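(* Let $A=(1\ a_2\ \cdots\ a_n)$ be an integer row matrix with $1<a_2<\cdots<a_n$ (put $a_1=1$), let $\beta\in\mathbb{C}$, $X=\mathbb{C}^n$, $Y=(x_n=0)\subset X$, $Z=(x_{n-1}=0)\subset X$. Then for all $p\in Y\setminus Z$ and all $s\ge a_n/a_{n-1}$: (i) If $\beta\notin\mathbb{N}$, then $$\mathcal{E}xt^0_{\mathcal{D}_X}(\mathcal{M}_A(\beta),\mathcal{Q}_Y(s))_p=\bigoplus_{j=0}^{a_{n-1}-1}\mathbb{C}\,\overline{\phi_{v^j,p}}.$$ (ii) If $\beta\in\mathbb{N}$, then there exists a unique $q\in\{0,\dots,a_{n-1}-1\}$ such that $\frac{\beta-q}{a_{n-1}}\in\mathbb{N}$, and $$\mathcal{E}xt^0_{\mathcal{D}_X}(\mathcal{M}_A(\beta),\mathcal{Q}_Y(s))_p=\bigoplus_{0\le j\le a_{n-1}-1,\ j\ne q}\mathbb{C}\,\overline{\phi_{v^j,p}}\ \oplus\ \mathbb{C}\,\overline{\phi_{\widetilde{v^q},p}}.$$ Here $\overline{\phi}$ denotes the class modulo $\mathcal{O}_{X|Y,p}$ of $\phi\in\mathcal{O}_{\widehat{X|Y},p}(s)$.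
   Context: $\mathbb{N}=\{0,1,2,\dots\}$. Hypergeometric system: $X=\mathbb{C}^n$ with coordinates $x_1,\dots,x_n$; $\mathcal{O}_X$ is the sheaf of holomorphic functions and $\mathcal{D}_X$ the sheaf of linear differential operators with holomorphic coefficients; $\partial_i=\partial/\partial x_i$. For a row matrix $A=(a_1\ \cdots\ a_n)$ of positive integers and $\beta\in\mathbb{C}$, $I_A\subset\mathbb{C}[\partial_1,\dots,\partial_n]$ is the toric ideal generated by all $\partial^{u_+}-\partial^{u_-}$, where $u\in\mathbb{Z}^n$, $Au=0$, $u=u_+-u_-$ with $u_\pm\in\mathbb{N}^n$ of disjoint support. $H_A(\beta)$ is the left ideal of the Weyl algebra $A_n(\mathbb{C})$ generated by $I_A$ and $E(\beta)=\sum_{j=1}^n a_jx_j\partial_j-\beta$, and $\mathcal{M}_A(\beta)=\mathcal{D}_X/\mathcal{D}_XH_A(\beta)$. Gevrey sheaves: $\mathcal{O}_{X|Y}$ is the restriction of $\mathcal{O}_X$ to $Y=(x_n=0)$, and $\mathcal{O}_{\widehat{X|Y}}=\varprojlim_k\mathcal{O}_X/(x_n^k)$. For real $s\ge1$, $\mathcal{O}_{\widehat{X|Y}}(s)$ is the subsheaf of Gevrey series of order $s$: a germ $f=\sum_{i\ge0}f_i(x_1,\dots,x_{n-1})x_n^i$ at $p\in Y$ lies in it iff $\sum_{i\ge0}\frac{1}{(i!)^{s-1}}f_i x_n^i$ converges at $p$. Put $\mathcal{O}_{\widehat{X|Y}}(\infty)=\mathcal{O}_{\widehat{X|Y}}$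 and $\mathcal{Q}_Y(s)=\mathcal{O}_{\widehat{X|Y}}(s)/\mathcal{O}_{X|Y}$, a left $\mathcal{D}_X$-module. $\mathcal{E}xt^0_{\mathcal{D}_X}(\mathcal{M}_A(\beta),\mathcal{Q}_Y(s))_p$ is identified with the space of $f\in\mathcal{Q}_Y(s)_p$ annihilated by $H_A(\beta)$. $\Gamma$-series: let $L_A=\{u\in\mathbb{Z}^n: Au=0\}$. For $z\in\mathbb{C}^n$, $\alpha\in\mathbb{N}^n$ let $(z)_\alpha=\prod_{i:\alpha_i>0}\prod_{l=0}^{\alpha_i-1}(z_i-l)$. For $v\in\mathbb{C}^n$ let $\mathrm{nsupp}(v)=\{i: v_i\in\mathbb{Z}_{<0}\}$, $N_v=\{u\in L_A:\mathrm{nsupp}(v+u)=\mathrm{nsupp}(v)\}$ and $$\phi_v=x^v\sum_{u\in N_v}\frac{(v)_{u_-}}{(v+u)_{u_+}}x^u .$$ For $0\le j\le a_{n-1}-1$ set $v^j=(j,0,\dots,0,\frac{\beta-j}{a_{n-1}},0)\in\mathbb{C}^n$ (nonzero entries allowed only in positions $1$ and $n-1$). Explicitly, the sum below being over $(m_2,\dots,m_n)\in\mathbb{N}^{n-1}$ with $e_j:=j-\sum_{2\le i\le n,\,i\ne n-1}a_im_i+a_{n-1}m_{n-1}\ge0$, $$\phi_{v^j}=\sum\frac{\big(\frac{\beta-j}{a_{n-1}}\big)_{m_{n-1}}\,j!}{m_2!\cdots m_{n-2}!\,m_n!\,e_j!}\;x_1^{e_j}x_2^{m_2}\cdots x_{n-2}^{m_{n-2}}x_{n-1}^{\frac{\beta-j}{a_{n-1}}-m_{n-1}}x_n^{m_n},$$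 where $(z)_m=z(z-1)\cdots(z-m+1)$. For $\beta\in\mathbb{N}$ and $q$ as in (ii), set $\widetilde{v^q}=(\beta+a_{n-1},0,\dots,0,-1,0)\in\mathbb{C}^n$ (entry $-1$ in position $n-1$). Explicitly, with sum over $(m_2,\dots,m_n)\in\mathbb{N}^{n-1}$ such that $e:=\beta+a_{n-1}+a_{n-1}m_{n-1}-\sum_{2\le i\le n,\,i\ne n-1}a_im_i\ge0$, $$\phi_{\widetilde{v^q}}=\sum\frac{(-1)^{m_{n-1}}m_{n-1}!\,(\beta+a_{n-1})!}{m_2!\cdots m_{n-2}!\,m_n!\,e!}\;x_1^{e}x_2^{m_2}\cdots x_{n-2}^{m_{n-2}}x_{n-1}^{-1-m_{n-1}}x_n^{m_n}.$$ For $p\in Y\setminus Z$, $\phi_{v,p}$ denotes the germ at $p$ of $\phi_v$, viewed as a series in $x_n$ with coefficients holomorphic near $p$ (for a chosen branch of $x_{n-1}^{(\beta-j)/a_{n-1}}$ near $p$). *)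

(* Defs.v *)
From HB Require Import structures.
From mathcomp Require Import all_boot all_order all_algebra complex finmap.
From mathcomp Require Import all_classical all_reals all_analysis.
From mathcomp Require Import showcase.summability.

Set Implicit Arguments.
Unset Strict Implicit.
Unset Printing Implicit Defensive.

Import Order.TTheory GRing.Theory Num.Theory.
Import numFieldNormedType.Exports.

Local Open Scope classical_set_scope.
Local Open Scope ring_scope.

(* The type ascription makes the topology and the normed module structure that
   MathComp-Analysis attaches to every numClosedFieldType available on R[i].  *)
Definition CC (R : realType) : numClosedFieldType := R[i].

Section ComplexFunctions.
Variable R : realType.

Definition cexp (z : CC R) : CC R :=
  let x := complex.Re z in let y := complex.Im z in
  ((expR x * cos y) +i* (expR x * sin y))%C.

(* b is a branch near z0 of the multivalued function z ^ gamma, that is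
   exp (gamma * log z) for a continuous determination of log near z0. *)
Definition is_power_branch (gamma z0 : CC R) (b : CC R -> CC R) : Prop :=
  exists log : CC R -> CC R, \forall z \near z0,
    [/\ {for z, continuous log}, cexp (log z) = z
      & b z = cexp (gamma * log z)].

(* The falling factorial (z)_m = z (z - 1) ... (z - m + 1). *)
Definition cffact (z : CC R) (m : nat) : CC R := \prod_(l < m) (z - l%:R).

(* f has a power series expansion at p that converges to f near p; the sum over
   multi-indices is the unconditional one (limit along finite subsets).
   A function is holomorphic on an open set when it is analytic at each point
   of that set. *)
Definition analytic_at m (f : 'rV[CC R]_m -> CC R) (p : 'rV[CC R]_m) : Prop :=
  exists c : {ffun 'I_m -> nat} -> CC R, \forall x \near p,
    partial_sum (fun alpha : {ffun 'I_m -> nat} =>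
        c alpha * \prod_i ((x : 'rV_m) 0 i - p 0 i) ^+ alpha i)
      @ totally --> f x.

End ComplexFunctions.

Section Germs.
Variables (R : realType) (m : nat).

(* X = C^(m+1), and Y is the hyperplane where the last coordinate vanishes.
   A series sum_i f_i(x_1, ..., x_m) x_(m+1)^i is the sequence of the f_i.  Germs
   are represented by total functions; every predicate below depends only on
   their values near the base point. *)
Definition fseries := nat -> 'rV[CC R]_m -> CC R.

Definition ycoord (x : 'rV[CC R]_m.+1) : 'rV[CC R]_m := col' ord_max x.

(* Stalk at p of lim_k O_X / (x_(m+1)^k): all the coefficients are holomorphic
   on one and the same neighbourhood of p in Y. *)
Definition formal_germ (p : 'rV[CC R]_m.+1) (f : fseries) : Prop :=
  \forall y \near ycoord p, forall i, analytic_at (f i) y.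

(* Stalk at p of O_{X|Y}, as a subspace of the previous one. *)
Definition convergent_germ (p : 'rV[CC R]_m.+1) (f : fseries) : Prop :=
  exists F : 'rV[CC R]_m.+1 -> CC R, \forall x \near p,
    analytic_at F x /\
    series (fun i => f i (ycoord x) * x 0 ord_max ^+ i) @ \oo --> F x.

(* Gevrey series of order s; order +oo imposes no growth condition. *)
Definition gevrey_germ (s : \bar R) (p : 'rV[CC R]_m.+1) (f : fseries) : Prop :=
  formal_germ p f /\
  forall r : R, s = r%:E ->
    convergent_germ p
      (fun i y => f i y / ((i`!%:R : R) `^ (r - 1))%:C%C).

End Germs.

(* Noncommutative polynomial expressions in x_i and d_i: every element of the
   Weyl algebra is the class of such an expression. *)
Inductive weyl (K : Type) (N : nat) : Type :=
| Wcst of K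
| Wx of 'I_N
| Wd of 'I_N
| Wadd of weyl K N & weyl K N
| Wmul of weyl K N & weyl K N.

Arguments Wcst {K N} _.
Arguments Wx {K N} _.
Arguments Wd {K N} _.

(* The elements of K[d_1, ..., d_N]. *)
Fixpoint no_x K N (P : weyl K N) : bool :=
  match P with
  | Wcst _ | Wd _ => true
  | Wx _ => false
  | Wadd P Q | Wmul P Q => no_x P && no_x Q
  end.

(* Left ideal generated by S when the multipliers range over B. *)
Inductive left_ideal (K : pzRingType) N (B S : weyl K N -> Prop) :
    weyl K N -> Prop :=
| left_ideal_gen P of S P : left_ideal B S P
| left_ideal0 : left_ideal B S (Wcst 0)
| left_idealD P Q of left_ideal B S P & left_ideal B S Q :
    left_ideal B S (Wadd P Q)
| left_idealM P Q of B P & left_ideal B S Q : left_ideal B S (Wmul P Q).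

Section HypergeometricIdeal.
Variables (K : pzRingType) (N : nat) (a : 'I_N -> nat).

Definition Wdmon (u : 'I_N -> nat) : weyl K N :=
  \big[@Wmul K N/Wcst 1]_(i < N) iter (u i) (Wmul (Wd i)) (Wcst 1).

Definition posp (u : 'I_N -> int) (i : 'I_N) : nat := `|Num.max (u i) 0|%N.
Definition negp (u : 'I_N -> int) (i : 'I_N) : nat := `|Num.max (- u i) 0|%N.

Definition toric_binomial (P : weyl K N) : Prop :=
  exists u : 'I_N -> int, \sum_i (a i)%:Z * u i = 0 /\
    P = Wadd (Wdmon (posp u)) (Wmul (Wcst (- 1)) (Wdmon (negp u))).

Definition toric_ideal : weyl K N -> Prop :=
  left_ideal (fun P => no_x P) toric_binomial.

Definition euler_op (beta : K) : weyl K N :=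
  Wadd (\big[@Wadd K N/Wcst 0]_(j < N)
          Wmul (Wcst (a j)%:R) (Wmul (Wx j) (Wd j)))
       (Wcst (- beta)).

Definition hyp_ideal (beta : K) : weyl K N -> Prop :=
  left_ideal (fun _ => True) (fun P => toric_ideal P \/ P = euler_op beta).

End HypergeometricIdeal.

Section Solutions.
Variables (R : realType) (m : nat).

Definition mul_x (k : 'I_m.+1) (f : fseries R m) : fseries R m :=
  if unlift ord_max k is Some k' then fun i y => y 0 k' * f i y
  else fun i y => if i is i'.+1 then f i' y else 0.

Definition diff_x (k : 'I_m.+1) (f : fseries R m) : fseries R m :=
  if unlift ord_max k is Some k' then fun i y => 'D_(delta_mx 0 k') (f i) y
  else fun i y => i.+1%:R * f i.+1 y.

Fixpoint wact (P : weyl (CC R) m.+1) (f : fseries R m) : fseries R m :=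
  match P with
  | Wcst c => fun i y => c * f i y
  | Wx k => mul_x k f
  | Wd k => diff_x k f
  | Wadd P Q => fun i y => wact P f i y + wact Q f i y
  | Wmul P Q => wact P (wact Q f)
  end.

(* The class of f modulo convergent series is annihilated by H_A(beta). *)
Definition annihilated (a : 'I_m.+1 -> nat) (beta : CC R) (p : 'rV[CC R]_m.+1)
    (f : fseries R m) : Prop :=
  forall P, hyp_ideal a beta P -> convergent_germ p (wact P f).

(* In Q_Y(s)_p, the space Ext^0(M_A(beta), Q_Y(s))_p of classes annihilated by
   H_A(beta) is the direct sum of the lines spanned by the classes of the
   Phi j. *)
Definition ext0_direct_sum (a : 'I_m.+1 -> nat) (beta : CC R) (s : \bar R)
    (p : 'rV[CC R]_m.+1) d (Phi : 'I_d -> fseries R m) : Prop :=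
  [/\ forall j, gevrey_germ s p (Phi j),
      forall f, gevrey_germ s p f ->
        (annihilated a beta p f <->
         exists lam : 'I_d -> CC R,
           convergent_germ p (fun i y => f i y - \sum_j lam j * Phi j i y))
    & forall lam : 'I_d -> CC R,
        convergent_germ p (fun i y => \sum_j lam j * Phi j i y) ->
        forall j, lam j = 0].

End Solutions.

Section GammaSeries.
Variables (R : realType) (n : nat) (a : 'I_n.+3 -> nat).

(* X = C^(n+3) with coordinates x_1, ..., x_N, N = n + 3; this is the index of
   x_(N-1). *)
Definition penult : 'I_n.+3 := lift ord_max ord_max.

(* The Gamma-series phi_v for v = (J, 0, ..., 0, gamma, 0), where J is a natural
   number and b is the chosen branch of x_(N-1)^gamma.  The coefficient of x_N^i
   is the sum over k = (m_2, ..., m_(N-1)), with m_N = i; the last entry of k is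
   m_(N-1), and y = (x_1, ..., x_(N-1)).
   For gamma = -1, (gamma)_m is (-1)^m m!. *)
Definition gamma_series (J : nat) (gamma : CC R) (b : CC R -> CC R) :
    fseries R n.+2 :=
  fun i y => sum (fun k : {ffun 'I_n.+1 -> nat} =>
    let r := k ord_max in
    let w := (\sum_(l < n.+1 | l != ord_max) a (lift ord_max (lift ord0 l)) * k l
              + a ord_max * i)%N in
    let e := (J + a penult * r - w)%N in
    if (w <= J + a penult * r)%N then
      cffact gamma r * J`!%:R
        / (\prod_(l < n.+1 | l != ord_max) (k l)`!%:R * i`!%:R * e`!%:R)
      * y 0 ord0 ^+ e
      * \prod_(l < n.+1 | l != ord_max) y 0 (lift ord0 l) ^+ k l
      * (b (y 0 ord_max) * y 0 ord_max ^- r)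
    else 0).

Definition vexp (beta : CC R) (j : nat) : CC R := (beta - j%:R) / (a penult)%:R.

Definition phi_v (beta : CC R) (b : CC R -> CC R) (j : nat) : fseries R n.+2 :=
  gamma_series j (vexp beta j) b.

Definition phi_vtilde (beta : nat) : fseries R n.+2 :=
  gamma_series (beta + a penult) (- 1) (fun z => z^-1).

End GammaSeries.

Definition is_natC (R : realType) (z : CC R) : Prop := exists k : nat, z = k%:R.

(* Main.v *)
(* A formal germ f at p is encoded by the array of its derivatives d_al = (D^al f)(p), al in N^N:
   D_i becomes a shift, x_i becomes d_al |-> p_i d_al + al_i d_(al - e_i), and f converges iff
   |d_al| <= M B^|al| |al|!.  Modulo convergent germs, the toric relations D_i = D_1^(a_i) then say
   that d_al = u_(wt al) for a sequence u, with wt al = sum_i a_i al_i, and the Euler relation says that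
     (T u)_k = sum_(i < N) a_i p_i u_(k + a_i) + (k - beta) u_k
   is small, that is O(B^k (k / a_N)!).  The term with i = N is absent because p_N = 0, so the first
   sum is dominated by (k - beta) u_k on small sequences: T is bijective on them, up to the
   index k = beta when beta is a natural number.  Hence the solutions modulo convergent germs
   correspond to ker T, a forward recursion of order a_(N-1) as p_(N-1) != 0; and if beta is natural,
   the polynomial solution, whose sequence vanishes beyond beta, is replaced by a sequence v with
   (T v)_k = 0 for k > beta and (T v)_beta != 0.  The Gamma-series are expanded at
   (0, ..., 0, p_(N-1)), where their derivatives are explicit, and recentered at p: their arrays are,
   modulo convergent ones, given by the sequences required. *)

Require Import Defs.
From HB Require Import structures.
From mathcomp Require Import all_boot all_order all_algebra complex finmap.
From mathcomp Require Import all_classical all_reals all_analysis.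
From mathcomp Require Import showcase.summability.
From mathcomp Require Import ring lra zify.

Set Implicit Arguments.
Unset Strict Implicit.
Unset Printing Implicit Defensive.

Import Order.TTheory GRing.Theory Num.Theory.
Import numFieldNormedType.Exports.

Local Open Scope classical_set_scope.
Local Open Scope ring_scope.

(** * The real-valued modulus *)

(** A multi-index of weight k has order at least k / a_N, as a_N is the largest weight: this is the
    origin of the bound O(B^k (k / a_N)!). The obstacle to d_al = u_(wt al) is that D_i = D_1^(a_i)
    raises the order from 1 to a_i, and an order that rises in proportion ruins factorial bounds;
    D_1^(a_N) is therefore traded for D_N as soon as it appears, so that orders rise by a bounded
    amount only. In T, a shift by a_j < a_N passes at most one multiple of a_N, which costs a factor
    comparable to k; a weight depending on k mod a_N makes the constant small enough for k - beta to
    absorb it. The kernel of T grows like (k / a_(N-1))!. For k = a_N i, after division by i!, this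
    is Gevrey order a_N / a_(N-1): all formal solutions modulo convergent germs have that order
    already, hence one answer for all larger s. Recentering reaches p, however far from (0, ..., 0,
    p_(N-1)), because x_1, ..., x_(N-2) have weights below a_(N-1), so that the coefficients of the
    powers of x_N converge for all values of these variables. *)

Definition nm (R : realType) (z : CC R) : R := complex.Re (`|z| : CC R).

Section Norm.
Variable R : realType.
Implicit Types x y z : CC R.

Lemma normE z : `|z| = (nm z)%:C%C :> CC R.
Proof. by rewrite /nm RRe_real // normr_real. Qed.

Lemma nm_ge0 z : 0 <= nm z.
Proof. by have := normr_ge0 z; rewrite normE ler0c. Qed.

Lemma nmM x y : nm (x * y) = nm x * nm y.
Proof. by apply: complexI; rewrite rmorphM /= -!normE normrM. Qed.

Lemma nmD x y : nm (x + y) <= nm x + nm y.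
Proof. by rewrite -lecR rmorphD /= -!normE ler_normD. Qed.

Lemma nmN x : nm (- x) = nm x.
Proof. by apply: complexI; rewrite -!normE normrN. Qed.

Lemma nm_real (r : R) : nm (r%:C%C : CC R) = `|r|.
Proof.
apply: complexI; rewrite -normE; etransitivity; first exact: normc_def.
by rewrite /= expr0n /= addr0 sqrtr_sqr.
Qed.

Lemma nm0 : nm (0 : CC R) = 0.
Proof. by rewrite /nm normr0. Qed.

Lemma nm1 : nm (1 : CC R) = 1.
Proof. by rewrite /nm normr1. Qed.

Lemma nm_nat k : nm (k%:R : CC R) = k%:R.
Proof. by apply: complexI; rewrite -normE normr_nat rmorph_nat. Qed.

Lemma nm_eq0 z : (nm z == 0) = (z == 0).
Proof. by rewrite -(inj_eq (@complexI R)) -normE normr_eq0. Qed.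

Lemma nm_gt0 z : (0 < nm z) = (z != 0).
Proof. by rewrite lt_neqAle nm_ge0 andbT eq_sym nm_eq0. Qed.

Lemma nmX z k : nm (z ^+ k) = nm z ^+ k.
Proof. by elim: k => [|k IH]; rewrite ?expr0 ?nm1 // !exprS nmM IH. Qed.

Lemma nmV z : nm z^-1 = (nm z)^-1.
Proof. by apply: complexI; rewrite fmorphV /= -!normE normfV. Qed.

Lemma nm_sum (I : Type) (r : seq I) (P : pred I) (F : I -> CC R) :
  nm (\sum_(i <- r | P i) F i) <= \sum_(i <- r | P i) nm (F i).
Proof.
elim/big_rec2: _ => [|i u v _ h]; first by rewrite nm0.
by apply: le_trans (nmD _ _) _; rewrite lerD2l.
Qed.

Lemma nm_prod (I : Type) (r : seq I) (P : pred I) (F : I -> CC R) :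
  nm (\prod_(i <- r | P i) F i) = \prod_(i <- r | P i) nm (F i).
Proof. by elim/big_rec2: _ => [|i u v _ <-]; rewrite ?nm1 ?nmM. Qed.

Lemma nmB x y : nm (x - y) <= nm x + nm y.
Proof. by rewrite -(nmN y) nmD. Qed.

Lemma nm_distC x y : nm (x - y) = nm (y - x).
Proof. by rewrite -nmN opprB. Qed.

Lemma nm_dist3 y x z : nm (x - z) <= nm (x - y) + nm (y - z).
Proof. by have := nmD (x - y) (y - z); rewrite addrA subrK. Qed.

Lemma nm_i : nm ('i%C : CC R) = 1.
Proof.
apply: complexI; rewrite -normE; etransitivity; first exact: normc_def.
by rewrite /= expr0n /= add0r expr1n sqrtr1.
Qed.

Lemma nm_Re z : `|complex.Re z| <= nm z.
Proof. by have := normc_ge_Re z; rewrite normE lecR. Qed.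

Lemma nm_Im z : `|complex.Im z| <= nm z.
Proof.
have := nm_Re (z * 'i%C); by rewrite ReiNIm normrN nmM nm_i mulr1.
Qed.

Lemma nm_ReIm z : nm z <= `|complex.Re z| + `|complex.Im z|.
Proof.
rewrite {1}[z]complexE; apply: le_trans (nmD _ _) _; by rewrite nmM !nm_real nm_i mul1r.
Qed.

(** Positive elements of [CC R] are real, so balls with radii in [CC R] can be given radii in [R],
    and all estimates can be made in the ordered field [R]. *)
Lemma nbhs_nmP z (P : set (CC R)) :
  (\forall x \near z, P x) <-> exists2 e : R, 0 < e & forall x, nm (x - z) < e -> P x.
Proof.
split=> [/nbhs_ballP [e e0 he]|[e e0 he]].
  have [e' ee'] : exists e' : R, e = e'%:C%C.
    by exists (complex.Re e); rewrite RRe_real // gtr0_real.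
  exists e' => [|x hx]; first by move: e0; rewrite /= ee' ltcR.
  by apply: he; rewrite /ball /= ee' normE ltcR nm_distC.
apply/nbhs_ballP; exists (e%:C%C) => /=; first by rewrite ltcR.
by move=> x; rewrite /ball /= normE ltcR nm_distC => /he.
Qed.

Lemma nbhs_rowP m (p : 'rV[CC R]_m) (P : set 'rV[CC R]_m) :
  (\forall x \near p, P x) <->
  exists2 e : R, 0 < e & forall x : 'rV_m, (forall i, nm (x 0 i - p 0 i) < e) -> P x.
Proof.
split=> [/nbhs_ballP [e e0 he]|[e e0 he]].
  have [e' ee'] : exists e' : R, e = e'%:C%C.
    by exists (complex.Re e); rewrite RRe_real // gtr0_real.
  exists e' => [|x hx]; first by move: e0; rewrite /= ee' ltcR.
  by apply: he; split=> // i j; rewrite ord1 /ball /= ee' normE ltcR nm_distC.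
apply/nbhs_ballP; exists (e%:C%C) => /=; first by rewrite ltcR.
move=> x [_ hx]; apply: he => i; have := hx 0 i.
by rewrite /ball /= normE ltcR nm_distC.
Qed.

Lemma cvg_nmP T (F : set_system T) {FF : Filter F} (f : T -> CC R) (l : CC R) :
  f @ F --> l <-> forall e : R, 0 < e -> \forall t \near F, nm (f t - l) < e.
Proof.
split=> [h e e0|h].
  have : nbhs l [set x | nm (x - l) < e] by apply/nbhs_nmP; exists e.
  by move/h.
by move=> P /nbhs_nmP [e e0 he]; apply: filterS (h _ e0) => t /he.
Qed.

End Norm.

(** * Unconditional sums *)

(** A relation, because [sum f] has a value even when the family does not converge. *)
Definition has_sum (R : realType) (I : choiceType) (f : I -> CC R) (s : CC R) :=
  partial_sum f @ totally --> s.

Lemma ler_sum_sub (R : numDomainType) (I : eqType) (s t : seq I) (F : I -> R) :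
  uniq s -> {subset s <= t} -> (forall i, 0 <= F i) ->
  \sum_(i <- s) F i <= \sum_(i <- t) F i.
Proof.
move=> us st F0; apply: (@le_trans _ _ (\sum_(i <- undup t | i \in s) F i)).
  rewrite -[X in _ <= X]big_filter [X in _ <= X](perm_big s) //.
  apply: uniq_perm => //; first by rewrite filter_uniq ?undup_uniq.
  by move=> i; rewrite mem_filter mem_undup; case: (boolP (i \in s)) => // /st ->.
apply: (@le_trans _ _ (\sum_(i <- undup t) F i)).
  by rewrite [X in _ <= X](bigID (mem s)) /= lerDl sumr_ge0.
elim: t {st} => [//|x t IH] /=; rewrite big_cons; case: ifP => _.
  by apply: le_trans IH _; rewrite lerDr.
by rewrite big_cons lerD2l.
Qed.

Section HasSum.
Variable R : realType.
Implicit Types I J : choiceType.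

Lemma partial_sumE I (f : I -> CC R) (A : {fset I}) :
  partial_sum f A = \sum_(i <- A) f i.
Proof. by rewrite /partial_sum (big_seq_fsetE _ _ (fun _ => true)). Qed.

Lemma has_sumP I (f : I -> CC R) s : has_sum f s <->
  forall e : R, 0 < e -> exists A : {fset I},
    forall B : {fset I}, (A `<=` B)%fset -> nm (\sum_(i <- B) f i - s) < e.
Proof.
rewrite /has_sum; split=> [/(cvg_nmP (FF := totally_filter)) h e e0|h].
  have [A _ hA] := h _ e0; exists A => B AB.
  by rewrite -partial_sumE; exact: hA.
apply/(cvg_nmP (FF := totally_filter)) => e e0.
have [A hA] := h _ e0; exists A => // B AB.
by rewrite /= partial_sumE; exact: hA.
Qed.

Lemma has_sum_uniq I (f : I -> CC R) s t : has_sum f s -> has_sum f t -> s = t.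
Proof. exact: (@cvg_unique _ (@norm_hausdorff _ _) _ (fmap_proper_filter _ totally_filter)). Qed.

Lemma has_sum_sum I (f : I -> CC R) s : has_sum f s -> sum f = s.
Proof. exact: (@cvg_lim _ (@norm_hausdorff _ _) _ _ totally_filter). Qed.

Lemma eq_has_sum I (f g : I -> CC R) s : f =1 g -> has_sum f s -> has_sum g s.
Proof. by move=> /funext ->. Qed.

Lemma has_sumD I (f g : I -> CC R) s t :
  has_sum f s -> has_sum g t -> has_sum (fun i => f i + g i) (s + t).
Proof.
move=> /has_sumP hf /has_sumP hg; apply/has_sumP => e e0.
have e2 : 0 < e / 2 by rewrite divr_gt0.
have [A hA] := hf _ e2; have [B hB] := hg _ e2.
exists (A `|` B)%fset => D; rewrite fsubUset => /andP[AD BD].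
rewrite big_split /= opprD addrACA [e]splitr.
by apply: le_lt_trans (nmD _ _) _; rewrite ltrD ?hA ?hB.
Qed.

Lemma has_sumZ I (f : I -> CC R) s c : has_sum f s -> has_sum (fun i => c * f i) (c * s).
Proof.
move=> /has_sumP hf; apply/has_sumP => e e0.
have c0 : 0 < nm c + 1 by rewrite ltr_wpDl ?nm_ge0.
have [A hA] := hf (e / (nm c + 1)) (divr_gt0 e0 c0).
exists A => B /hA h; rewrite -mulr_sumr -mulrBr nmM.
apply: (@le_lt_trans _ _ ((nm c + 1) * nm (\sum_(i <- B) f i - s))).
  by rewrite ler_wpM2r ?nm_ge0 // lerDl.
by rewrite mulrC -ltr_pdivlMr.
Qed.

Lemma has_sum_fin I (f : I -> CC R) (A : {fset I}) :
  (forall i, i \notin A -> f i = 0) -> has_sum f (\sum_(i <- A) f i).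
Proof.
move=> h; apply/has_sumP => e e0; exists A => B AB.
rewrite [X in nm (X - _)](bigID (mem A)) /= [X in _ + X - _]big1 ?addr0; last by move=> i /h.
rewrite -big_filter (perm_big A) ?subrr ?nm0 //=.
apply: uniq_perm; rewrite ?filter_uniq ?fset_uniq // => i.
rewrite mem_filter; case: (boolP (i \in A)) => //= iA.
by rewrite (fsubsetP AB).
Qed.

Lemma has_sum0 I (f : I -> CC R) : (forall i, f i = 0) -> has_sum f 0.
Proof.
by move=> h; have := @has_sum_fin I f fset0 (fun i _ => h i); rewrite big_seq_fset0.
Qed.

Lemma has_sum_big I (T : Type) (r : seq T) (P : pred T) (f : T -> I -> CC R) (s : T -> CC R) :
  (forall t, P t -> has_sum (f t) (s t)) ->
  has_sum (fun i => \sum_(t <- r | P t) f t i) (\sum_(t <- r | P t) s t).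
Proof.
move=> h; elim: r => [|t r IH].
  by rewrite big_nil; apply: has_sum0 => i; rewrite big_nil.
rewrite big_cons; case: ifP => Pt.
  by apply: eq_has_sum (has_sumD (h _ Pt) IH) => i; rewrite big_cons Pt.
by apply: eq_has_sum IH => i; rewrite big_cons Pt.
Qed.

(** Outside a finite set every term is the difference of two partial sums that lie within 1 of s.
    This turns convergence at one point into Cauchy estimates. *)
Lemma has_sum_term_bound I (f : I -> CC R) s :
  has_sum f s -> exists2 M : R, 0 <= M & forall i, nm (f i) <= M.
Proof.
move=> /has_sumP /(_ 1 ltr01) [A hA].
exists (2 + \sum_(i <- A) nm (f i)) => [|i].
  by rewrite addr_ge0 // sumr_ge0 // => i _; exact: nm_ge0.
have [iA|iA] := boolP (i \in A).
  apply: ler_wpDl => //; rewrite (big_rem i) //= lerDl sumr_ge0 // => j _; exact: nm_ge0.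
have h1 := hA A (fsubset_refl _).
have h2 := hA (i |` A)%fset (fsubsetU1 _ _).
rewrite big_fsetU1 //= in h2.
have -> : f i = (f i + \sum_(i <- A) f i - s) - (\sum_(i <- A) f i - s) by ring.
apply: le_trans (nmB _ _) _.
have : 0 <= \sum_(i <- A) nm (f i) by rewrite sumr_ge0 // => j _; exact: nm_ge0.
lra.
Qed.

Lemma has_sum_le I (f : I -> CC R) s (M : R) : has_sum f s ->
  (forall A : {fset I}, \sum_(i <- A) nm (f i) <= M) -> nm s <= M.
Proof.
move=> /has_sumP h hM; apply/ler_addgt0Pr => e e0.
have [A hA] := h e e0; have := hA A (fsubset_refl _); rewrite nm_distC => h1.
have -> : s = (s - \sum_(i <- A) f i) + \sum_(i <- A) f i by rewrite subrK.
apply: le_trans (nmD _ _) _; rewrite addrC lerD //; last exact: ltW.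
by apply: le_trans (nm_sum _ _ _) _.
Qed.

Lemma nneg_has_sum_ex I (g : I -> R) (M : R) : (forall i, 0 <= g i) ->
  (forall A : {fset I}, \sum_(i <- A) g i <= M) ->
  exists s, has_sum (fun i => (g i)%:C%C : CC R) s.
Proof.
move=> g0 hM; pose S := [set (\sum_(i <- A) g i)%R | A in [set: {fset I}]].
have hS : has_sup S.
  split; first by exists (\sum_(i <- fset0) g i); exists fset0.
  by exists M => _ [A _ <-].
exists ((sup S)%:C%C); apply/has_sumP => e e0.
have [_ [A _ <-] hA] := sup_adherent e0 hS.
exists A => B AB; have -> : \sum_(i <- B) ((g i)%:C%C : CC R) = (\sum_(i <- B) g i)%:C%C.
  by rewrite rmorph_sum.
rewrite -rmorphB /= nm_real.
have h1 : \sum_(i <- A) g i <= \sum_(i <- B) g i.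
  by apply: ler_sum_sub => //; exact/fsubsetP.
have h2 : \sum_(i <- B) g i <= sup S by apply: ub_le_sup; [exact: hS.2|exists B].
by rewrite ler0_norm ?subr_le0 // opprB; lra.
Qed.

(** The real and imaginary parts g are written as the difference of (|g| + g) / 2 and (|g| - g) / 2,
    to which the supremum argument for nonnegative families applies. *)
Lemma abs_has_sum_ex I (f : I -> CC R) (M : R) :
  (forall A : {fset I}, \sum_(i <- A) nm (f i) <= M) -> exists s, has_sum f s.
Proof.
move=> hM.
have real_part (g : I -> R) : (forall i, `|g i| <= nm (f i)) ->
    exists s, has_sum (fun i => (g i)%:C%C : CC R) s.
  move=> hg.
  have aux (h : I -> R) : (forall i, 0 <= h i <= nm (f i)) ->
      exists s, has_sum (fun i => (h i)%:C%C : CC R) s.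
    move=> hh; apply: (@nneg_has_sum_ex _ _ M) => [i|A]; first by have /andP[] := hh i.
    by apply: le_trans (hM A); apply: ler_sum => i _; have /andP[] := hh i.
  have [s1 h1] : exists s, has_sum (fun i => ((`|g i| + g i) / 2)%:C%C : CC R) s.
    by apply: aux => i; have := hg i; have := lerNnormlW (lexx `|g i|); have := ler_norm (g i); lra.
  have [s2 h2] : exists s, has_sum (fun i => ((`|g i| - g i) / 2)%:C%C : CC R) s.
    by apply: aux => i; have := hg i; have := lerNnormlW (lexx `|g i|); have := ler_norm (g i); lra.
  exists (s1 + (-1) * s2); move: (has_sumD h1 (has_sumZ (c := -1) h2)); apply: eq_has_sum => i.
  rewrite mulN1r -rmorphB; congr (_%:C%C); lra.
have [s1 h1] := real_part (fun i => complex.Re (f i)) (fun i => nm_Re _).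
have [s2 h2] := real_part (fun i => complex.Im (f i)) (fun i => nm_Im _).
eexists; apply: eq_has_sum (has_sumD h1 (has_sumZ (c := 'i%C) h2)) => i.
by rewrite [RHS]complexE.
Qed.

(** The bijection is between the supports: shifts of exponents by truncated subtraction are
    invertible only there. *)
Lemma has_sum_reindex I J (e : I -> J) (e' : J -> I) (P : pred I) (Q : pred J)
    (f : I -> CC R) (g : J -> CC R) s :
  (forall i, P i -> Q (e i) /\ e' (e i) = i) ->
  (forall j, Q j -> P (e' j) /\ e (e' j) = j) ->
  (forall i, ~~ P i -> f i = 0) -> (forall j, ~~ Q j -> g j = 0) ->
  (forall i, P i -> f i = g (e i)) ->
  has_sum g s -> has_sum f s.
Proof.
move=> eP eQ f0 g0 fg /has_sumP hg; apply/has_sumP => r r0.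
have [A hA] := hg r r0.
exists [fset e' j | j in A & Q j]%fset => B AB.
pose B2 := (A `|` [fset e i | i in B & P i])%fset.
suff -> : \sum_(i <- B) f i = \sum_(j <- B2) g j by apply: hA; exact: fsubsetUl.
rewrite (bigID P) /= [X in _ + X]big1 ?addr0 //.
rewrite [RHS](bigID Q) /= [X in _ = _ + X]big1 ?addr0 //.
rewrite (eq_bigr (g \o e)); last by move=> i /fg.
rewrite -big_filter -[RHS]big_filter /=.
transitivity (\sum_(j <- map e [seq i <- B | P i]) g j); first by rewrite big_map.
apply: perm_big; apply: uniq_perm.
- rewrite map_inj_in_uniq ?filter_uniq ?fset_uniq // => i j.
  rewrite !mem_filter => /andP[Pi _] /andP[Pj _] h.
  by rewrite -(eP i Pi).2 h (eP j Pj).2.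
- by rewrite filter_uniq ?fset_uniq.
move=> j; rewrite mem_filter; apply/mapP/andP; last move=> [Qj].
  move=> [ i ]; rewrite mem_filter => /andP[Pi iB] ->; split; first exact: (eP i Pi).1.
  by rewrite inE; apply/orP; right; apply/imfsetP; exists i => //=; rewrite inE iB.
rewrite inE => /orP[jA|/imfsetP [i /=]].
  exists (e' j); last by rewrite (eQ j Qj).2.
  rewrite mem_filter (eQ j Qj).1 /=; apply: (fsubsetP AB).
  by apply/imfsetP; exists j => //=; rewrite inE jA.
by rewrite inE => /andP[iB Pi] ->; exists i => //; rewrite mem_filter Pi.
Qed.

Lemma has_sum_bij I J (e : I -> J) (e' : J -> I) (g : J -> CC R) s :
  cancel e e' -> cancel e' e -> has_sum g s -> has_sum (g \o e) s.
Proof.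
by move=> c1 c2; apply: (@has_sum_reindex _ _ e e' predT predT).
Qed.

(** One finite rectangle does both jobs: it contains A, so its sum is close to s, and its rows are
    long enough to be close to the [t i]. *)
Lemma has_sum_fubini I J (F : I * J -> CC R) s (t : I -> CC R) :
  has_sum F s -> (forall i, has_sum (fun j => F (i, j)) (t i)) -> has_sum t s.
Proof.
move=> /has_sumP hF ht; apply/has_sumP => e e0.
have e2 : 0 < e / 2 by rewrite divr_gt0.
have [A hA] := hF _ e2.
exists [fset x.1 | x in A]%fset => B AB.
(* The rows are fixed by now, so that the errors of all of them together stay below e / 2; the
   successor keeps the denominator nonzero. *)
pose d := e / 2 / (size B).+1%:R.
have d0 : 0 < d by rewrite divr_gt0.
have /choice [D hD] : forall i, exists D : {fset J}, forall E : {fset J},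
    (D `<=` E)%fset -> nm (\sum_(j <- E) F (i, j) - t i) < d.
  by move=> i; have /has_sumP/(_ _ d0) := ht i.
pose E : {fset J} := [fset j in [seq x.2 | x <- A] ++ flatten [seq (D i : seq J) | i <- B]]%fset.
pose G := [fset x in [seq (i, j) | i <- B, j <- E]]%fset.
have eG : \sum_(x <- G) F x = \sum_(i <- B) \sum_(j <- E) F (i, j).
  rewrite -big_allpairs; apply: perm_big; apply: uniq_perm; rewrite ?fset_uniq //.
    by apply: allpairs_uniq; rewrite ?fset_uniq // => -[? ?] [? ?].
  by move=> x; rewrite inE.
have AG : (A `<=` G)%fset.
  apply/fsubsetP => -[i j] xA; rewrite inE /=; apply/allpairsP; exists (i, j); split=> //=.
    by apply: (fsubsetP AB); apply/imfsetP; exists (i, j).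
  by apply/imfsetP; exists j => //=; rewrite mem_cat; apply/orP; left; apply/mapP; exists (i, j).
have h1 := hA G AG; rewrite eG in h1.
have h2 : nm (\sum_(i <- B) (t i - \sum_(j <- E) F (i, j))) <= e / 2.
  apply: le_trans (nm_sum _ _ _) _.
  apply: (@le_trans _ _ (\sum_(i <- B) d)).
    rewrite big_seq [X in _ <= X]big_seq; apply: ler_sum => i iB; rewrite nm_distC ltW //; apply: hD.
    apply/fsubsetP => j jD; apply/imfsetP; exists j => //=; rewrite mem_cat; apply/orP; right.
    by apply/flattenP; exists (D i : seq J) => //; apply/mapP; exists i.
  rewrite big_const_seq count_predT iter_addr_0 -[X in X <= _]mulr_natr /d -[X in X <= _]mulrA.
  rewrite ler_piMr ?(ltW e2) // mulrC ler_pdivrMr // mul1r ler_nat //.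
rewrite sumrB in h2.
rewrite [e]splitr; apply: le_lt_trans (nm_dist3 (\sum_(i <- B) \sum_(j <- E) F (i, j)) _ _) _.
by rewrite ler_ltD.
Qed.

Lemma has_sum_fubini_swap I J (F : I * J -> CC R) s (t : J -> CC R) :
  has_sum F s -> (forall j, has_sum (fun i => F (i, j)) (t j)) -> has_sum t s.
Proof.
move=> hF ht; apply: (@has_sum_fubini _ _ (fun x => F (x.2, x.1))) => //.
by apply: (has_sum_bij (e := fun x => (x.2, x.1)) (e' := fun x => (x.2, x.1)) _ _ hF); case.
Qed.

Lemma has_sum_series (f : nat -> CC R) s : has_sum f s -> series f @ \oo --> s.
Proof.
move=> /has_sumP h; apply/cvg_nmP => e e0; have [A hA] := h e e0.
exists (\max_(i <- A) i).+1%N => // n /= hn.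
have := hA [fset i in index_iota 0 n]%fset.
rewrite /series /=; suff -> : \sum_(i <- [fset i in index_iota 0 n]%fset) f i = \sum_(0 <= i < n) f i.
  apply; apply/fsubsetP => i iA; rewrite inE mem_index_iota /=.
  by apply: leq_trans hn; rewrite ltnS; exact: leq_bigmax_seq.
apply: perm_big; apply: uniq_perm; rewrite ?fset_uniq ?iota_uniq // => i.
by rewrite inE.
Qed.

End HasSum.

Section Products.
Variables (R : realType) (m : nat).
Implicit Type al : {ffun 'I_m -> nat}.

Let of_box L (b : {ffun 'I_m -> 'I_L}) : {ffun 'I_m -> nat} := [ffun i => b i : nat].

Let box_of L (A : {fset {ffun 'I_m -> nat}}) al : al \in A ->
  (forall al, al \in A -> forall i, (al i < L)%N) ->
  al \in [seq of_box b | b <- enum {: {ffun 'I_m -> 'I_L}}].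
Proof.
move=> alA hL; apply/mapP; exists [ffun i => Ordinal (hL _ alA i)]; first by rewrite mem_enum.
by apply/ffunP => i; rewrite !ffunE.
Qed.

(** A finite set of multi-indices lies in a box, and over a box the sum of the products factors. *)
Lemma ler_sum_prod (g : 'I_m -> nat -> R) (G : 'I_m -> R) (A : {fset {ffun 'I_m -> nat}}) :
  (forall i l, 0 <= g i l) -> (forall i L, \sum_(l < L) g i l <= G i) ->
  \sum_(al <- A) \prod_i g i (al i) <= \prod_i G i.
Proof.
move=> g0 hG; pose L := (\max_(al <- A) \max_i al i).+1%N.
have hL al : al \in A -> forall i, (al i < L)%N.
  move=> alA i; rewrite ltnS.
  by apply: leq_trans (leq_bigmax i) _; apply: (leq_bigmax_seq (F := fun al => \max_i al i)).
apply: (@le_trans _ _ (\sum_(al <- [seq of_box b | b <- enum {: {ffun 'I_m -> 'I_L}}])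
   \prod_i g i (al i))).
  apply: (@ler_sum_sub _ {ffun 'I_m -> nat}); first exact: fset_uniq.
    by move=> al alA; exact: box_of alA hL.
  by move=> al; apply: prodr_ge0 => i _; exact: g0.
rewrite big_map big_enum /=.
rewrite (eq_bigr (fun b : {ffun 'I_m -> 'I_L} => \prod_i g i (b i))); last first.
  by move=> b _; apply: eq_bigr => i _; rewrite ffunE.
rewrite -(bigA_distr_bigA (fun i (l : 'I_L) => g i l)) /=.
by apply: ler_prod => i _; rewrite hG sumr_ge0.
Qed.

Lemma has_sum_prod_fin (g : 'I_m -> nat -> CC R) (L : nat) :
  (forall i l, (L <= l)%N -> g i l = 0) ->
  has_sum (fun al : {ffun 'I_m -> nat} => \prod_i g i (al i)) (\prod_i \sum_(l < L) g i l).
Proof.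
move=> g0; pose A : {fset {ffun 'I_m -> nat}} :=
  [fset al in [seq of_box b | b <- enum {: {ffun 'I_m -> 'I_L}}]]%fset.
have -> : \prod_i \sum_(l < L) g i l = \sum_(al <- A) \prod_i g i (al i).
  rewrite bigA_distr_bigA /=.
  rewrite (perm_big [seq of_box b | b <- enum {: {ffun 'I_m -> 'I_L}}]) /=.
    rewrite big_map big_enum /=; apply: eq_bigr => b _; apply: eq_bigr => i _.
    by rewrite ffunE.
  apply: uniq_perm; rewrite ?fset_uniq // ?map_inj_uniq -?enumT ?enum_uniq //; last by move=> al; rewrite inE.
  move=> b b' /ffunP h; apply/ffunP => i; apply: val_inj.
  by have := h i; rewrite !ffunE.
apply: has_sum_fin => al alA; apply/eqP/prodf_eq0.
have [i hi] : exists i, (L <= al i)%N.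
  apply: contrapT => h; move: alA; apply/negP; rewrite negbK inE.
  apply: (@box_of L [fset al]%fset); first by rewrite inE.
  move=> al'; rewrite inE => /eqP -> i; rewrite ltnNge; apply/negP => hi; apply: h; by exists i.
by exists i => //; rewrite g0.
Qed.

End Products.

(** * Multivariate power series and recentering *)

Section MultiIndex.
Variable m : nat.
Implicit Types al be : {ffun 'I_m -> nat}.

Definition addi al be : {ffun 'I_m -> nat} := [ffun i => al i + be i]%N.
Definition subi al be : {ffun 'I_m -> nat} := [ffun i => al i - be i]%N.
Definition uniti (k : 'I_m) : {ffun 'I_m -> nat} := [ffun i => (i == k) : nat].
Definition zeroi : {ffun 'I_m -> nat} := [ffun=> 0%N].
Definition deg al := (\sum_i al i)%N.

Lemma addiK al be : subi (addi al be) be = al.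
Proof. by apply/ffunP => i; rewrite !ffunE addnK. Qed.

Lemma subiK al k : (0 < al k)%N -> addi (subi al (uniti k)) (uniti k) = al.
Proof.
move=> h; apply/ffunP => i; rewrite !ffunE; case: eqP => [->|_]; last by rewrite subn0 addn0.
by rewrite subnK.
Qed.

Lemma addiC al be : addi al be = addi be al.
Proof. by apply/ffunP => i; rewrite !ffunE addnC. Qed.

Lemma degD al be : deg (addi al be) = (deg al + deg be)%N.
Proof. by rewrite /deg -big_split; apply: eq_bigr => i _; rewrite ffunE. Qed.

Lemma deg_uniti k : deg (uniti k) = 1%N.
Proof.
rewrite /deg (bigD1 k) //= ffunE eqxx big1 // => i /negPf ik.
by rewrite ffunE ik.
Qed.

Lemma leq_deg al i : (al i <= deg al)%N.
Proof. by rewrite /deg (bigD1 i) //= leq_addr. Qed.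

Lemma deg_eq0 al : (deg al == 0)%N = (al == zeroi).
Proof.
apply/idP/eqP => [|->]; last by rewrite /deg big1 // => i _; rewrite ffunE.
rewrite /deg sum_nat_eq0 => /forallP h; apply/ffunP => i; rewrite ffunE.
by apply/eqP; have := h i.
Qed.

Lemma multi_ind (P : {ffun 'I_m -> nat} -> Prop) :
  P zeroi -> (forall al k, P al -> P (addi al (uniti k))) -> forall al, P al.
Proof.
move=> P0 PS al; elim: {al}(deg al) {-2}al (erefl (deg al)) => [|n IH] al.
  by move=> /eqP; rewrite deg_eq0 => /eqP ->.
move=> h; have [k hk] : exists k, (0 < al k)%N.
  apply: contrapT => hn; suff : deg al = 0%N by rewrite h.
  rewrite /deg big1 // => i _; apply/eqP; rewrite -leqn0 leqNgt.
  by apply/negP => hi; apply: hn; exists i.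
rewrite -(subiK hk); apply: PS; apply: IH.
by move: h; rewrite -{1}(subiK hk) degD deg_uniti addn1 => -[].
Qed.

End MultiIndex.
Arguments zeroi {m}.

Section PowerSeries.
Variables (R : realType) (m : nat).
Implicit Types (al be ga de : {ffun 'I_m -> nat}) (p x y : 'rV[CC R]_m).
Implicit Types (C D : {ffun 'I_m -> nat} -> CC R) (f g : 'rV[CC R]_m -> CC R).

Definition mon (h : 'I_m -> CC R) al : CC R := \prod_i h i ^+ al i.
Definition rmon (r : 'I_m -> R) al : R := \prod_i r i ^+ al i.

Lemma rmon_ge0 r al : (forall i, 0 <= r i) -> 0 <= rmon r al.
Proof. by move=> r0; apply: prodr_ge0 => i _; apply: exprn_ge0. Qed.

Lemma mon0 (h : 'I_m -> CC R) : mon h zeroi = 1.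
Proof. by rewrite /mon big1 // => k _; rewrite ffunE expr0. Qed.

Lemma nm_mon h al : nm (mon h al) = rmon (fun i => nm (h i)) al.
Proof. by rewrite /mon nm_prod; apply: eq_bigr => i _; rewrite nmX. Qed.

Lemma ler_rmon r r' al : (forall i, 0 <= r i <= r' i) -> rmon r al <= rmon r' al.
Proof.
move=> h; apply: ler_prod => i _; have /andP[r0 rr] := h i.
by rewrite exprn_ge0 //= lerXn2r // nnegrE // (le_trans r0).
Qed.

(** Cauchy estimates on a polydisc. The radii depend on the coordinate because the expansions of the
    Gamma-series hold on polydiscs that are large in all directions but one. *)
Definition pbd C (r : 'I_m -> R) (M : R) := forall al, nm (C al) * rmon r al <= M.

Lemma pbd_ge0 C r M : (forall i, 0 <= r i) -> pbd C r M -> 0 <= M.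
Proof. by move=> r0 /(_ zeroi); apply: le_trans; rewrite mulr_ge0 ?nm_ge0 ?rmon_ge0. Qed.

Lemma geo2_sum L : \sum_(l < L) (2^-1 : R) ^+ l <= 2.
Proof.
have := subrX1 (2^-1 : R) L.
have : 0 <= (2^-1 : R) ^+ L by rewrite exprn_ge0 // invr_ge0.
lra.
Qed.

(** Halving the radii leaves a product of m geometric series of ratio 1/2, hence the factor 2 ^
    m. *)
Lemma geo_abs C r M (A : {fset {ffun 'I_m -> nat}}) : (forall i, 0 <= r i) -> pbd C r M ->
  \sum_(al <- A) nm (C al) * rmon (fun i => r i / 2) al <= M * 2 ^+ m.
Proof.
move=> r0 h; have M0 := pbd_ge0 r0 h.
have e al : rmon (fun i => r i / 2) al = rmon r al * \prod_i 2^-1 ^+ al i.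
  by rewrite /rmon -big_split; apply: eq_bigr => i _; rewrite exprMn.
apply: (@le_trans _ _ (\sum_(al <- A) M * \prod_i 2^-1 ^+ al i)).
  apply: ler_sum => al _; rewrite e mulrA ler_wpM2r //.
  by apply: prodr_ge0 => i _; rewrite exprn_ge0 // invr_ge0.
rewrite -mulr_sumr ler_wpM2l //.
apply: le_trans (ler_sum_prod (g := fun i l => 2^-1 ^+ l) (G := fun=> 2) A _ _) _.
- by move=> i l; rewrite exprn_ge0 // invr_ge0.
- by move=> i L; exact: geo2_sum.
by rewrite prodr_const card_ord.
Qed.

Lemma geo_abs_le C r M (x : 'I_m -> R) (A : {fset {ffun 'I_m -> nat}}) :
  (forall i, 0 <= x i <= r i / 2) -> pbd C r M ->
  \sum_(al <- A) nm (C al) * rmon x al <= M * 2 ^+ m.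
Proof.
move=> hx h; have r0 i : 0 <= r i.
  by have /andP[/le_trans hh /hh] := hx i; rewrite pmulr_lge0 ?invr_gt0.
apply: le_trans (geo_abs A r0 h); apply: ler_sum => al _.
by rewrite ler_wpM2l ?nm_ge0 // ler_rmon.
Qed.

(** The contribution of the monomial [de] to the coefficient [ga] after translation by h. Where ga
    <= de fails a binomial coefficient vanishes, so the truncated subtraction does no harm. *)
Definition shift_term C (h : 'I_m -> CC R) ga de :=
  C de * \prod_i ('C(de i, ga i)%:R * h i ^+ (de i - ga i)).

Definition recenter C h ga := sum (shift_term C h ga).

Let bnd (h : 'I_m -> CC R) (r' : 'I_m -> R) de ga :=
  \prod_i ('C(de i, ga i)%:R * nm (h i) ^+ (de i - ga i) * r' i ^+ ga i).

Let bnd_ge0 h r' de ga : (forall i, 0 <= r' i) -> 0 <= bnd h r' de ga.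
Proof. by move=> r0; apply: prodr_ge0 => i _; rewrite !mulr_ge0 // exprn_ge0 // nm_ge0. Qed.

Let nm_shift_term C h r' ga de : nm (shift_term C h ga de) * rmon r' ga = nm (C de) * bnd h r' de ga.
Proof.
rewrite /shift_term nmM -mulrA nm_prod -big_split /=; congr (_ * _).
by apply: eq_bigr => i _; rewrite nmM nm_nat nmX.
Qed.

Let sum_binom (d L : nat) (u v : R) : 0 <= u -> 0 <= v ->
  \sum_(l < L) 'C(d, l)%:R * u ^+ (d - l) * v ^+ l <= (u + v) ^+ d.
Proof.
move=> u0 v0; pose t l := u ^+ (d - l) * v ^+ l *+ 'C(d, l).
rewrite exprDn (eq_bigr (fun l : 'I_L => t l)); last first.
  by move=> l _; rewrite -mulrA mulr_natl.
rewrite -(big_mkord predT t) -(big_mkord predT (fun l => u ^+ (d - l) * v ^+ l *+ 'C(d, l))).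
have t0 l : 0 <= t l.
  by rewrite mulrn_wge0 // mulr_ge0 // exprn_ge0.
case: (leqP L d.+1) => hL.
  by apply: ler_sum_sub => // [|i]; rewrite ?iota_uniq // !mem_index_iota /= => /leq_trans; apply.
rewrite (@big_cat_nat _ _ _ d.+1) //= ?(ltnW hL) // [X in _ + X <= _]big_nat_cond.
rewrite [X in _ + X <= _]big1 ?addr0 // => l /andP[/andP[dl _] _].
by rewrite /t bin_small // mulr0n.
Qed.

(** Summing over [ga] first gives |C_de| (|h| + r')^de by the binomial theorem, and |h| + r' is
    within half of r. *)
Let double_abs C h r r' M (A B : {fset {ffun 'I_m -> nat}}) :
  (forall i, 0 < r' i) -> (forall i, nm (h i) + r' i <= r i / 2) -> pbd C r M ->
  \sum_(de <- A) \sum_(ga <- B) nm (C de) * bnd h r' de ga <= M * 2 ^+ m.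
Proof.
move=> r0 hr hC.
apply: le_trans (geo_abs_le (x := fun i => nm (h i) + r' i) A _ hC); last first.
  by move=> i; rewrite hr addr_ge0 ?nm_ge0 // ltW.
apply: ler_sum => de _; rewrite -mulr_sumr ler_wpM2l ?nm_ge0 //.
apply: (ler_sum_prod (g := fun i l => 'C(de i, l)%:R * nm (h i) ^+ (de i - l) * r' i ^+ l)).
  by move=> i l; rewrite !mulr_ge0 // exprn_ge0 ?nm_ge0 // ltW.
by move=> i L; apply: sum_binom; rewrite ?nm_ge0 // ltW.
Qed.

Let column_abs C h r r' M ga (A : {fset {ffun 'I_m -> nat}}) :
  (forall i, 0 < r' i) -> (forall i, nm (h i) + r' i <= r i / 2) -> pbd C r M ->
  \sum_(de <- A) nm (shift_term C h ga de) <= M * 2 ^+ m / rmon r' ga.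
Proof.
move=> r0 hr hC; rewrite ler_pdivlMr; last by apply: prodr_gt0 => i _; rewrite exprn_gt0.
rewrite mulr_suml; apply: le_trans (double_abs A [fset ga]%fset r0 hr hC).
by apply: ler_sum => de _; rewrite big_seq_fset1 nm_shift_term.
Qed.

Lemma recenter_sum C h r r' M ga :
  (forall i, 0 < r' i) -> (forall i, nm (h i) + r' i <= r i / 2) -> pbd C r M ->
  has_sum (shift_term C h ga) (recenter C h ga).
Proof.
move=> r0 hr hC.
have [s hs] := abs_has_sum_ex (fun A => @column_abs C h r r' M ga A r0 hr hC).
by rewrite /recenter (has_sum_sum hs).
Qed.

Lemma recenter_bound C h r r' M :
  (forall i, 0 < r' i) -> (forall i, nm (h i) + r' i <= r i / 2) -> pbd C r M ->
  pbd (recenter C h) r' (M * 2 ^+ m).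
Proof.
move=> r0 hr hC ga; rewrite -ler_pdivlMr; last by apply: prodr_gt0 => i _; rewrite exprn_gt0.
by apply: has_sum_le (@recenter_sum C h r r' M ga r0 hr hC) _ => A; apply: column_abs hC.
Qed.

(** Both sums are iterated sums of one absolutely summable double family: its rows are the binomial
    expansions of (h + k)^de, its columns give the recentered coefficients. *)
Lemma recenter_has_sum C h k r r' M s :
  (forall i, 0 < r' i) -> (forall i, nm (h i) + r' i <= r i / 2) -> pbd C r M ->
  (forall i, nm (k i) <= r' i) ->
  has_sum (fun de => C de * mon (fun i => h i + k i) de) s ->
  has_sum (fun ga => recenter C h ga * mon k ga) s.
Proof.
move=> r0 hr hC hk hs.
pose F (x : {ffun 'I_m -> nat} * {ffun 'I_m -> nat}) := shift_term C h x.2 x.1 * mon k x.2.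
have Fabs (A : {fset _}) : \sum_(x <- A) nm (F x) <= M * 2 ^+ m.
  pose A1 := [fset x.1 | x in A]%fset; pose A2 := [fset x.2 | x in A]%fset.
  apply: le_trans (double_abs A1 A2 r0 hr hC).
  apply: (@le_trans _ _ (\sum_(x <- [seq (a, b) | a <- A1, b <- A2]) nm (F x))).
    apply: ler_sum_sub => [|[a b] xA|x]; [exact: fset_uniq| |exact: nm_ge0].
    by apply/allpairsP; exists (a, b); split=> //=; apply/imfsetP; exists (a, b).
  rewrite big_allpairs; apply: ler_sum => de _; apply: ler_sum => ga _.
  rewrite -nm_shift_term /F nmM /= nm_mon ler_wpM2l ?nm_ge0 // ler_rmon // => i.
  by rewrite nm_ge0 hk.
have [S hS] := abs_has_sum_ex Fabs.
have hrow de : has_sum (fun ga => F (de, ga)) (C de * mon (fun i => h i + k i) de).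
  pose g i l := 'C(de i, l)%:R * h i ^+ (de i - l) * k i ^+ l.
  (* All factors get the common length deg de + 1, so that the product expands over a box; the extra
     terms carry a vanishing binomial coefficient. *)
  have -> : mon (fun i => h i + k i) de = \prod_i \sum_(l < (deg de).+1) g i l.
    apply: eq_bigr => i _; rewrite exprDn.
    rewrite -(big_mkord predT (g i)).
    rewrite (@big_cat_nat _ _ _ (de i).+1) //=; last by rewrite ltnS leq_deg.
    rewrite [X in _ = _ + X]big_nat_cond [X in _ = _ + X]big1 ?addr0; last first.
      by move=> l /andP[/andP[dl _] _]; rewrite /g bin_small // !mul0r.
    by rewrite big_mkord; apply: eq_bigr => l _; rewrite /g -mulrA mulr_natl.
  have g0 i l : ((deg de).+1 <= l)%N -> g i l = 0.
    by move=> hl; rewrite /g bin_small ?mul0r // (leq_trans _ hl) // ltnS leq_deg.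
  move: (has_sumZ (c := C de) (has_sum_prod_fin g0)).
  by apply: eq_has_sum => ga; rewrite /F /shift_term -mulrA -big_split.
have -> : s = S by apply: has_sum_uniq hs _; exact: has_sum_fubini hS hrow.
apply: has_sum_fubini_swap hS _ => ga.
have := has_sumZ (c := mon k ga) (@recenter_sum C h r r' M ga r0 hr hC).
by rewrite mulrC; apply: eq_has_sum => de; rewrite mulrC.
Qed.

End PowerSeries.

Lemma has_sum_single (R : realType) (I : choiceType) (i : I) (c : CC R) :
  has_sum (fun j => if j == i then c else 0) c.
Proof.
have := @has_sum_fin R I (fun j => if j == i then c else 0) [fset i]%fset.
rewrite big_seq_fset1 eqxx; apply=> j; by rewrite inE => /negPf ->.
Qed.

Arguments has_sum_single {R I} i c.

(** * Local power series expansions and their termwise differentiation *)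

Section Expansions.
Variables (R : realType) (m : nat).
Implicit Types (al be ga de : {ffun 'I_m -> nat}) (p x y : 'rV[CC R]_m).
Implicit Types (C D : {ffun 'I_m -> nat} -> CC R) (f g : 'rV[CC R]_m -> CC R).

Definition expands p C f := \forall x \near p,
  has_sum (fun al => C al * mon (fun i => (x : 'rV_m) 0 i - p 0 i) al) (f x).

Definition expands_on (r : R) p C f := forall x, (forall i, nm (x 0 i - p 0 i) <= r) ->
  has_sum (fun al => C al * mon (fun i => x 0 i - p 0 i) al) (f x).

Lemma expands_strong p C f : expands p C f ->
  exists r M : R, [/\ 0 < r, pbd C (fun=> r) M & expands_on r p C f].
Proof.
move=> /nbhs_rowP [e e0 he]; have e2 : 0 < e / 2 by rewrite divr_gt0.
have hx x : (forall i, nm (x 0 i - p 0 i) <= e / 2) ->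
    has_sum (fun al => C al * mon (fun i => x 0 i - p 0 i) al) (f x).
  by move=> h; apply: he => i; apply: le_lt_trans (h i) _; lra.
(* A corner of the polydisc: all coordinates of x - p are the same positive real, so bounded terms
   at x are Cauchy estimates with equal radii. *)
pose x := \row_i (p 0 i + (e / 2)%:C%C).
have xp i : x 0 i - p 0 i = (e / 2)%:C%C by rewrite mxE addrAC subrr add0r.
have [|M _ hM] := has_sum_term_bound (hx x _).
  by move=> i; rewrite xp nm_real gtr0_norm.
exists (e / 2), M; split=> // al; have := hM al; rewrite nmM nm_mon.
by congr (_ * _ <= _); apply: eq_bigr => i _; rewrite xp nm_real gtr0_norm.
Qed.

Lemma expands_on_expands r p C f : 0 < r -> expands_on r p C f -> expands p C f.
Proof.
by move=> r0 h; apply/nbhs_rowP; exists r => // x hx; apply: h => i; exact: ltW.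
Qed.

(** The displacement and the new radius are both r / 4; together they fill the r / 2 that
    recentering allows. *)
Lemma expands_on_recenter r M p C f y : 0 < r -> pbd C (fun=> r) M -> expands_on r p C f ->
  (forall i, nm (y 0 i - p 0 i) <= r / 4) ->
  expands_on (r / 4) y (recenter C (fun i => y 0 i - p 0 i)) f.
Proof.
move=> r0 hC hf hy x hx.
apply: (recenter_has_sum (r := fun=> r) (r' := fun=> r / 4) _ _ hC) => //.
- by move=> i; rewrite divr_gt0.
- by move=> i; have := hy i; lra.
have -> : (fun i => y 0 i - p 0 i + (x 0 i - y 0 i)) = (fun i => x 0 i - p 0 i).
  by apply/funext => i; ring.
apply: hf => i; have := nm_dist3 (y 0 i) (x 0 i) (p 0 i); have := hx i; have := hy i; lra.
Qed.

Lemma mon_const0 al : mon (fun=> 0 : CC R) al = (al == zeroi)%:R.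
Proof.
case: eqP => [->|h]; first by rewrite /mon big1 // => i _; rewrite ffunE.
have [i hi] : exists i, al i != 0%N.
  apply: contrapT => hn; apply: h; apply/ffunP => i; rewrite ffunE.
  by apply/eqP; apply: contrapT => hi; apply: hn; exists i; apply/negP.
by rewrite /mon (bigD1 i) //= expr0n (negPf hi) mul0r.
Qed.

Lemma expands_on_at0 r p C f : 0 <= r -> expands_on r p C f -> f p = C zeroi.
Proof.
move=> r0 h; have hp : forall i, nm (p 0 i - p 0 i) <= r by move=> i; rewrite subrr nm0.
apply: has_sum_uniq (h p hp) _; apply: eq_has_sum (has_sum_single zeroi (C zeroi)) => al.
 have -> : (fun i => p 0 i - p 0 i) = (fun=> 0).
  by apply/funext => i; rewrite subrr.
by rewrite mon_const0; case: eqP => [->|_]; rewrite ?mulr1 ?mulr0.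
Qed.

Lemma expands_at0 p C f : expands p C f -> f p = C zeroi.
Proof. by move=> /expands_strong [r [M [r0 _ /expands_on_at0]]]; apply; exact: ltW. Qed.

Lemma expands_analytic p C f : expands p C f -> \forall y \near p, analytic_at f y.
Proof.
move=> /expands_strong [r [M [r0 hC hf]]]; apply/nbhs_rowP; exists (r / 4); first by rewrite divr_gt0.
move=> y hy; exists (recenter C (fun i => y 0 i - p 0 i)).
apply: (@expands_on_expands (r / 4)); first by rewrite divr_gt0.
by apply: expands_on_recenter hf _ => // i; exact: ltW.
Qed.

Lemma expands_near p C f g : (\forall x \near p, f x = g x) -> expands p C f -> expands p C g.
Proof. by move=> fg; apply: filterS2 fg => x ->. Qed.

Lemma expandsD p C D f g : expands p C f -> expands p D g ->
  expands p (fun al => C al + D al) (fun x => f x + g x).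
Proof.
move=> hf hg; apply: filterS2 hf hg => x hf hg.
by move: (has_sumD hf hg); apply: eq_has_sum => al; rewrite mulrDl.
Qed.

Lemma expandsZ p C f (c : CC R) : expands p C f -> expands p (fun al => c * C al) (fun x => c * f x).
Proof.
apply: filterS => x hf.
by move: (has_sumZ (c := c) hf); apply: eq_has_sum => al; rewrite mulrA.
Qed.

Lemma expands0 p : expands p (fun=> 0) (fun=> 0).
Proof. by apply: filterE => x; apply: has_sum0 => al; rewrite mul0r. Qed.

Lemma mon_add (h : 'I_m -> CC R) al be : mon h (addi al be) = mon h al * mon h be.
Proof. by rewrite /mon -big_split; apply: eq_bigr => i _; rewrite ffunE exprD. Qed.

Lemma mon_unit (h : 'I_m -> CC R) k : mon h (uniti k) = h k.
Proof.
rewrite /mon (bigD1 k) //= ffunE eqxx expr1 big1 ?mulr1 // => i /negPf ik.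
by rewrite ffunE ik.
Qed.

Lemma has_sum_shift k (F : {ffun 'I_m -> nat} -> CC R) s :
  (forall al, al k = 0%N -> F al = 0) -> has_sum F s ->
  has_sum (fun al => F (addi al (uniti k))) s.
Proof.
move=> F0; apply: (@has_sum_reindex _ _ _ (fun al => addi al (uniti k))
   (fun al => subi al (uniti k)) predT (fun al => 0 < al k)%N) => //.
- by move=> al _; rewrite addiK !ffunE eqxx addn1.
- by move=> al /subiK.
by move=> al; rewrite lt0n negbK => /eqP /F0.
Qed.

Lemma has_sum_unshift k (F : {ffun 'I_m -> nat} -> CC R) s :
  (forall al, al k = 0%N -> F al = 0) ->
  has_sum (fun al => F (addi al (uniti k))) s -> has_sum F s.
Proof.
move=> F0; apply: (@has_sum_reindex _ _ _ (fun al => subi al (uniti k))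
   (fun al => addi al (uniti k)) (fun al => 0 < al k)%N predT) => //.
- by move=> al /subiK.
- by move=> al _; rewrite addiK !ffunE eqxx addn1.
- by move=> al; rewrite lt0n negbK => /eqP /F0.
by move=> al /subiK ->.
Qed.

Definition tmulx (c : CC R) k C al : CC R :=
  c * C al + (if al k is 0 then 0 else C (subi al (uniti k))).

Lemma expands_mulx p C f k : expands p C f -> expands p (tmulx (p 0 k) k C) (fun x => x 0 k * f x).
Proof.
apply: filterS => x hf.
have h1 := has_sumZ (c := p 0 k) hf; have h2 := has_sumZ (c := x 0 k - p 0 k) hf.
pose F al := (if al k is 0 then 0 else C (subi al (uniti k))) * mon (fun i => x 0 i - p 0 i) al.
have h3 : has_sum F ((x 0 k - p 0 k) * f x).
  apply: (@has_sum_unshift k) => [al hal|]; first by rewrite /F hal mul0r.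
  move: h2; apply: eq_has_sum => al; rewrite /F !ffunE eqxx addn1 addiK mon_add mon_unit; ring.
have -> : x 0 k * f x = p 0 k * f x + (x 0 k - p 0 k) * f x by ring.
by move: (has_sumD h1 h3); apply: eq_has_sum => al; rewrite /tmulx /F mulrDl mulrA.
Qed.

(** Along the k-th axis the constant and linear terms cancel, monomials in other variables vanish,
    and the remaining ones contain h at least twice, which yields the squared ratio. *)
Lemma expands_on_taylor1 r M p C f k h : 0 < r -> pbd C (fun=> r) M -> expands_on r p C f ->
  nm h <= r / 2 ->
  nm (f (h *: delta_mx 0 k + p) - f p - C (uniti k) * h) <= M * 2 ^+ m * (nm h / (r / 2)) ^+ 2.
Proof.
move=> r0 hC hf hh; set x := _ + p; have r2 : 0 < r / 2 by rewrite divr_gt0.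
have xp i : x 0 i - p 0 i = h * (i == k)%:R by rewrite !mxE eqxx /= addrK.
have hx : has_sum (fun al => C al * mon (fun i => x 0 i - p 0 i) al) (f x).
  by apply: hf => i; rewrite xp nmM nm_nat; case: eqP => _; rewrite ?mulr1 ?mulr0; lra.
have := has_sumD hx (has_sumZ (c := -1) (has_sumD (has_sum_single zeroi (C zeroi))
   (has_sum_single (uniti k) (C (uniti k) * h)))).
rewrite -(expands_on_at0 (ltW r0) hf) mulN1r opprD addrA => hs.
apply: has_sum_le hs _ => A.
have hA := geo_abs A (fun=> ltW r0) hC.
apply: (@le_trans _ _ (\sum_(al <- A) nm (C al) * rmon (fun=> r / 2) al * (nm h / (r / 2)) ^+ 2)); last first.
  by rewrite -mulr_suml ler_wpM2r // exprn_ge0 // divr_ge0 ?nm_ge0 // ltW.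
apply: ler_sum => al _.
have rhs1 be : 0 <= rmon (fun=> r / 2) be * (nm h / (r / 2)) ^+ 2.
  by rewrite mulr_ge0 ?rmon_ge0 // ?exprn_ge0 ?divr_ge0 ?nm_ge0 // => *; exact: ltW.
have rhs0 be : 0 <= nm (C be) * rmon (fun=> r / 2) be * (nm h / (r / 2)) ^+ 2.
  by rewrite -mulrA mulr_ge0 ?nm_ge0.
have -> : (fun i => x 0 i - p 0 i) = (fun i => h * (i == k)%:R) by apply/funext.
have u0 : (uniti k == zeroi) = false by rewrite -deg_eq0 deg_uniti.
case: (eqVneq al zeroi) => [->|al0].
  rewrite eq_sym u0 addr0 /mon big1 ?mulr1; last by move=> i _; rewrite ffunE.
  by rewrite mulN1r (expands_on_at0 (ltW r0) hf) subrr nm0.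
case: (eqVneq al (uniti k)) => [->|alk].
  by rewrite add0r mon_unit eqxx mulr1 mulN1r subrr nm0.
rewrite addr0 mulr0 addr0 nmM -mulrA ler_wpM2l ?nm_ge0 //.
case: (pselect (exists2 i, i != k & (0 < al i)%N)) => [[i ik ai]|hn].
  by rewrite /mon (bigD1 i) //= (negPf ik) mulr0 expr0n gtn_eqF // mul0r nm0.
have al_i i : i != k -> al i = 0%N.
  by move=> ik; apply/eqP; rewrite -leqn0 leqNgt; apply/negP => h1; apply: hn; exists i.
have hk : (2 <= al k)%N.
  rewrite leqNgt ltnS; apply/negP => h1.
  have : al k = 0%N \/ al k = 1%N by case: (al k) h1 => [|[|]] // _; [left|right].
  case=> h2; [move/eqP: al0; apply|move/eqP: alk; apply]; apply/ffunP => i; rewrite ffunE.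
    by case: (eqVneq i k) => [->|/al_i ->].
  by case: (eqVneq i k) => [->|/al_i ->].
rewrite /mon /rmon (bigD1 k) //= [\prod_(i < m) (r / 2) ^+ al i](bigD1 k) //=.
rewrite !big1 ?mulr1; try by move=> i /al_i ->; rewrite expr0.
rewrite eqxx mulr1 nmX -(subnK hk) !exprD -mulrA -[X in _ <= _ * X]exprMn.
rewrite [r / 2 * _]mulrC divfK ?gt_eqF //.
by rewrite ler_wpM2r ?exprn_ge0 ?nm_ge0 // lerXn2r // nnegrE ?nm_ge0 // ltW.
Qed.

Lemma expands_derive_at p C f k : expands p C f -> 'D_(delta_mx 0 k) f p = C (uniti k).
Proof.
move=> /expands_strong [r [M [r0 hC hf]]]; rewrite /derive.
apply: (@cvg_lim _ (@norm_hausdorff _ _)).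
apply/cvg_nmP => e e0; apply/nbhs_nmP.
have M0 : 0 <= M by apply: pbd_ge0 hC => i; exact: ltW.
have r2 : 0 < r / 2 by rewrite divr_gt0.
pose K := M * 2 ^+ m / (r / 2) ^+ 2.
have K0 : 0 <= K by rewrite divr_ge0 ?mulr_ge0 ?exprn_ge0 // ltW.
exists (Num.min (r / 2) (e / (K + 1))).
  by rewrite lt_min r2 divr_gt0 // ltr_wpDl.
move=> h; rewrite subr0 lt_min => /andP[hr he] h0.
have hn0 : 0 < nm h by rewrite nm_gt0.
have := @expands_on_taylor1 r M p C f k h r0 hC hf (ltW hr).
rewrite /= /shift /=; set d := f _ - f p => hd.
have -> : h^-1 *: d - C (uniti k) = h^-1 * (d - C (uniti k) * h).
  by rewrite mulrBr [C _ * h]mulrC mulKf.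
rewrite nmM nmV mulrC ltr_pdivrMr //; apply: le_lt_trans hd _.
rewrite expr_div_n mulrA mulrAC -/K expr2 mulrA ltr_pM2r //.
move: he; rewrite ltr_pdivlMr ?ltr_wpDl //; nra.
Qed.

Definition dC k C al : CC R := (al k).+1%:R * C (addi al (uniti k)).

(** The first-order coefficient of the expansion recentered at y is the derivative at y. Termwise
    differentiation is thus an instance of recentering. *)
Lemma has_sum_dC r M p C y k : 0 < r -> pbd C (fun=> r) M ->
  (forall i, nm (y 0 i - p 0 i) <= r / 4) ->
  has_sum (fun al => dC k C al * mon (fun i => y 0 i - p 0 i) al)
    (recenter C (fun i => y 0 i - p 0 i) (uniti k)).
Proof.
move=> r0 hC hy.
have hs : has_sum (shift_term C (fun i => y 0 i - p 0 i) (uniti k))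
    (recenter C (fun i => y 0 i - p 0 i) (uniti k)).
  apply: (recenter_sum (r := fun=> r) (r' := fun=> r / 4) _ _ hC) => i; first by rewrite divr_gt0.
  by have := hy i; lra.
have : forall al, al k = 0%N -> shift_term C (fun i => y 0 i - p 0 i) (uniti k) al = 0.
  by move=> al h0; rewrite /shift_term (bigD1 k) //= h0 ffunE eqxx bin_small // !mul0r mulr0.
move/has_sum_shift/(_ hs); apply: eq_has_sum => al; rewrite /shift_term /dC [_%:R * _]mulrC -[RHS]mulrA; congr (_ * _).
rewrite /mon (bigD1 k) //= [in RHS](bigD1 k) //= !ffunE eqxx addn1 bin1 subn1 /= mulrA.
congr (_ * _); apply: eq_bigr => i /negPf ik.
by rewrite !ffunE ik addn0 bin0 subn0 mul1r.
Qed.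

Lemma expands_derive p C f k : expands p C f -> expands p (dC k C) ('D_(delta_mx 0 k) f).
Proof.
move=> /expands_strong [r [M [r0 hC hf]]]; apply/nbhs_rowP.
have r4 : 0 < r / 4 by rewrite divr_gt0.
exists (r / 4) => // y hy; have hy' i := ltW (hy i).
rewrite (expands_derive_at k (expands_on_expands r4 (expands_on_recenter r0 hC hf hy'))).
exact: has_sum_dC hC hy'.
Qed.

Lemma expands_inj p C D f : expands p C f -> expands p D f -> C =1 D.
Proof.
move=> hC hD al; elim/multi_ind: al C D f hC hD => [|al k IH] C D f hC hD.
  by rewrite -(expands_at0 hC) -(expands_at0 hD).
have : dC k C al = dC k D al by apply: IH (expands_derive k hC) (expands_derive k hD).
by move/mulfI; apply; rewrite pnatr_eq0.
Qed.

Lemma expands_uniq p C D f g : (\forall x \near p, f x = g x) ->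
  expands p C f -> expands p D g -> C =1 D.
Proof. by move=> fg /(expands_near fg); exact: expands_inj. Qed.

End Expansions.

(** * The identity theorem *)

Section Identity.
Variables (R : realType) (m : nat).
Implicit Types (p x y q : 'rV[CC R]_m) (f g : 'rV[CC R]_m -> CC R).

(** The expansion recentered at y reaches all points within r / 4 of y, hence the whole polydisc of
    radius r / 8 around q. That e is independent of y is what makes the vanishing propagate. *)
Lemma expands_zero_spread q E f : expands q E f -> exists2 e : R, 0 < e &
  forall y, (forall i, nm (y 0 i - q 0 i) <= e) -> (\forall x \near y, f x = 0) ->
  forall x, (forall i, nm (x 0 i - q 0 i) <= e) -> f x = 0.
Proof.
move=> /expands_strong [r [M [r0 hC hf]]]; exists (r / 8); first by rewrite divr_gt0.
move=> y hy f0 x hx; have r4 : 0 < r / 4 by rewrite divr_gt0.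
have h : expands_on (r / 4) y (recenter E (fun i => y 0 i - q 0 i)) f.
  by apply: expands_on_recenter hf _ => // i; have := hy i; lra.
have h0 : recenter E (fun i => y 0 i - q 0 i) =1 (fun=> 0).
  exact: expands_uniq f0 (expands_on_expands r4 h) (expands0 y).
apply: (has_sum_uniq (h x _)) => [i|].
  by have := nm_dist3 (q 0 i) (x 0 i) (y 0 i); rewrite (nm_distC (q 0 i)); have := hx i; have := hy i; lra.
by apply: has_sum0 => al; rewrite h0 mul0r.
Qed.

(** Connectedness of the unit interval, for a property that is locally constant in t; the argument
    takes place at the supremum of the set where P holds. *)
Lemma segment_ind (P : R -> Prop) :
  (forall t, 0 <= t <= 1 -> exists2 e : R, 0 < e & forall s s', 0 <= s <= 1 -> 0 <= s' <= 1 ->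
     `|s - t| <= e -> `|s' - t| <= e -> P s -> P s') ->
  P 0 -> P 1.
Proof.
move=> h P0; pose S := [set t : R | 0 <= t <= 1 /\ P t].
have hS : has_sup S.
  split; first by exists 0; split=> //; rewrite lexx ler01.
  by exists 1 => t [/andP[_ ?] _].
have T0 : 0 <= sup S by apply: ub_le_sup; [exact: hS.2|split=> //; rewrite lexx ler01].
have T1 : sup S <= 1 by apply: ge_sup; [exact: hS.1|move=> t [/andP[_ ?] _]].
have [|e e0 he] := h (sup S); first by rewrite T0.
have [s [s01 Ps] hs] := sup_adherent e0 hS.
have sT : s <= sup S by apply: ub_le_sup; [exact: hS.2|].
have hse : `|s - sup S| <= e by rewrite ler0_norm ?subr_le0 // opprB; lra.
case: (leP 1 (sup S + e)) => h1.
  apply: (he s 1) => //; rewrite ?ler01 ?lexx // ger0_norm ?subr_ge0 //; lra.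
have h01 : 0 <= sup S + e <= 1 by apply/andP; split; lra.
have PT : P (sup S + e).
  apply: (he s) => //.
  by rewrite addrAC subrr add0r gtr0_norm.
have : sup S + e <= sup S.
  by apply: ub_le_sup; [exact: hS.2|].
by lra.
Qed.

(** Continuation along the segment from p to y: at each of its points f - g has an expansion, so its
    vanishing near a point is locally constant along the segment. *)
Lemma analytic_eq_ball p f g (rho : R) : 0 < rho ->
  (forall y, (forall i, nm (y 0 i - p 0 i) < rho) -> analytic_at f y) ->
  (forall y, (forall i, nm (y 0 i - p 0 i) < rho) -> analytic_at g y) ->
  (\forall x \near p, f x = g x) ->
  forall y, (forall i, nm (y 0 i - p 0 i) < rho) -> f y = g y.
Proof.
move=> rho0 hf hg fg y hy.
pose pt (t : R) : 'rV[CC R]_m := \row_i (p 0 i + t%:C%C * (y 0 i - p 0 i)).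
have pt0 : pt 0 = p by apply/rowP => i; rewrite mxE mul0r addr0.
have pt1 : pt 1 = y by apply/rowP => i; rewrite mxE mul1r addrC subrK.
have ptB s t i : pt s 0 i - pt t 0 i = (s - t)%:C%C * (y 0 i - p 0 i).
  rewrite !mxE rmorphB /=; ring.
suff : \forall x \near pt 1, f x + (-1) * g x = 0.
  by rewrite pt1 => /nbhs_singleton; rewrite mulN1r => /eqP; rewrite subr_eq0 => /eqP.
apply: (@segment_ind (fun t => \forall x \near pt t, f x + (-1) * g x = 0)); last first.
  by rewrite pt0; apply: filterS fg => x ->; rewrite mulN1r subrr.
move=> t /andP[t0 t1].
have hpt i : nm (pt t 0 i - p 0 i) < rho.
  have -> : p 0 i = pt 0 0 i by rewrite pt0.
  rewrite ptB subr0 nmM nm_real ger0_norm //.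
  by apply: le_lt_trans (hy i); rewrite ler_piMl ?nm_ge0.
have [C hC] := hf _ hpt; have [D hD] := hg _ hpt.
have [e e0 he] := expands_zero_spread (expandsD hC (expandsZ (-1) hD)).
have d0 : 0 < e / 2 / rho by rewrite !divr_gt0.
have hd s : `|s - t| <= e / 2 / rho -> forall i, nm (pt s 0 i - pt t 0 i) <= e / 2.
  move=> hs i; rewrite ptB nmM nm_real -[e / 2](@divfK _ rho) ?gt_eqF //.
  by rewrite ler_pM // ?nm_ge0 // ltW.
exists (e / 2 / rho); first exact: d0.
move=> s s' _ _ hs hs' Ps; apply/nbhs_rowP; exists (e / 2); first by rewrite divr_gt0.
move=> x hx; apply: (he (pt s) _ Ps) => i; first by have := hd s hs i; lra.
by have := nm_dist3 (pt s' 0 i) (x 0 i) (pt t 0 i); have := hd s' hs' i; have := hx i; lra.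
Qed.

End Identity.

Section OneVariable.
Variable R : realType.

Let cst1 (i : nat) : {ffun 'I_1 -> nat} := [ffun=> i].

Lemma has_sum_ord1 (F : {ffun 'I_1 -> nat} -> CC R) s :
  has_sum F s <-> has_sum (fun i => F (cst1 i)) s.
Proof.
have c1 : cancel cst1 (fun al => al 0) by move=> i; rewrite ffunE.
have c2 : cancel (fun al : {ffun 'I_1 -> nat} => al 0) cst1.
  by move=> al; apply/ffunP => i; rewrite ffunE ord1.
split=> h; first exact: has_sum_bij c1 c2 h.
by move: (has_sum_bij c2 c1 h); apply: eq_has_sum => al /=; rewrite c2.
Qed.

(** Ordinary convergence at rho / 2 bounds the terms; the series is then absolutely summable for |z|
    <= rho / 4, where expansions are unique. *)
Lemma pseries_eq0 (a : nat -> CC R) (rho : R) : 0 < rho ->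
  (forall z, nm z < rho -> series (fun i => a i * z ^+ i) @ \oo --> (0 : CC R)) ->
  forall i, a i = 0.
Proof.
move=> rho0 h; pose z0 : CC R := (rho / 2)%:C%C.
have r2 : 0 < rho / 2 by rewrite divr_gt0.
have nz0 : nm z0 = rho / 2 by rewrite nm_real gtr0_norm.
have [M hM] : exists M, pbd (fun al : {ffun 'I_1 -> nat} => a (al 0)) (fun=> rho / 2) M.
  have /cvg_nmP/(_ 1 ltr01) : series (fun i => a i * z0 ^+ i) @ \oo --> (0 : CC R).
    by apply: h; rewrite nz0; lra.
  move=> [N _ hN]; exists (2 + \sum_(i < N) nm (a i * z0 ^+ i)) => al.
  rewrite /rmon big_ord1; have -> : nm (a (al 0)) * (rho / 2) ^+ al 0 = nm (a (al 0) * z0 ^+ al 0).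
    by rewrite nmM nmX nz0.
  set i := al 0; case: (ltnP i N) => hi.
    by rewrite (bigD1 (Ordinal hi)) //=; set S := \sum_(_ < _ | _) _;
       have : 0 <= S by [apply: sumr_ge0 => *; exact: nm_ge0]; lra.
  have h1 := hN _ hi; have h2 := hN i.+1 (leqW hi).
  rewrite /= subr0 in h1; rewrite /= subr0 in h2.
  have -> : a i * z0 ^+ i = series (fun i => a i * z0 ^+ i) i.+1 - series (fun i => a i * z0 ^+ i) i.
    by rewrite seriesSr addrAC subrr add0r.
  have : 0 <= \sum_(i < N) nm (a i * z0 ^+ i) by apply: sumr_ge0 => *; exact: nm_ge0.
  have := nmB (series (fun i => a i * z0 ^+ i) i.+1) (series (fun i => a i * z0 ^+ i) i); lra.
have hr : expands 0 (fun al : {ffun 'I_1 -> nat} => a (al 0)) (fun=> 0).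
  apply: (@expands_on_expands _ _ (rho / 4)); first by rewrite divr_gt0.
  move=> x hx; have hx0 : nm (x 0 0) <= rho / 4 by have := hx 0; rewrite mxE subr0.
  have [s hs] : exists s, has_sum (fun al : {ffun 'I_1 -> nat} =>
      a (al 0) * mon (fun i => x 0 i - (0 : 'rV_1) 0 i) al) s.
    apply: (@abs_has_sum_ex _ _ _ (M * 2 ^+ 1)) => A.
    apply: le_trans (geo_abs A _ hM); last by move=> _; rewrite ltW.
    apply: ler_sum => al _; rewrite nmM nm_mon ler_wpM2l ?nm_ge0 // ler_rmon // => i.
    by rewrite nm_ge0 /=; have := hx i; lra.
  suff <- : s = 0 by [].
  have hs' := has_sum_series ((has_sum_ord1 _ _).1 hs).
  have := h (x 0 0); have -> : (fun i => a i * x 0 0 ^+ i) = (fun i => a (cst1 i 0) *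
      mon (fun i0 => x 0 i0 - (0 : 'rV_1) 0 i0) (cst1 i)).
    by apply/funext => i; rewrite /mon big_ord1 !ffunE mxE subr0.
  move=> h0; apply: (@cvg_unique _ (@norm_hausdorff _ _) _ _ _ _ hs'); apply: h0; lra.
by move=> i; have := expands_inj hr (expands0 _) (cst1 i); rewrite ffunE.
Qed.

End OneVariable.

(** * Formal germs as arrays of Taylor coefficients *)

Section Germs.
Variables (R : realType) (m : nat).
Implicit Types (p : 'rV[CC R]_m.+1) (f g : fseries R m) (C D : {ffun 'I_m.+1 -> nat} -> CC R).

Definition gluei (al : {ffun 'I_m -> nat}) (i : nat) : {ffun 'I_m.+1 -> nat} :=
  [ffun k => if unlift ord_max k is Some k' then al k' else i].
Definition front (be : {ffun 'I_m.+1 -> nat}) : {ffun 'I_m -> nat} :=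
  [ffun k => be (lift ord_max k)].

Lemma glue_lift al i k : gluei al i (lift ord_max k) = al k.
Proof. by rewrite ffunE liftK. Qed.

Lemma glue_max al i : gluei al i ord_max = i.
Proof. by rewrite ffunE unlift_none. Qed.

Lemma front_glue al i : front (gluei al i) = al.
Proof. by apply/ffunP => k; rewrite ffunE glue_lift. Qed.

Lemma glue_front be : gluei (front be) (be ord_max) = be.
Proof. by apply/ffunP => k; rewrite ffunE; case: unliftP => [j ->|->] //; rewrite ffunE. Qed.

Lemma ffun_lift_ind (P : {ffun 'I_m.+1 -> nat} -> Prop) :
  (forall al i, P (gluei al i)) -> forall be, P be.
Proof. by move=> h be; rewrite -(glue_front be). Qed.

Lemma rmon_glue (r : 'I_m.+1 -> R) al i :
  rmon r (gluei al i) = rmon (fun k => r (lift ord_max k)) al * r ord_max ^+ i.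
Proof.
rewrite /rmon (bigD1_ord ord_max) //= glue_max mulrC; congr (_ * _).
by apply: eq_bigr => k _; rewrite glue_lift.
Qed.

Lemma mon_glue (h : 'I_m.+1 -> CC R) al i :
  mon h (gluei al i) = mon (fun k => h (lift ord_max k)) al * h ord_max ^+ i.
Proof.
rewrite /mon (bigD1_ord ord_max) //= glue_max mulrC; congr (_ * _).
by apply: eq_bigr => k _; rewrite glue_lift.
Qed.

Lemma deg_glue al i : deg (gluei al i) = (deg al + i)%N.
Proof.
rewrite /deg (bigD1_ord ord_max) //= glue_max addnC; congr (_ + _)%N.
by apply: eq_bigr => k _; rewrite glue_lift.
Qed.

Lemma has_sum_glue (F : {ffun 'I_m.+1 -> nat} -> CC R) s :
  has_sum F s <-> has_sum (fun x : {ffun 'I_m -> nat} * nat => F (gluei x.1 x.2)) s.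
Proof.
have c1 : cancel (fun x : {ffun 'I_m -> nat} * nat => gluei x.1 x.2)
    (fun be => (front be, be ord_max)) by case=> al i; rewrite front_glue glue_max.
have c2 : cancel (fun be => (front be, be ord_max))
    (fun x : {ffun 'I_m -> nat} * nat => gluei x.1 x.2) by move=> be; rewrite glue_front.
split=> h; first exact: has_sum_bij c1 c2 h.
by move: (has_sum_bij c2 c1 h); apply: eq_has_sum => al /=; rewrite glue_front.
Qed.

(** Every [f i] has its own neighbourhood of validity here; a common one comes from [formal_germ]
    and the identity theorem. *)
Definition tay p f C := forall i, expands (ycoord p) (fun al => C (gluei al i)) (f i).

Lemma formal_tay p f : formal_germ p f -> exists C, tay p f C.
Proof.
move=> /nbhs_singleton h; have /choice [C hC] := h.
by exists (fun be : {ffun 'I_m.+1 -> nat} => C (be ord_max) (front be)) => i; move: (hC i);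
  apply: filterS => x; apply: eq_has_sum => al; rewrite glue_max front_glue.
Qed.

Lemma tay_inj p f C D : tay p f C -> tay p f D -> C =1 D.
Proof.
move=> hC hD; elim/ffun_lift_ind => al i.
exact: (expands_inj (hC i) (hD i) al).
Qed.

Definition join_row (y : 'rV[CC R]_m) (z : CC R) : 'rV[CC R]_m.+1 :=
  \row_k (if unlift ord_max k is Some k' then y 0 k' else z).

Lemma join_lift y z k : join_row y z 0 (lift ord_max k) = y 0 k.
Proof. by rewrite mxE liftK. Qed.

Lemma join_max y z : join_row y z 0 ord_max = z.
Proof. by rewrite mxE unlift_none. Qed.

Lemma ycoordE (x : 'rV[CC R]_m.+1) k : ycoord x 0 k = x 0 (lift ord_max k).
Proof. by rewrite mxE. Qed.

Lemma ycoord_join y z : ycoord (join_row y z) = y.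
Proof. by apply/rowP => k; rewrite ycoordE join_lift. Qed.

Lemma forall_lift (P : 'I_m.+1 -> Prop) :
  (forall k, P (lift ord_max k)) -> P ord_max -> forall k, P k.
Proof. by move=> h1 h2 k; case: (unliftP ord_max k) => [j ->|->]. Qed.

(* Summing first over the exponents of the front variables. *)
Lemma pbd_slices C (r M : R) p (x : 'rV[CC R]_m.+1) : p 0 ord_max = 0 -> 0 < r ->
  pbd C (fun=> r) M -> (forall k, nm (x 0 k - p 0 k) <= r / 2) ->
  exists s (t : nat -> CC R),
    [/\ has_sum (fun be => C be * mon (fun k => x 0 k - p 0 k) be) s,
        forall i, has_sum (fun al => C (gluei al i) *
           mon (fun k => ycoord x 0 k - ycoord p 0 k) al) (t i)
      & series (fun i => t i * x 0 ord_max ^+ i) @ \oo --> s].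
Proof.
move=> p0 r0 hC hx.
have [s hs] : exists s, has_sum (fun be => C be * mon (fun k => x 0 k - p 0 k) be) s.
  apply: (@abs_has_sum_ex _ _ _ (M * 2 ^+ m.+1)) => A.
  apply: le_trans (geo_abs A _ hC); last by move=> _; rewrite ltW.
  apply: ler_sum => al _; rewrite nmM nm_mon ler_wpM2l ?nm_ge0 // ler_rmon // => i.
  by rewrite nm_ge0 /= hx.
have /choice [t ht] : forall i, exists t, has_sum (fun al => C (gluei al i) *
           mon (fun k => ycoord x 0 k - ycoord p 0 k) al) t.
  move=> i; have hCi : pbd (fun al => C (gluei al i)) (fun=> r) (M / r ^+ i).
    move=> al; rewrite ler_pdivlMr ?exprn_gt0 //; apply: le_trans (hC (gluei al i)).
    rewrite -mulrA ler_wpM2l ?nm_ge0 // /rmon (bigD1_ord ord_max) //= glue_max mulrC.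
    apply: ler_wpM2l; first by rewrite exprn_ge0 // ltW.
    apply: ler_prod => k _; by rewrite glue_lift lexx exprn_ge0 // ltW.
  apply: (@abs_has_sum_ex _ _ _ (M / r ^+ i * 2 ^+ m)) => A.
  apply: le_trans (geo_abs A _ hCi); last by move=> _; rewrite ltW.
  apply: ler_sum => al _; rewrite nmM nm_mon ler_wpM2l ?nm_ge0 // ler_rmon // => k.
  by rewrite nm_ge0 /= !ycoordE hx.
exists s, t; split=> //; apply: has_sum_series.
have := has_sum_fubini_swap ((has_sum_glue _ _).1 hs); apply=> i /=.
have := has_sumZ (c := x 0 ord_max ^+ i) (ht i); rewrite mulrC; apply: eq_has_sum => al.
rewrite mon_glue p0 subr0 [LHS]mulrC [RHS]mulrA; congr (_ * _ * _).
by apply: eq_bigr => k _; rewrite !ycoordE.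
Qed.

(** The analytic sum F has Cauchy estimates in all the variables at once. For fixed y, its slices
    and the [f i] are coefficients of two power series in the last variable with the same sum, so F
    has the Taylor array C. *)
Lemma convergent_bound p f C : p 0 ord_max = 0 -> convergent_germ p f -> tay p f C ->
  exists r M : R, 0 < r /\ pbd C (fun=> r) M.
Proof.
move=> p0 [F hF] hC; have [[D hD] _] := nbhs_singleton hF.
have [r [M [r0 bD hFr]]] := expands_strong hD.
move/nbhs_rowP: hF => [e e0 he].
suff CD : C =1 D by exists r, M; split=> // be; rewrite CD; exact: bD.
suff : tay p f D by exact: tay_inj hC.
pose rho := Num.min (r / 2) (e / 2).
have rho0 : 0 < rho by rewrite lt_min !divr_gt0.
have hrho : rho <= r / 2 /\ rho <= e / 2 by rewrite !ge_min !lexx orbT.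
move=> i; apply/nbhs_rowP; exists rho => // y hy.
have hx z k : nm z < rho -> nm (join_row y z 0 k - p 0 k) < rho.
  move=> hz; move: k; apply: forall_lift => [k|]; last by rewrite join_max p0 subr0.
  by rewrite join_lift; have := hy k; rewrite ycoordE.
have h0 : nm (0 : CC R) < rho by rewrite nm0.
have hsl z : nm z < rho -> forall k, nm (join_row y z 0 k - p 0 k) <= r / 2.
  by move=> hz k; have := hx z k hz; lra.
have [_ [t [_ ht _]]] := pbd_slices p0 r0 bD (hsl 0 h0).
suff -> : f i y = t i by have := ht i; rewrite ycoord_join.
apply/eqP; rewrite -subr_eq0; apply/eqP.
apply: (pseries_eq0 (a := fun i => f i y - t i) rho0) => z hz.
have [s [t' [hs ht' hser]]] := pbd_slices p0 r0 bD (hsl z hz).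
have tt' : t' = t.
  apply/funext => j; apply: has_sum_uniq (ht' j) _; have := ht j.
  by rewrite !ycoord_join.
rewrite tt' join_max in hser.
have sF : s = F (join_row y z).
  by apply: has_sum_uniq hs _; apply: hFr => k; have := hx z k hz; lra.
have [|_] := he (join_row y z); first by move=> k; have := hx z k hz; lra.
rewrite ycoord_join join_max -sF => hf.
rewrite -(subrr s); have -> : series (fun j => (f j y - t j) * z ^+ j) =
    (fun n => series (fun j => f j y * z ^+ j) n - series (fun j => t j * z ^+ j) n).
  apply/funext => n; rewrite /series /= -sumrB; apply: eq_bigr => j _.
  by rewrite mulrBl.
exact: cvgB hf hser.
Qed.

Lemma bound_convergent p f C (r M : R) : p 0 ord_max = 0 -> formal_germ p f -> tay p f C ->
  0 < r -> pbd C (fun=> r) M -> convergent_germ p f.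
Proof.
move=> p0 /nbhs_rowP [e e0 he] hC r0 bC.
pose F (x : 'rV[CC R]_m.+1) := sum (fun be => C be * mon (fun k => x 0 k - p 0 k) be).
have hF (x : 'rV[CC R]_m.+1) : (forall k, nm (x 0 k - p 0 k) <= r / 2) ->
    has_sum (fun be => C be * mon (fun k => x 0 k - p 0 k) be) (F x).
  by move=> hx; have [s [t [hs _ _]]] := pbd_slices p0 r0 bC hx; rewrite /F (has_sum_sum hs).
have r2 : 0 < r / 2 by rewrite divr_gt0.
exists F; apply: filterI.
  by apply: expands_analytic; apply: (@expands_on_expands _ _ (r / 2)) => // x hx; exact: hF.
pose T i (y : 'rV[CC R]_m) := sum (fun al => C (gluei al i) * mon (fun k => y 0 k - ycoord p 0 k) al).
pose rho := Num.min (r / 8) e.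
have rho0 : 0 < rho by rewrite lt_min divr_gt0.
have hrho : rho <= r / 8 /\ rho <= e by rewrite !ge_min !lexx orbT.
have hT i : expands_on (r / 2) (ycoord p) (fun al => C (gluei al i)) (T i).
  move=> y hy; have [|_ [t [_ ht _]]] := pbd_slices (x := join_row y 0) p0 r0 bC.
    by apply: forall_lift => [k|]; rewrite ?join_lift ?join_max ?p0 ?subrr ?nm0 ?(ltW r2) -?ycoordE.
  by have := ht i; rewrite ycoord_join /T => h; rewrite (has_sum_sum h).
apply/nbhs_rowP; exists rho => // x hx.
have hx2 k : nm (x 0 k - p 0 k) <= r / 2 by have := hx k; lra.
have [s [t [hs ht hser]]] := pbd_slices p0 r0 bC hx2.
rewrite (has_sum_uniq (hF x hx2) hs); suff ft i : f i (ycoord x) = t i.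
  by have -> : (fun i => f i (ycoord x) * x 0 ord_max ^+ i) = (fun i => t i * x 0 ord_max ^+ i)
    by apply/funext => i; rewrite ft.
have -> : t i = T i (ycoord x) by rewrite /T (has_sum_sum (ht i)).
(* [f i] is known to agree with [T i] only on a neighbourhood that may shrink as i grows; both are
   analytic on the polydisc of radius rho, which does not. *)
apply: (analytic_eq_ball (p := ycoord p) rho0) => [y hy|y hy||k].
- by apply: he => k; have := hy k; lra.
- have hCi : pbd (fun al => C (gluei al i)) (fun=> r / 2) (M / r ^+ i).
    move=> al; rewrite ler_pdivlMr ?exprn_gt0 //; apply: le_trans (bC (gluei al i)).
    rewrite -mulrA ler_wpM2l ?nm_ge0 // /rmon (bigD1_ord ord_max) //= glue_max mulrC.
    apply: ler_wpM2l; first by rewrite exprn_ge0 // ltW.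
    apply: ler_prod => k _; rewrite glue_lift.
    have [h1 h2] : 0 <= r / 2 /\ r / 2 <= r by lra.
    apply/andP; split; first exact: exprn_ge0.
    by apply: lerXn2r; rewrite ?nnegrE // ltW.
  exists (recenter (fun al => C (gluei al i)) (fun k => y 0 k - ycoord p 0 k)).
  apply: (@expands_on_expands _ _ (r / 2 / 4)); first by rewrite !divr_gt0.
  by apply: expands_on_recenter hCi (hT i) _ => // k; have := hy k; lra.
- apply: filterS2 (hC i) (expands_on_expands r2 (hT i)) => y h1 h2; exact: has_sum_uniq h1 h2.
by rewrite !ycoordE; exact: hx.
Qed.

End Germs.

(** * Arrays of derivatives and the action of the Weyl algebra *)

Section Factorials.
Local Open Scope nat_scope.

Lemma fact_add_le s t : s`! * t`! <= (s + t)`!.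
Proof.
have -> : (s + t)`! = 'C(s + t, s) * (s`! * t`!).
  by rewrite -(bin_fact (leq_addr t s)) addKn.
by rewrite leq_pmull // bin_gt0 leq_addr.
Qed.

Lemma fact_add_ge s t : (s + t)`! <= 2 ^ (s + t) * (s`! * t`!).
Proof.
rewrite -{1}(bin_fact (leq_addr t s)) addKn leq_mul2r; apply/orP; right.
have -> : 2 ^ (s + t) = \sum_(i < (s + t).+1) 'C(s + t, i).
  by rewrite -[2]/(1 + 1) expnDn; apply: eq_bigr => i _; rewrite !exp1n !muln1.
have hs : s < (s + t).+1 by rewrite ltnS leq_addr.
by rewrite (bigD1 (Ordinal hs)) //= leq_addr.
Qed.

Definition mfact N (be : {ffun 'I_N -> nat}) := \prod_k (be k)`!.

Lemma mfact_gt0 N (be : {ffun 'I_N -> nat}) : 0 < mfact be.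
Proof. by apply: prodn_gt0 => k; rewrite fact_gt0. Qed.

Lemma mfact_le N (be : {ffun 'I_N -> nat}) : mfact be <= (deg be)`!.
Proof.
rewrite /mfact /deg; elim/big_rec2: _ => // k s t _ h.
by apply: leq_trans (fact_add_le _ _); rewrite leq_mul2l h orbT.
Qed.

(** An exponential bound for multinomial coefficients; the crude base 2 ^ size r comes from peeling
    off one summand at a time. *)
Lemma fact_sum_ge (I : Type) (r : seq I) (F : I -> nat) :
  (\sum_(i <- r) F i)`! <= 2 ^ (size r * \sum_(i <- r) F i) * \prod_(i <- r) (F i)`!.
Proof.
elim: r => [|k r IH]; first by rewrite !big_nil.
rewrite !big_cons /=; set S := \sum_(_ <- _) _ in IH *; set P := \prod_(_ <- _) _ in IH *.
apply: leq_trans (fact_add_ge _ _) _; apply: leq_trans (leq_mul (leqnn _) (leq_mul (leqnn _) IH)) _.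
have -> : 2 ^ (F k + S) * ((F k)`! * (2 ^ (size r * S) * P)) =
  2 ^ (F k + S + size r * S) * ((F k)`! * P) by rewrite [(F k)`! * (_ * _)]mulnCA mulnA -expnD.
rewrite leq_mul2r leq_pexp2l ?orbT // mulSn leq_add2l leq_mul2l leq_addl orbT //.
Qed.

Lemma mfact_ge N (be : {ffun 'I_N -> nat}) : (deg be)`! <= 2 ^ (N * deg be) * mfact be.
Proof.
have := fact_sum_ge (index_enum 'I_N) be.
suff -> : size (index_enum 'I_N) = N by [].
rewrite -[RHS]card_ord cardE; apply/perm_size/uniq_perm.
- exact: index_enum_uniq.
- exact: enum_uniq.
by move=> i; rewrite mem_index_enum mem_enum.
Qed.

Lemma mfact_glue m (al : {ffun 'I_m -> nat}) i : mfact (gluei al i) = mfact al * i`!.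
Proof.
rewrite /mfact (bigD1_ord ord_max) //= glue_max mulnC; congr (_ * _).
by apply: eq_bigr => k _; rewrite glue_lift.
Qed.

Lemma mfact0 m : mfact (zeroi : {ffun 'I_m -> nat}) = 1.
Proof. by rewrite /mfact big1 // => k _; rewrite ffunE. Qed.

Lemma mfactS N (be : {ffun 'I_N -> nat}) k : mfact (addi be (uniti k)) = (be k).+1 * mfact be.
Proof.
rewrite /mfact (bigD1 k) //= [\prod_k0 _](bigD1 k) //= !ffunE eqxx addn1 factS -mulnA.
congr (_ * (_ * _)); apply: eq_bigr => i /negPf ik; by rewrite !ffunE ik addn0.
Qed.

End Factorials.

(** * Convergent arrays of derivatives and their stability under the Weyl algebra *)

Section ConvergentArrays.
Variables (R : realType) (N : nat).
Implicit Types (be : {ffun 'I_N -> nat}) (d : {ffun 'I_N -> nat} -> CC R).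

(* d is the array of the derivatives at p of a formal germ; the germ converges iff [convarr d]. *)
Definition convarr d := exists M B : R, [/\ 0 <= M, 1 <= B &
  forall be, nm (d be) <= M * B ^+ deg be * (deg be)`!%:R].

Lemma carr_le d d' (c : R) : 0 <= c -> (forall be, nm (d be) <= c * nm (d' be)) -> convarr d' -> convarr d.
Proof.
move=> c0 h [M [B [M0 B1 hM]]]; exists (c * M), B; split=> //; first exact: mulr_ge0.
by move=> be; apply: le_trans (h be) _; rewrite -!mulrA ler_wpM2l // mulrA hM.
Qed.

Lemma carr_ext d d' : d =1 d' -> convarr d -> convarr d'.
Proof. by move=> /funext ->. Qed.

Lemma carr0 : convarr (fun=> 0).
Proof. by exists 0, 1; split=> // be; rewrite nm0 !mul0r. Qed.

Lemma carrD d d' : convarr d -> convarr d' -> convarr (fun be => d be + d' be).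
Proof.
move=> [M [B [M0 B1 hM]]] [M' [B' [M'0 B'1 hM']]].
have B0 : 0 <= B by lra.
have B'0 : 0 <= B' by lra.
exists (M + M'), (Num.max B B'); split; [exact: addr_ge0|by rewrite le_max B1|].
move=> be; apply: le_trans (nmD _ _) _; rewrite !mulrDl; apply: lerD.
  apply: le_trans (hM be) _; rewrite ler_wpM2r // ler_wpM2l //.
  by rewrite lerXn2r ?nnegrE ?le_max ?B0 ?lexx.
apply: le_trans (hM' be) _; rewrite ler_wpM2r // ler_wpM2l //.
by rewrite lerXn2r ?nnegrE ?le_max ?B'0 ?lexx ?orbT.
Qed.

Lemma carrZ c d : convarr d -> convarr (fun be => c * d be).
Proof. by apply: (@carr_le _ _ (nm c)) => [|be]; rewrite ?nm_ge0 ?nmM. Qed.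

Lemma carrB d d' : convarr d -> convarr d' -> convarr (fun be => d be - d' be).
Proof.
move=> h h'; move: (carrD h (carrZ (-1) h')); apply: carr_ext => be.
by rewrite mulN1r.
Qed.

Lemma carr_sum (T : Type) (r : seq T) (d : T -> {ffun 'I_N -> nat} -> CC R) :
  (forall t, convarr (d t)) -> convarr (fun be => \sum_(t <- r) d t be).
Proof.
move=> h; elim: r => [|t r IH]; first by apply: carr_ext carr0 => be; rewrite big_nil.
by apply: carr_ext (carrD (h t) IH) => be; rewrite big_cons.
Qed.

Lemma rmon_const (r : R) be : rmon (fun=> r) be = r ^+ deg be.
Proof. by rewrite /rmon /deg prodrXr. Qed.

(** |be|! and be! differ by a factor at most exponential in |be|, which is absorbed by the
    radius. *)
Lemma carr_pbd d : convarr d <->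
  exists r M : R, 0 < r /\ pbd (fun be => d be / (mfact be)%:R) (fun=> r) M.
Proof.
have f0 be : (0 : R) < (mfact be)%:R by rewrite ltr0n mfact_gt0.
split=> [[M [B [M0 B1 hM]]]|[r [M [r0 hM]]]].
  have B0 : 0 < B by lra.
  exists (B * 2 ^+ N)^-1, M; split; first by rewrite invr_gt0 mulr_gt0 // exprn_gt0.
  move=> be; rewrite rmon_const exprVn nmM nmV nm_nat.
  rewrite ler_pdivrMr ?exprn_gt0 ?mulr_gt0 ?exprn_gt0 // ler_pdivrMr //.
  apply: le_trans (hM be) _; rewrite exprMn mulrA -[X in _ <= X]mulrA ler_wpM2l //.
    by rewrite mulr_ge0 // exprn_ge0 // ltW.
  by rewrite -exprM -natrX -natrM ler_nat mfact_ge.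
have M0 : 0 <= M by apply: pbd_ge0 hM => i; rewrite ltW.
exists M, (Num.max 1 r^-1); split=> //; first by rewrite le_max lexx.
move=> be; have := hM be; rewrite rmon_const nmM nmV nm_nat -ler_pdivlMr ?exprn_gt0 //.
rewrite ler_pdivrMr // => h; apply: le_trans h _.
apply: ler_pM; rewrite ?ler0n ?divr_ge0 ?exprn_ge0 ?(ltW r0) //; last by rewrite ler_nat mfact_le.
rewrite -exprVn ler_wpM2l // lerXn2r ?nnegrE ?le_max ?invr_ge0 ?(ltW r0) ?lexx ?orbT //.
Qed.

Variable p : 'rV[CC R]_N.

(** In the case of [Wx] the factor be_k vanishes when be - e_k would leave the set of
    multi-indices. *)
Fixpoint wactD (P : weyl (CC R) N) d : {ffun 'I_N -> nat} -> CC R :=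
  match P with
  | Wcst c => fun be => c * d be
  | Wx k => fun be => p 0 k * d be + (be k)%:R * d (subi be (uniti k))
  | Wd k => fun be => d (addi be (uniti k))
  | Wadd P Q => fun be => wactD P d be + wactD Q d be
  | Wmul P Q => wactD P (wactD Q d)
  end.

Lemma wactD_add P d d' : wactD P (fun be => d be + d' be) = (fun be => wactD P d be + wactD P d' be).
Proof.
elim: P d d' => [c|k|k|P IHP Q IHQ|P IHP Q IHQ] d d' /=; first 1 last.
- by apply/funext => be; rewrite !mulrDr addrACA.
- by [].
- by rewrite IHP IHQ; apply/funext => be; rewrite addrACA.
- by rewrite IHQ IHP.
by apply/funext => be; rewrite mulrDr.
Qed.

Lemma wactD_scale P c d : wactD P (fun be => c * d be) = (fun be => c * wactD P d be).
Proof.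
elim: P d => [c'|k|k|P IHP Q IHQ|P IHP Q IHQ] d /=; first 1 last.
- by apply/funext => be; rewrite mulrDr !mulrA ![c * _]mulrC.
- by [].
- by rewrite IHP IHQ; apply/funext => be; rewrite mulrDr.
- by rewrite IHQ IHP.
by apply/funext => be; rewrite mulrCA.
Qed.

Lemma wactD_sum P (T : Type) (r : seq T) (d : T -> {ffun 'I_N -> nat} -> CC R) :
  wactD P (fun be => \sum_(t <- r) d t be) = (fun be => \sum_(t <- r) wactD P (d t) be).
Proof.
elim: r => [|t r IH].
  have -> : (fun be => \sum_(t <- [::]) d t be) = (fun be => 0 * (0 : CC R)).
    by apply/funext => be; rewrite big_nil mul0r.
  by rewrite wactD_scale; apply/funext => be; rewrite big_nil mul0r.
have -> : (fun be => \sum_(t <- t :: r) d t be) = (fun be => d t be + \sum_(t <- r) d t be).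
  by apply/funext => be; rewrite big_cons.
by rewrite wactD_add IH; apply/funext => be; rewrite big_cons.
Qed.

Lemma carr_wactD P d : convarr d -> convarr (wactD P d).
Proof.
elim: P d => [c|k|k|P IHP Q IHQ|P IHP Q IHQ] d hd /=; first exact: carrZ.
- apply: carrD; first exact: carrZ.
  have [M [B [M0 B1 hM]]] := hd; exists M, B; split=> // be.
  rewrite nmM nm_nat; case: (posnP (be k)) => hk.
    by rewrite hk mul0r !mulr_ge0 // exprn_ge0 //; lra.
  have e : deg be = (deg (subi be (uniti k))).+1 by rewrite -{1}(subiK hk) degD deg_uniti addn1.
  apply: le_trans (ler_wpM2l (ler0n _ _) (hM _)) _.
  rewrite e exprS factS natrM; set n := deg _.
  have h1 : ((be k)%:R : R) <= n.+1%:R by rewrite ler_nat -e leq_deg.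
  have Bn : 0 <= B ^+ n by rewrite exprn_ge0 //; lra.
  have -> : (be k)%:R * (M * B ^+ n * n`!%:R) = M * B ^+ n * ((be k)%:R * n`!%:R) by ring.
  have -> : M * (B * B ^+ n) * (n.+1%:R * n`!%:R) = M * B ^+ n * (B * n.+1%:R * n`!%:R) by ring.
  rewrite ler_wpM2l ?mulr_ge0 // ler_wpM2r //.
  by apply: le_trans h1 _; rewrite ler_peMl.
(* The order rises by one: of the new factors B and |be| + 1, the first goes into the constant and
   the second is at most 2 ^ |be|. *)
- have [M [B [M0 B1 hM]]] := hd; exists (M * B), (2 * B); split=> [||be]; [|lra|].
    by rewrite mulr_ge0 //; lra.
  apply: le_trans (hM _) _; rewrite degD deg_uniti addn1 exprS mulrA -!mulrA.
  rewrite ler_wpM2l // ler_wpM2l //; first by lra.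
  rewrite exprMn [2 ^+ _ * _]mulrC -mulrA ler_wpM2l //; first by rewrite exprn_ge0 //; lra.
  by rewrite factS natrM ler_wpM2r // -natrX ler_nat ltn_expl.
- exact: carrD (IHP _ hd) (IHQ _ hd).
exact: IHP (IHQ _ hd).
Qed.

Lemma wactD_iter k n d be : wactD (iter n (Wmul (Wd k)) (Wcst 1)) d be =
  d [ffun i => be i + (i == k) * n]%N.
Proof.
elim: n be => [|n IH] be /=.
  by rewrite mul1r; congr d; apply/ffunP => i; rewrite ffunE muln0 addn0.
rewrite IH; congr d; apply/ffunP => i; rewrite !ffunE mulnS addnA //.
Qed.

Lemma wactD_mon (u : 'I_N -> nat) d be :
  wactD (Wdmon (CC R) u) d be = d (addi be [ffun i => u i]).
Proof.
have H (r : seq 'I_N) d' be' :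
    wactD (\big[@Wmul (CC R) N/Wcst 1]_(i <- r) iter (u i) (Wmul (Wd i)) (Wcst 1)) d' be' =
    d' [ffun i => be' i + count_mem i r * u i]%N.
  elim: r be' => [|k r IH] be'.
    by rewrite big_nil /= mul1r; congr d'; apply/ffunP => i; rewrite ffunE addn0.
  rewrite big_cons /= wactD_iter IH; congr d'; apply/ffunP => i; rewrite !ffunE /=.
  rewrite mulnDl addnA eq_sym; case: eqP => [->|] //; by rewrite !mul0n.
rewrite H; congr d; apply/ffunP => i; rewrite !ffunE; congr (_ + _)%N.
by rewrite count_uniq_mem ?index_enum_uniq // mem_index_enum mul1n.
Qed.

Lemma wactD_euler (a : 'I_N -> nat) beta d be :
  wactD (euler_op a beta) d be =
  \sum_j (a j)%:R * (p 0 j * d (addi be (uniti j)) + (be j)%:R * d be) - beta * d be.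
Proof.
rewrite /= mulNr; congr (_ - _).
elim: (index_enum _) => [|j r IH]; first by rewrite !big_nil /= mul0r.
rewrite !big_cons /= IH; congr (_ * (_ + _) + _).
case: (posnP (be j)) => hj; first by rewrite hj !mul0r.
by rewrite subiK.
Qed.

Definition annihilatedD (a : 'I_N -> nat) beta d :=
  forall P, hyp_ideal a beta P -> convarr (wactD P d).

(** Convergent arrays are stable under all operators, so it is enough to test the generators of the
    two nested left ideals. *)
Lemma annihilatedD_gen a beta d :
  (forall u : 'I_N -> int, \sum_i (a i)%:Z * u i = 0 ->
    convarr (fun be => d (addi be [ffun i => posp u i]) - d (addi be [ffun i => negp u i]))) ->
  convarr (fun be => \sum_j (a j)%:R * (p 0 j * d (addi be (uniti j)) + (be j)%:R * d be) - beta * d be) ->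
  annihilatedD a beta d.
Proof.
move=> hu hE P; elim=> {P} [P [|->]||P Q _ hP _ hQ|P Q _ _ hQ] /=.
- elim=> {P} [P [u [u0 ->]]||P Q _ hP _ hQ|P Q _ _ hQ] /=.
  + by move: (hu u u0); apply: carr_ext => be; rewrite !wactD_mon mulN1r.
  + by apply: carr_ext carr0 => be; rewrite mul0r.
  + exact: carrD.
  exact: carr_wactD.
- by move: hE; apply: carr_ext => be; rewrite -wactD_euler.
- by apply: carr_ext carr0 => be; rewrite mul0r.
- exact: carrD.
exact: carr_wactD.
Qed.

Lemma annihilatedD_conv a beta d : convarr d -> annihilatedD a beta d.
Proof. by move=> hd P _; exact: carr_wactD. Qed.

Lemma annihilatedD_add a beta d d' : annihilatedD a beta d -> annihilatedD a beta d' ->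
  annihilatedD a beta (fun be => d be + d' be).
Proof. by move=> h h' P hP; rewrite wactD_add; apply: carrD; [exact: h|exact: h']. Qed.

Lemma annihilatedD_sum a beta (T : Type) (r : seq T) (lam : T -> CC R)
    (d : T -> {ffun 'I_N -> nat} -> CC R) :
  (forall t, annihilatedD a beta (d t)) ->
  annihilatedD a beta (fun be => \sum_(t <- r) lam t * d t be).
Proof.
move=> h P hP; rewrite wactD_sum; apply: carr_sum => t.
by rewrite wactD_scale; apply: carrZ; exact: h.
Qed.

End ConvergentArrays.

(** * From formal germs to arrays of derivatives *)

Section TayD.
Variables (R : realType) (m : nat).
Implicit Types (p : 'rV[CC R]_m.+1) (f g : fseries R m) (d : {ffun 'I_m.+1 -> nat} -> CC R).

Definition tayd p f d := tay p f (fun be => d be / (mfact be)%:R).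

Let mfact_neq0 (be : {ffun 'I_m.+1 -> nat}) : (mfact be)%:R != 0 :> CC R.
Proof. by rewrite pnatr_eq0 -lt0n mfact_gt0. Qed.

Lemma formal_tayd p f : formal_germ p f -> exists d, tayd p f d.
Proof.
move=> /formal_tay [C hC]; exists (fun be => C be * (mfact be)%:R).
have -> : tayd p f (fun be => C be * (mfact be)%:R) = tay p f C; last by [].
by congr tay; apply/funext => be; rewrite mulfK.
Qed.

Lemma carr_germP p f d : p 0 ord_max = 0 -> formal_germ p f -> tayd p f d ->
  convergent_germ p f <-> convarr d.
Proof.
move=> p0 hf hd; rewrite carr_pbd; split; first by move/convergent_bound; exact.
by move=> [r [M [r0 hM]]]; apply: bound_convergent hd r0 hM.
Qed.

Lemma glueD_lift al i (k : 'I_m) : addi (gluei al i) (uniti (lift ord_max k)) = gluei (addi al (uniti k)) i.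
Proof.
apply/ffunP; apply: forall_lift => [j|]; rewrite !ffunE ?glue_lift ?glue_max ?ffunE.
  by rewrite liftK !ffunE (inj_eq lift_inj).
by rewrite unlift_none (negPf (neq_lift _ _)) addn0.
Qed.

Lemma glueD_max (al : {ffun 'I_m -> nat}) i : addi (gluei al i) (uniti ord_max) = gluei al i.+1.
Proof.
apply/ffunP; apply: forall_lift => [j|]; rewrite !ffunE ?liftK ?unlift_none ?eqxx ?addn1 //.
by rewrite eq_sym (negPf (neq_lift _ _)) addn0.
Qed.

Lemma formal_wact p P f : formal_germ p f -> formal_germ p (wact P f).
Proof.
elim: P f => [c|k|k|P IHP Q IHQ|P IHP Q IHQ] f hf /=.
- by apply: filterS hf => y hy i; have [C hC] := hy i; eexists; exact: expandsZ hC.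
- apply: filterS hf => y hy i; rewrite /mul_x; case: unliftP => [k' _|_].
    by have [C hC] := hy i; eexists; exact: expands_mulx hC.
  by case: i => [|i]; [eexists; exact: expands0|exact: hy].
- apply: filterS hf => y hy i; rewrite /diff_x; case: unliftP => [k' _|_].
    by have [C hC] := hy i; eexists; exact: expands_derive hC.
  by have [C hC] := hy i.+1; eexists; exact: expandsZ hC.
- apply: filterS2 (IHP f hf) (IHQ f hf) => y h1 h2 i.
  by have [C hC] := h1 i; have [D hD] := h2 i; eexists; exact: expandsD hC hD.
exact: IHP (IHQ _ hf).
Qed.

Lemma expands_ext q C D (g : 'rV[CC R]_m -> CC R) : C =1 D -> expands q C g -> expands q D g.
Proof. by move=> /funext ->. Qed.

Lemma tayd_wact p P f d : p 0 ord_max = 0 -> tayd p f d -> tayd p (wact P f) (wactD p P d).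
Proof.
move=> p0; elim: P f d => [c|k|k|P IHP Q IHQ|P IHP Q IHQ] f d hd i /=.
- by apply: expands_ext (expandsZ c (hd i)) => al; rewrite mulrA.
- rewrite /mul_x; case: unliftP => [k' ->|->].
    apply: expands_ext (expands_mulx k' (hd i)) => al.
    rewrite /tmulx ycoordE glue_lift mulrDl mulrA; congr (_ + _).
    case E: (al k') => [|j]; first by rewrite !mul0r.
    have hk : (0 < al k')%N by rewrite E.
    rewrite -{3 4}(subiK hk) -!glueD_lift mfactS glue_lift addiK ffunE E !ffunE eqxx subn1 /=.
    by rewrite natrM invfM mulrACA mulfV ?pnatr_eq0 // mul1r.
  case: i => [|i].
    by apply: expands_ext (expands0 _) => al; rewrite p0 mul0r add0r glue_max !mul0r.
  apply: expands_ext (hd i) => al.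
  rewrite p0 mul0r add0r glue_max -glueD_max addiK mfactS glue_max natrM invfM mulrACA mulfV ?mul1r //.
- rewrite /diff_x; case: unliftP => [k' ->|->].
    apply: expands_ext (expands_derive k' (hd i)) => al.
    rewrite /dC -glueD_lift mfactS glue_lift natrM invfM mulrCA; congr (_ * _).
    by rewrite mulrA mulfV ?mul1r // pnatr_eq0.
  apply: expands_ext (expandsZ _ (hd i.+1)) => al.
  rewrite -glueD_max mfactS glue_max natrM invfM mulrCA; congr (_ * _).
  by rewrite mulrA mulfV ?mul1r // pnatr_eq0.
- by apply: expands_ext (expandsD (IHP f d hd i) (IHQ f d hd i)) => al; rewrite mulrDl.
exact: (IHP _ _ (IHQ _ _ hd)).
Qed.

Lemma annihilatedP (a : 'I_m.+1 -> nat) beta p f d : p 0 ord_max = 0 ->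
  formal_germ p f -> tayd p f d -> annihilated a beta p f <-> annihilatedD p a beta d.
Proof.
move=> p0 hf hd; split=> h P /h.
  by move/(carr_germP p0 (formal_wact P hf) (tayd_wact P p0 hd)).
by move/(carr_germP p0 (formal_wact P hf) (tayd_wact P p0 hd)).
Qed.

Lemma formal_lin p f (n0 : nat) (lam : 'I_n0 -> CC R) (Phi : 'I_n0 -> fseries R m) (c : CC R) :
  formal_germ p f -> (forall j, formal_germ p (Phi j)) ->
  formal_germ p (fun i y => c * f i y + \sum_j lam j * Phi j i y).
Proof.
move=> hf hPhi; have hS : formal_germ p (fun i y => \sum_j lam j * Phi j i y).
  elim: (index_enum _) => [|j r IH].
    apply: filterE => y i; eexists; have := expands0 y; apply: expands_near.
    by apply: filterE => x; rewrite big_nil.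
  apply: filterS2 (hPhi j) IH => y h1 h2 i; have [C hC] := h1 i; have [D hD] := h2 i.
  eexists; move: (expandsD (expandsZ (lam j) hC) hD); apply: expands_near.
  by apply: filterE => x; rewrite big_cons.
apply: filterS2 hf hS => y h1 h2 i; have [C hC] := h1 i; have [D hD] := h2 i.
eexists; exact: expandsD (expandsZ c hC) hD.
Qed.

Lemma tayd_lin p f d (n0 : nat) (lam : 'I_n0 -> CC R) (Phi : 'I_n0 -> fseries R m) dPhi (c : CC R) :
  tayd p f d -> (forall j, tayd p (Phi j) (dPhi j)) ->
  tayd p (fun i y => c * f i y + \sum_j lam j * Phi j i y)
    (fun be => c * d be + \sum_j lam j * dPhi j be).
Proof.
move=> hf hPhi i; have hS : expands (ycoord p)
    (fun al => \sum_j lam j * (dPhi j (gluei al i) / (mfact (gluei al i))%:R))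
    (fun y => \sum_j lam j * Phi j i y).
  elim: (index_enum _) => [|j r IH].
    have := expands0 (ycoord p); have -> : (fun=> 0) = (fun y => \sum_(j <- [::]) lam j * Phi j i y) :> ('rV_m -> CC R).
      by apply/funext => y; rewrite big_nil.
    by apply: expands_ext => al; rewrite big_nil.
  have := expandsD (expandsZ (lam j) (hPhi j i)) IH.
  have -> : (fun y => lam j * Phi j i y + \sum_(j <- r) lam j * Phi j i y) =
      (fun y => \sum_(j <- j :: r) lam j * Phi j i y).
    by apply/funext => y; rewrite big_cons.
  by apply: expands_ext => al; rewrite big_cons.
move: (expandsD (expandsZ c (hf i)) hS); apply: expands_ext => al.
rewrite mulrDl mulrA mulr_suml; congr (_ + _); apply: eq_bigr => j _; by rewrite mulrA.
Qed.

End TayD.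

(** * The toric relations *)

Section Toric.
Variables (R : realType) (n : nat) (a : 'I_n.+3 -> nat).
Hypothesis a_first : a ord0 = 1%N.
Hypothesis a_incr : forall i j : 'I_n.+3, (i < j)%N -> (a i < a j)%N.
Implicit Types (be ga : {ffun 'I_n.+3 -> nat}) (d : {ffun 'I_n.+3 -> nat} -> CC R).
Local Notation aN := (a ord_max).

Definition wt be := (\sum_i a i * be i)%N.
Definition times k m : {ffun 'I_n.+3 -> nat} := [ffun i => (i == k) * m]%N.

Lemma a_gt0 i : (0 < a i)%N.
Proof.
case: (posnP i) => [i0|/(a_incr (i := ord0))]; last exact: leq_trans.
have -> : i = ord0 by apply: ord_inj; rewrite i0.
by rewrite a_first.
Qed.

Lemma a_le_max i : (a i <= aN)%N.
Proof.
have [e|] := eqVneq i ord_max; first by rewrite e.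
by rewrite -val_eqE /= => h; apply/ltnW/a_incr; rewrite ltn_neqAle h /= -ltnS.
Qed.

Lemma a_lt_max i : i != ord_max -> (a i < aN)%N.
Proof. by rewrite -val_eqE /= => h; apply: a_incr; rewrite ltn_neqAle h /= -ltnS. Qed.

Lemma wtD be ga : wt (addi be ga) = (wt be + wt ga)%N.
Proof. by rewrite /wt -big_split; apply: eq_bigr => i _; rewrite ffunE mulnDr. Qed.

Lemma wt_times k m : wt (times k m) = (a k * m)%N.
Proof.
rewrite /wt (bigD1 k) //= ffunE eqxx mul1n big1 ?addn0 // => i /negPf ik.
by rewrite ffunE ik mul0n muln0.
Qed.

Lemma deg_times k m : deg (times k m) = m.
Proof.
rewrite /deg (bigD1 k) //= ffunE eqxx mul1n big1 ?addn0 // => i /negPf ik.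
by rewrite ffunE ik mul0n.
Qed.

Lemma wt_uniti k : wt (uniti k) = a k.
Proof.
have -> : uniti k = times k 1 by apply/ffunP => i; rewrite !ffunE muln1.
by rewrite wt_times muln1.
Qed.

Lemma wt_le be : (wt be <= aN * deg be)%N.
Proof. by rewrite /wt /deg big_distrr /=; apply: leq_sum => i _; rewrite leq_mul2r a_le_max orbT. Qed.

(* The monomial d_1^(k mod a_N) d_N^(k / a_N), a normal form of the monomials of weight k
   modulo the toric relations d_i = d_1^(a_i). *)
Definition nf k : {ffun 'I_n.+3 -> nat} :=
  [ffun i => if i == ord0 then k %% aN else if i == ord_max then k %/ aN else 0]%N.

Lemma big_ends (F : 'I_n.+3 -> nat) :
  (\sum_i F i = F ord0 + (\sum_(i | (i != ord0) && (i != ord_max)) F i + F ord_max))%N.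
Proof.
by rewrite (bigD1 ord0) //= (bigD1 ord_max (P := fun i => i != ord0)) //= [(F ord_max + _)%N]addnC.
Qed.

Lemma nf_ends k : nf k ord0 = (k %% aN)%N /\ nf k ord_max = (k %/ aN)%N.
Proof. by split; rewrite ffunE //= eqxx. Qed.

Lemma wt_nf k : wt (nf k) = k.
Proof.
rewrite /wt big_ends big1 => [|i /andP[/negPf h1 /negPf h2]]; last by rewrite ffunE h1 h2 muln0.
have [-> ->] := nf_ends k; rewrite a_first mul1n add0n addnC mulnC; exact/esym/divn_eq.
Qed.

Lemma deg_nf k : deg (nf k) = (k %% aN + k %/ aN)%N.
Proof.
rewrite /deg big_ends big1 => [|i /andP[/negPf h1 /negPf h2]]; last by rewrite ffunE h1 h2.
by have [-> ->] := nf_ends k.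
Qed.

Definition red be : {ffun 'I_n.+3 -> nat} :=
  [ffun i => if i == ord0 then be ord0 %% aN
             else if i == ord_max then be ord_max + be ord0 %/ aN else be i]%N.

(** During the second reduction [tail] controls the orders, and [mid], the number of factors d_i
    with 1 < i < N, counts the steps. *)
Definition tail be := (\sum_(i | i != ord0) be i)%N.
Definition mid be := (\sum_(i | (i != ord0) && (i != ord_max)) be i)%N.

Lemma deg_tail be : deg be = (be ord0 + tail be)%N.
Proof. by rewrite /deg (bigD1 ord0). Qed.

Lemma tail_mid be : tail be = (be ord_max + mid be)%N.
Proof. by rewrite /tail (bigD1 ord_max). Qed.

Lemma wt_ends be : wt be = (be ord0 + (\sum_(i | (i != ord0) && (i != ord_max)) a i * be i +
  aN * be ord_max))%N.
Proof. by rewrite /wt big_ends a_first mul1n. Qed.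

Lemma red_ends be : red be ord0 = (be ord0 %% aN)%N /\
  red be ord_max = (be ord_max + be ord0 %/ aN)%N.
Proof. by split; rewrite ffunE //= eqxx. Qed.

Lemma red_mid be i : i != ord0 -> i != ord_max -> red be i = be i.
Proof. by move=> /negPf h1 /negPf h2; rewrite ffunE h1 h2. Qed.

Lemma mid_red be : mid (red be) = mid be.
Proof. by apply: eq_bigr => i /andP[h1 h2]; rewrite red_mid. Qed.

Lemma wt_red be : wt (red be) = wt be.
Proof.
rewrite !wt_ends; have [-> ->] := red_ends be.
rewrite (eq_bigr (fun i => a i * be i)%N); last by move=> i /andP[h1 h2]; rewrite red_mid.
rewrite addnCA [RHS]addnCA; congr (_ + _)%N.
rewrite [in RHS](divn_eq (be ord0) aN) mulnDr; lia.
Qed.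

Lemma red_small be : (be ord0 < aN)%N -> red be = be.
Proof.
move=> h; apply/ffunP => i; rewrite ffunE; case: eqP => [->|_]; first by rewrite modn_small.
by case: eqP => [->|//]; rewrite divn_small // addn0.
Qed.

Section Telescope.
Variables (d : {ffun 'I_n.+3 -> nat} -> CC R) (M B : R).
Hypotheses (M0 : 0 <= M) (B1 : 1 <= B).
Let E k := M * B ^+ k * k`!%:R.
Hypothesis toric_bound : forall i be,
  nm (d (addi be (times i 1)) - d (addi be (times ord0 (a i)))) <= E (deg be).

Let B0 : 0 <= B. Proof. by have := B1; lra. Qed.

Lemma E_ge0 k : 0 <= E k.
Proof. by rewrite /E !mulr_ge0 // exprn_ge0. Qed.

Lemma E_le k l : (k <= l)%N -> E k <= E l.
Proof.
move=> kl; rewrite /E -!mulrA ler_wpM2l //; apply: ler_pM; rewrite ?exprn_ge0 //.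
  by rewrite ler_weXn2l.
by rewrite ler_nat leq_fact.
Qed.

(* d_1^(a_N) is traded for d_N first: with the exponent of d_1 kept below 2 a_N, the orders of
   all the derivatives met on the way to the normal form stay bounded by that of d. *)
Lemma telescope_red be : nm (d be - d (red be)) <= (be ord0 %/ aN)%:R * E (deg be).
Proof.
elim: {be}(be ord0 %/ aN)%N {-2}be (erefl (be ord0 %/ aN)%N) => [|s IH] be hs.
  rewrite red_small; first by rewrite subrr nm0 hs mul0r.
  by rewrite ltnNge -divn_gt0 ?a_gt0 // hs.
have h : (aN <= be ord0)%N by rewrite -divn_gt0 ?a_gt0 // hs.
pose ga := subi be (times ord0 aN).
have ebe : be = addi ga (times ord0 aN).
  by apply/ffunP => i; rewrite !ffunE; case: eqP => [->|_]; rewrite ?mul1n ?mul0n ?subn0 ?addn0 ?subnK.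
pose be' := addi ga (times ord_max 1).
have ga0 : ga ord0 = (be ord0 - aN)%N by rewrite !ffunE eqxx mul1n.
have gai i : i != ord0 -> ga i = be i by move=> /negPf h1; rewrite !ffunE h1 mul0n subn0.
have be'0 : be' ord0 = (be ord0 - aN)%N by rewrite ffunE ga0 ffunE /= mul0n addn0.
have s' : (be' ord0 %/ aN)%N = s.
  by rewrite be'0; move: hs; rewrite -{1}(subnK h) divnDr // divnn a_gt0 addn1 => -[].
have er : red be' = red be.
  have be'N : be' ord_max = (be ord_max).+1 by rewrite ffunE gai // ffunE eqxx mul1n addn1.
  apply/ffunP => i; rewrite ffunE [RHS]ffunE s' hs be'0 be'N.
  case: eqP => [_|/eqP i0]; first by rewrite -{2}(subnK h) modnDr.
  case: eqP => [_|/eqP iN]; first by rewrite addSnnS.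
  by rewrite ffunE gai // ffunE (negPf iN) mul0n addn0.
have dga : (deg be = deg ga + aN)%N by rewrite {1}ebe degD deg_times.
have dbe' : deg be' = (deg ga).+1 by rewrite degD deg_times addn1.
have hN := a_gt0 ord_max.
have h1 := IH be' s'; rewrite er s' in h1.
have h2 := toric_bound ord_max ga; rewrite -ebe -/be' in h2.
have -> : d be - d (red be) = (d be' - d (red be)) - (d be' - d be) by ring.
apply: le_trans (nmB _ _) _; rewrite hs -natr1 mulrDl mul1r; apply: lerD.
  apply: le_trans h1 _; rewrite ler_wpM2l // E_le // dbe' dga; lia.
apply: le_trans h2 _; apply: E_le; rewrite dga; lia.
Qed.

(** A factor d_i with 1 < i < N becomes d_1^(a_i), and if d_1^(a_N) appears it is traded for d_N at
    once: at most two relations per factor. As [tail] does not increase and the exponent of d_1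
    stays below 2 a_N, a single L bounds all the orders. *)
Lemma telescope_mid L be : (be ord0 < aN)%N -> (tail be + 2 * aN <= L)%N ->
  nm (d be - d (nf (wt be))) <= (2 * mid be)%:R * E L.
Proof.
elim: {be}(mid be) {-2}be (erefl (mid be)) => [|s IH] be hs hb hL.
  have z i : i != ord0 -> i != ord_max -> be i = 0%N.
    move=> h1 h2; apply/eqP; move/eqP: hs; rewrite /mid sum_nat_eq0 => /forallP/(_ i).
    by rewrite h1 h2.
  suff -> : nf (wt be) = be by rewrite subrr nm0 hs muln0 mul0r.
  have w : wt be = (be ord_max * aN + be ord0)%N.
    rewrite wt_ends big1 ?add0n; first lia.
    by move=> i /andP[h1 h2]; rewrite z ?muln0.
  apply/ffunP => i; rewrite ffunE w; case: eqP => [->|/eqP h1].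
    by rewrite modnMDl modn_small.
  case: eqP => [->|/eqP h2]; last by rewrite z.
  by rewrite divnMDl ?a_gt0 // divn_small ?addn0.
have [i [i0 iN hi]] : exists i, [/\ i != ord0, i != ord_max & (0 < be i)%N].
  apply: contrapT => hn; suff : mid be = 0%N by rewrite hs.
  rewrite /mid big1 // => i /andP[h1 h2]; apply/eqP; rewrite -leqn0 leqNgt; apply/negP => h3.
  by apply: hn; exists i.
pose ga := subi be (times i 1).
have ebe : be = addi ga (times i 1).
  by apply/ffunP => j; rewrite !ffunE; case: eqP => [->|_]; rewrite ?mul1n ?mul0n ?subn0 ?addn0 ?subnK.
pose be1 := addi ga (times ord0 (a i)).
have ga0 : ga ord0 = be ord0 by rewrite !ffunE eq_sym (negPf i0) mul0n subn0.
have gaN : ga ord_max = be ord_max by rewrite !ffunE eq_sym (negPf iN) mul0n subn0.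
have be10 : be1 ord0 = (be ord0 + a i)%N by rewrite ffunE ga0 ffunE eqxx mul1n.
have be1N : be1 ord_max = be ord_max by rewrite ffunE gaN ffunE /= mul0n addn0.
have dga : deg be = (deg ga).+1 by rewrite {1}ebe degD deg_times addn1.
have dbe1 : deg be1 = (deg ga + a i)%N by rewrite degD deg_times.
have ai := a_lt_max iN.
have m1 : mid be1 = s.
  have := deg_tail be1; have := deg_tail be; rewrite !tail_mid be10 be1N hs; lia.
have w1 : wt be1 = wt be by rewrite wtD wt_times a_first mul1n [in RHS]ebe wtD wt_times muln1.
have q1 : (be1 ord0 %/ aN <= 1)%N.
  by rewrite -ltnS ltn_divLR ?a_gt0 // be10; lia.
have tl := deg_tail be.
have h1 : nm (d be - d be1) <= E L.
  rewrite {1}ebe; apply: le_trans (toric_bound i ga) _; apply: E_le; lia.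
have h2 : nm (d be1 - d (red be1)) <= E L.
  apply: le_trans (telescope_red be1) _; apply: (@le_trans _ _ (1%:R * E (deg be1))).
    by rewrite ler_wpM2r ?E_ge0 // ler_nat.
  rewrite mul1r; apply: E_le; lia.
have h3 : nm (d (red be1) - d (nf (wt be))) <= (2 * s)%:R * E L.
  rewrite -w1 -(wt_red be1) -m1 -(mid_red be1); apply: IH; rewrite ?mid_red //.
    by have [-> _] := red_ends be1; rewrite ltn_mod a_gt0.
  have := tail_mid (red be1); rewrite mid_red m1; have [_ ->] := red_ends be1.
  have := tail_mid be; rewrite hs be1N; lia.
have -> : d be - d (nf (wt be)) = (d be - d be1) + (d be1 - d (red be1)) +
   (d (red be1) - d (nf (wt be))) by ring.
apply: le_trans (nmD _ _) _; rewrite hs mulnS natrD mulrDl; apply: lerD => //.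
apply: le_trans (nmD _ _) _; rewrite mulr_natl mulr2n; exact: lerD.
Qed.

Lemma telescope : convarr (fun be => d be - d (nf (wt be))).
Proof.
(* The orders on the way exceed |be| by at most 2 a_N. In the base 4 B below, one factor 2 comes
   from splitting (k + c)!, the other from the linear number of steps. *)
pose c := (2 * aN)%N.
exists (3 * M * B ^+ c * 2 ^+ c * c`!%:R), (4 * B); split.
- by rewrite !mulr_ge0 // exprn_ge0.
- by have := B1; lra.
move=> be; set k := deg be.
have h1 := telescope_red be.
have [r0 rN] := red_ends be.
have tr : tail (red be) = (tail be + be ord0 %/ aN)%N.
  by rewrite !tail_mid mid_red rN; lia.
have q : (be ord0 %/ aN <= be ord0)%N by exact: leq_div.
have dt := deg_tail be.
have h2 : nm (d (red be) - d (nf (wt be))) <= (2 * mid be)%:R * E (k + c).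
  rewrite -(wt_red be) -(mid_red be); apply: telescope_mid; first by rewrite r0 ltn_mod a_gt0.
  by rewrite tr /k /c; lia.
have h3 : nm (d be - d (nf (wt be))) <= (3 * k)%:R * E (k + c).
  have -> : d be - d (nf (wt be)) = (d be - d (red be)) + (d (red be) - d (nf (wt be))) by ring.
  apply: le_trans (nmD _ _) _; apply: le_trans (lerD h1 h2) _.
  apply: (@le_trans _ _ ((be ord0 %/ aN)%:R * E (k + c) + (2 * mid be)%:R * E (k + c))).
    by rewrite lerD2r ler_wpM2l // E_le // leq_addr.
  rewrite -mulrDl -natrD ler_wpM2r ?E_ge0 // ler_nat.
  by have := tail_mid be; rewrite /k; lia.
apply: le_trans h3 _; rewrite /E.
have f1 : ((k + c)`!%:R : R) <= 2 ^+ k * 2 ^+ c * (k`!%:R * c`!%:R).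
  by rewrite -exprD -natrX -!natrM ler_nat fact_add_ge.
have f2 : (k%:R : R) <= 2 ^+ k by rewrite -natrX ler_nat ltnW // ltn_expl.
rewrite natrM exprD exprMn; have -> : (4 : R) = 2 * 2 by rewrite -natrM.
rewrite exprMn; set x := B ^+ k; set y := B ^+ c; set u := 2 ^+ k; set v := 2 ^+ c.
have x0 : 0 <= x by rewrite exprn_ge0.
have y0 : 0 <= y by rewrite exprn_ge0.
have u0 : 0 <= u by rewrite exprn_ge0.
have v0 : 0 <= v by rewrite exprn_ge0.
apply: (@le_trans _ _ (3 * u * (M * (x * y) * (u * v * (k`!%:R * c`!%:R))))).
  apply: ler_pM; rewrite ?mulr_ge0 // ?ler_wpM2l // ?mulr_ge0 //.
by rewrite le_eqVlt; apply/orP; left; apply/eqP; ring.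
Qed.

End Telescope.

(* The growth condition on u that makes the array [be |-> u (wt be)] convergent. *)
Definition Sq (u : nat -> CC R) := exists M B : R, [/\ 0 <= M, 1 <= B &
  forall k, nm (u k) <= M * B ^+ k * (k %/ aN)`!%:R].

(** The order of a multi-index of weight k is at least k / a_N, and that of [nf k] exceeds k / a_N
    by less than a_N; the strongest condition on u_k is thus the one at the normal form. *)
Lemma carr_wt (u : nat -> CC R) : convarr (fun be => u (wt be)) <-> Sq u.
Proof.
split=> [[M [B [M0 B1 h]]]|[M [B [M0 B1 h]]]].
  have B0 : 0 <= B by lra.
  exists (M * 2 ^+ aN * aN`!%:R), (2 * B); split; [by rewrite !mulr_ge0 // exprn_ge0|lra|].
  move=> k; have := h (nf k); rewrite wt_nf deg_nf => hk; apply: le_trans hk _.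
  set q := (k %/ aN)%N.
  have qk : (q <= k)%N by exact: leq_div.
  have hq : (k %% aN + q <= q + aN)%N by rewrite addnC leq_add2l ltnW // ltn_mod a_gt0.
  have hdk : (k %% aN + q <= k)%N.
    by rewrite [X in (_ <= X)%N](divn_eq k aN) -/q addnC leq_add2r leq_pmulr // a_gt0.
  have f1 : ((k %% aN + q)`!%:R : R) <= 2 ^+ k * 2 ^+ aN * (q`!%:R * aN`!%:R).
    apply: (@le_trans _ _ ((q + aN)`!%:R)); first by rewrite ler_nat leq_fact.
    apply: (@le_trans _ _ (2 ^+ q * 2 ^+ aN * (q`!%:R * aN`!%:R))).
      by rewrite -exprD -natrX -!natrM ler_nat fact_add_ge.
    by rewrite -!mulrA ler_wpM2r ?mulr_ge0 ?exprn_ge0 // ler_weXn2l // ler1n.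
  have f2 : B ^+ (k %% aN + q) <= B ^+ k by rewrite ler_weXn2l.
  apply: (@le_trans _ _ (M * B ^+ k * (2 ^+ k * 2 ^+ aN * (q`!%:R * aN`!%:R)))).
    by apply: ler_pM; rewrite ?mulr_ge0 ?exprn_ge0 // ler_wpM2l.
  by rewrite exprMn le_eqVlt; apply/orP; left; apply/eqP; ring.
have B0 : 0 <= B by lra.
exists M, (B ^+ aN); split=> //; first by rewrite exprn_ege1.
move=> be; apply: le_trans (h _) _; rewrite -!mulrA ler_wpM2l //.
apply: ler_pM; rewrite ?exprn_ge0 //.
  by rewrite -exprM ler_weXn2l // wt_le.
by rewrite ler_nat leq_fact // -(mulKn (deg be) (a_gt0 ord_max)) leq_div2r // wt_le.
Qed.

Variables (beta : CC R) (p : 'rV[CC R]_n.+3).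
Hypothesis pY : p 0 ord_max = 0.

(* The Euler operator E(beta) on the arrays that depend only on the weight; the sum leaves out
   the last coordinate, since p lies on Y. *)
Definition Top (u : nat -> CC R) k : CC R :=
  \sum_(j | j != ord_max) (a j)%:R * p 0 j * u (k + a j)%N + (k%:R - beta) * u k.

Lemma euler_wt (u : nat -> CC R) be :
  \sum_j (a j)%:R * (p 0 j * u (wt (addi be (uniti j))) + (be j)%:R * u (wt be)) - beta * u (wt be) =
  Top u (wt be).
Proof.
rewrite /Top mulrBl addrA; congr (_ - _).
rewrite {4}/wt natr_sum mulr_suml.
rewrite (eq_bigr (fun j => (a j)%:R * p 0 j * u (wt be + a j)%N + (a j * be j)%:R * u (wt be))); last first.
  by move=> j _; rewrite wtD wt_uniti natrM; ring.
by rewrite big_split /= (bigD1 ord_max) //= pY mulr0 mul0r add0r.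
Qed.

(** The toric binomials are homogeneous for the weight and kill arrays of the form u_(wt be)
    exactly; only the Euler operator gives a condition on u. *)
Lemma annihilatedD_seq d (u : nat -> CC R) :
  convarr (fun be => d be - u (wt be)) -> Sq (Top u) -> annihilatedD p a beta d.
Proof.
move=> hd hu; have -> : d = (fun be => u (wt be) + (d be - u (wt be))).
  by apply/funext => be; rewrite addrC subrK.
apply: annihilatedD_add; last exact: annihilatedD_conv.
apply: annihilatedD_gen => [v hv|]; last first.
  by move/carr_wt: hu; apply: carr_ext => be; rewrite euler_wt.
apply: (carr_ext _ (carr0 R n.+3)) => be; rewrite !wtD.
suff -> : wt [ffun i => posp v i] = wt [ffun i => negp v i] by rewrite subrr.
apply/eqP; rewrite -(eqr_nat int) /wt !natr_sum -subr_eq0 -sumrB -[X in _ == X]hv; apply/eqP.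
apply: eq_bigr => i _; rewrite !ffunE !natrM -mulrBr natz; congr (_ * _).
rewrite /posp /negp !natz !gez0_abs ?le_max ?lexx ?orbT //.
by rewrite !maxElt; case: ifP => ?; case: ifP => ?; lia.
Qed.

Lemma annihilatedD_toric d i : annihilatedD p a beta d ->
  convarr (fun be => d (addi be (times i 1)) - d (addi be (times ord0 (a i)))).
Proof.
move=> h; have [->|i0] := eqVneq i ord0.
  by apply: (carr_ext _ (carr0 R n.+3)) => be; rewrite a_first subrr.
(* The lattice vector a_i e_1 - e_i. Its binomial is d_1^(a_i) - d_i, hence the change of sign
   below. *)
pose v (j : 'I_n.+3) : int := if j == ord0 then (a i)%:Z else if j == i then -1 else 0.
have hv : \sum_j (a j)%:Z * v j = 0.
  rewrite (bigD1 ord0) //= (bigD1 i) //= big1 => [|j /andP[/negPf h1 /negPf h2]].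
    by rewrite /v !eqxx (negPf i0) a_first mul1r addr0 mulrN1 subrr.
  by rewrite /v h1 h2 mulr0.
have /h : hyp_ideal a beta (Wadd (Wdmon _ (posp v)) (Wmul (Wcst (- 1)) (Wdmon _ (negp v)))).
  by apply: left_ideal_gen; left; apply: left_ideal_gen; exists v.
move/(carrZ (-1)); apply: carr_ext => be /=.
rewrite !wactD_mon mulN1r mulN1r opprD opprK addrC; congr (d _ - d _); congr addi; apply/ffunP => j;
  rewrite !ffunE /posp /negp /v.
  case: (eqVneq j ord0) => [->|j0]; first by rewrite eq_sym (negPf i0) mul0n max_r // oppr_le0.
  by case: eqP => _.
case: (eqVneq j ord0) => [_|j0]; first by rewrite mul1n max_l.
by case: eqP => _.
Qed.

(** The sequence is read off at the normal forms. The error d - u_(wt) is a convergent array, so the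
    Euler condition passes from d to u. *)
Lemma annihilatedD_reduce d : annihilatedD p a beta d ->
  exists u : nat -> CC R, convarr (fun be => d be - u (wt be)) /\ Sq (Top u).
Proof.
move=> h; exists (fun k => d (nf k)).
have hconv : convarr (fun be => d be - d (nf (wt be))).
  pose g i be := d (addi be (times i 1)) - d (addi be (times ord0 (a i))).
  (* Adding the moduli of the defects of all the relations yields constants M and B common to them,
     as the telescoping requires. *)
  have hgi i : convarr (fun be => (nm (g i be))%:C%C : CC R).
    apply: (carr_le (c := 1) _ _ (annihilatedD_toric i h)) => // be.
    by rewrite nm_real mul1r ger0_norm ?nm_ge0.
  have [M [B [M0 B1 hM]]] := carr_sum (index_enum 'I_n.+3) hgi.
  apply: (telescope M0 B1) => i be; apply: le_trans (hM be).
  rewrite -rmorph_sum nm_real ger0_norm; last by apply: sumr_ge0 => *; exact: nm_ge0.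
  by rewrite (bigD1 i) //= lerDl sumr_ge0 // => *; exact: nm_ge0.
split=> //; apply/carr_wt.
have hE : convarr (wactD p (euler_op a beta) d).
  by apply: h; apply: left_ideal_gen; right.
move: (carrB hE (carr_wactD p (euler_op a beta) hconv)); apply: carr_ext => be.
rewrite -(euler_wt (fun k => d (nf k))) -(wactD_euler p a beta (fun be => d (nf (wt be)))).
have -> : (fun be => d be - d (nf (wt be))) = (fun be => d be + (-1) * d (nf (wt be))).
  by apply/funext => x; rewrite mulN1r.
by rewrite wactD_add wactD_scale mulN1r opprD opprK addrA subrr add0r.
Qed.

End Toric.

(** * The Euler operator on sequences *)

Section GeometricSums.
Variable R : realType.

Lemma geo2_fset (A : {fset nat}) : \sum_(t <- A) (2^-1 : R) ^+ t <= 2.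
Proof.
apply: (@le_trans _ _ (\sum_(t <- index_iota 0 (\max_(i <- A) i).+1) (2^-1 : R) ^+ t)).
  apply: ler_sum_sub => [|t tA|t]; first exact: fset_uniq.
    by rewrite mem_index_iota ltnS /=; exact: leq_bigmax_seq.
  by rewrite exprn_ge0 // invr_ge0.
by rewrite big_mkord; exact: geo2_sum.
Qed.

Lemma halves_le0 (x c : R) : (forall t, x <= c * 2^-1 ^+ t) -> x <= 0.
Proof.
move=> h; rewrite leNgt; apply/negP => x0.
have c0 : 0 < c by apply: lt_le_trans x0 _; have := h 0%N; rewrite expr0 mulr1.
have := archi_boundP (ltW (divr_gt0 c0 x0)); set t := Num.bound _ => ht.
have := h t; rewrite exprVn ler_pdivlMr ?exprn_gt0 //; apply/negP; rewrite -ltNge.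
rewrite -ltr_pdivrMl // mulrC; apply: lt_trans ht _.
by rewrite -natrX ltr_nat ltn_expl.
Qed.

Lemma has_sum_nat_shift (f : nat -> CC R) s : has_sum f s -> has_sum (fun t => f t.+1) (s - f 0%N).
Proof.
move=> h; have := has_sumD h (has_sumZ (c := -1) (has_sum_single 0%N (f 0%N))).
rewrite mulN1r; apply: (@has_sum_reindex _ _ _ S predn predT (fun t => t != 0%N)) => //.
- by case.
- by move=> [|t] //=; rewrite mulN1r subrr.
by move=> t _ /=; rewrite mulr0 addr0.
Qed.

End GeometricSums.

Section Sequences.
Variables (R : realType) (n : nat) (a : 'I_n.+3 -> nat).
Hypothesis a_first : a ord0 = 1%N.
Hypothesis a_incr : forall i j : 'I_n.+3, (i < j)%N -> (a i < a j)%N.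
Variables (beta : CC R) (p : 'rV[CC R]_n.+3).
Local Notation aN := (a ord_max).
Local Notation T := (Top a beta p).
Implicit Types u v w : nat -> CC R.

Let aN0 : (0 < aN)%N := a_gt0 a_first a_incr ord_max.

Lemma SqD u v : Sq a u -> Sq a v -> Sq a (fun k => u k + v k).
Proof.
move=> /(carr_wt a_first a_incr) hu /(carr_wt a_first a_incr) hv.
by apply/(carr_wt a_first a_incr); exact: carrD.
Qed.

Lemma SqZ c u : Sq a u -> Sq a (fun k => c * u k).
Proof.
move=> /(carr_wt a_first a_incr) hu.
by apply/(carr_wt a_first a_incr); exact: carrZ.
Qed.

Lemma Sq_fin K u : (forall k, (K <= k)%N -> u k = 0) -> Sq a u.
Proof.
move=> h; exists (\sum_(k < K) nm (u k)), 1; split=> //.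
  by apply: sumr_ge0 => *; exact: nm_ge0.
move=> k; rewrite expr1n mulr1; case: (leqP K k) => hk.
  by rewrite h // nm0 mulr_ge0 // sumr_ge0 // => *; exact: nm_ge0.
apply: (@le_trans _ _ (\sum_(k < K) nm (u k))).
  by rewrite (bigD1 (Ordinal hk)) //= lerDl sumr_ge0 // => *; exact: nm_ge0.
rewrite ler_peMr ?ler1n ?fact_gt0 // sumr_ge0 // => *; exact: nm_ge0.
Qed.

Lemma Sq_ext u v : u =1 v -> Sq a u -> Sq a v.
Proof. by move=> /funext ->. Qed.

Lemma Top_lin c u v k : T (fun k => u k + c * v k) k = T u k + c * T v k.
Proof.
rewrite /Top [c * (_ + _)]mulrDr mulr_sumr addrACA -big_split /=; congr (_ + _); last by ring.
by apply: eq_bigr => j _; ring.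
Qed.

Lemma Top_sum d (lam : 'I_d -> CC R) (U : 'I_d -> nat -> CC R) k :
  T (fun k => \sum_j lam j * U j k) k = \sum_j lam j * T (U j) k.
Proof.
elim: (index_enum _) => [|j r IH].
  rewrite big_nil /Top big1 ?add0r => [|j _]; first by rewrite big_nil mulr0.
  by rewrite big_nil mulr0.
rewrite big_cons -IH addrC -Top_lin; congr Top; apply/funext => l.
by rewrite big_cons addrC.
Qed.

Lemma TopB u v k : T (fun k => u k - v k) k = T u k - T v k.
Proof.
have -> : (fun k => u k - v k) = (fun k => u k + (-1) * v k).
  by apply/funext => l; rewrite mulN1r.
by rewrite Top_lin mulN1r.
Qed.

(* For th large and k large, the operator u |-> (sum_j a_j p_j u_(k + a_j)) / (k - beta) is a
   contraction for the sup norm with weight W. *)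
Definition W (rho th : R) k : R := rho ^+ (k %/ aN) * th ^+ (k %% aN) * (k %/ aN)`!%:R.

Lemma W_ge0 rho th k : 0 <= rho -> 0 <= th -> 0 <= W rho th k.
Proof. by move=> h1 h2; rewrite /W !mulr_ge0 // exprn_ge0. Qed.

(** Within a block of length a_N the shift costs th^b <= th^(a_N). Passing to the next block it
    costs rho and the factorial factor k / a_N + 1 <= k + 1, while the exponent of th drops by a_N -
    b >= 1: this produces rho / th. *)
Lemma W_shift rho th k b : 0 < rho -> 1 <= th -> (0 < b < aN)%N ->
  W rho th (k + b) <= (th ^+ aN + rho / th * (k.+1)%:R) * W rho th k.
Proof.
move=> rho0 th1 /andP[b0 bN]; have th0 : 0 < th by lra.
have W0 := W_ge0 k (ltW rho0) (ltW th0).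
set q := (k %/ aN)%N; set r := (k %% aN)%N.
have rN : (r < aN)%N by rewrite ltn_mod.
have ek : k = (q * aN + r)%N by exact: divn_eq.
rewrite mulrDl; case: (ltnP (r + b) aN) => hc.
  have -> : W rho th (k + b) = th ^+ b * W rho th k.
    rewrite /W {1 2 3}ek -addnA divnMDl // modnMDl divn_small // modn_small // addn0 -/q -/r exprD; ring.
  apply: ler_wpDr; first by rewrite mulr_ge0 // mulr_ge0 // divr_ge0 // ltW.
  by rewrite ler_wpM2r // ler_weXn2l // ltnW.
apply: ler_wpDl; first by rewrite mulr_ge0 // exprn_ge0 // ltW.
have s1 : (r + b - aN < aN)%N by lia.
have eW : W rho th (k + b) = rho ^+ q.+1 * th ^+ (r + b - aN) * (q.+1)`!%:R.
  have -> : (k + b = q.+1 * aN + (r + b - aN))%N by rewrite {1}ek mulSn; lia.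
  by rewrite /W divnMDl // modnMDl divn_small // modn_small // addn0.
have er : r = ((r + b - aN) + (aN - b).-1.+1)%N by lia.
rewrite eW /W -/q -/r {2}er exprD exprS factS natrM exprS.
set x := rho ^+ q; set y := th ^+ (r + b - aN); set z := th ^+ _.-1; set f := (q`!)%:R.
have x0 : 0 <= x by rewrite exprn_ge0 // ltW.
have y0 : 0 <= y by rewrite exprn_ge0 // ltW.
have z1 : 1 <= z by rewrite exprn_ege1.
have f0 : 0 <= f by [].
have -> : rho / th * k.+1%:R * (x * (y * (th * z)) * f) = (rho * x * y * f) * (z * k.+1%:R).
  by field; rewrite gt_eqF.
have -> : rho * x * y * (q.+1%:R * f) = (rho * x * y * f) * (1 * q.+1%:R) by ring.
rewrite ler_wpM2l ?mulr_ge0 // ?(ltW rho0) //; apply: ler_pM => //.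
by rewrite ler_nat ltnS leq_div.
Qed.

Let A := \sum_(j | j != ord_max) (a j)%:R * nm (p 0 j).

Let A0 : 0 <= A. Proof. by apply: sumr_ge0 => j _; rewrite mulr_ge0 ?nm_ge0. Qed.

Lemma nm_shift_ge k : k%:R - nm beta <= nm (k%:R - beta).
Proof. by have := nmD (k%:R - beta) beta; rewrite subrK nm_nat; lra. Qed.

Lemma weight_contract rho : 1 <= rho -> exists th K, [/\ rho <= th,
  forall k, (K <= k)%N -> 1 <= nm (k%:R - beta) &
  forall k, (K <= k)%N -> \sum_(j | j != ord_max) (a j)%:R * nm (p 0 j) * W rho th (k + a j) <=
     2^-1 * nm (k%:R - beta) * W rho th k].
Proof.
(* th makes A rho / th at most 1/4, so the part growing with k takes only a quarter of k. The bound
   D makes another quarter of k exceed the constant terms and |beta|. *)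
move=> rho1; pose th := 4 * (A + 1) * rho; pose D := 4 * (A * th ^+ aN + 1 + nm beta).
have th1 : rho <= th by rewrite /th ler_peMl //; have := A0; lra.
have thN : 0 <= th ^+ aN by rewrite exprn_ge0 //; lra.
have At : 0 <= A * th ^+ aN by rewrite mulr_ge0.
have D0 : 0 <= D by rewrite /D; have := nm_ge0 beta; lra.
exists th, (Num.bound D).
have hk k : (Num.bound D <= k)%N -> D < k%:R.
  by move=> h; apply: lt_le_trans (archi_boundP D0) _; rewrite ler_nat.
split=> // k /hk hk'; have := nm_shift_ge k; have := nm_ge0 beta; move: hk'; rewrite /D => hk' b0 hs.
  lra.
have W0 : 0 <= W rho th k by apply: W_ge0; lra.
apply: (@le_trans _ _ (A * ((th ^+ aN + rho / th * (k.+1)%:R) * W rho th k))).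
  rewrite /A mulr_suml; apply: ler_sum => j jN.
  rewrite ler_wpM2l ?mulr_ge0 ?nm_ge0 //; apply: W_shift; [lra|lra|].
  by rewrite (a_gt0 a_first a_incr) (a_lt_max a_incr).
rewrite mulrA ler_wpM2r //.
have hr : A * (rho / th) <= 4^-1.
  rewrite /th; have -> : A * (rho / (4 * (A + 1) * rho)) = 4^-1 * (A / (A + 1)).
    by field; rewrite !gt_eqF //; [lra|have := A0; lra].
  rewrite ler_piMr // ler_pdivrMr; have := A0; lra.
have : A * (rho / th) * k.+1%:R <= 4^-1 * k.+1%:R by rewrite ler_wpM2r.
rewrite mulrDr [A * (rho / th * _)]mulrA -natr1; lra.
Qed.

(** rho is fixed before th: [weight_contract] chooses th in terms of rho, so the bound has to hold
    for all th >= rho. *)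
Lemma Sq_W u : Sq a u -> exists M rho : R, [/\ 0 <= M, 1 <= rho &
  forall th, rho <= th -> forall k, nm (u k) <= M * W rho th k].
Proof.
move=> [M [B [M0 B1 h]]]; have B0 : 0 <= B by lra.
have rho1 : 1 <= B ^+ aN by rewrite exprn_ege1.
have Brho : B <= B ^+ aN by rewrite -{1}[B]expr1 ler_weXn2l.
exists M, (B ^+ aN); split=> // th hth k; apply: le_trans (h k) _.
rewrite -mulrA ler_wpM2l // /W ler_wpM2r // {1}(divn_eq k aN) exprD mulnC exprM.
by rewrite ler_wpM2l ?exprn_ge0 // lerXn2r ?nnegrE //; lra.
Qed.

Lemma W_Sq u M rho th : 0 <= M -> 1 <= rho -> 1 <= th ->
  (forall k, nm (u k) <= M * W rho th k) -> Sq a u.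
Proof.
move=> M0 r1 t1 h; exists M, (rho * th); split=> //; first by rewrite mulr_ege1.
move=> k; apply: le_trans (h k) _; rewrite -[X in _ <= X]mulrA ler_wpM2l // /W ler_wpM2r //.
rewrite exprMn; apply: ler_pM; rewrite ?exprn_ge0 //; [lra|lra| |].
  by rewrite ler_weXn2l // leq_div.
by rewrite ler_weXn2l // leq_mod.
Qed.

Lemma sum_weight (v : nat -> CC R) (c : R) rho th k :
  (forall j, j != ord_max -> nm (v (k + a j)%N) <= c * W rho th (k + a j)) ->
  nm (\sum_(j | j != ord_max) (a j)%:R * p 0 j * v (k + a j)%N) <=
  c * \sum_(j | j != ord_max) (a j)%:R * nm (p 0 j) * W rho th (k + a j).
Proof.
move=> h; apply: le_trans (nm_sum _ _ _) _; rewrite mulr_sumr; apply: ler_sum => j jN.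
rewrite !nmM nm_nat mulrCA ler_wpM2l ?mulr_ge0 ?nm_ge0 //; exact: h.
Qed.

(** From K on, the equation expresses u_k through later entries by a contraction of ratio 1/2, so
    the weighted bound can be halved indefinitely. *)
Lemma tail_unique u K0 : Sq a u -> (forall k, (K0 <= k)%N -> T u k = 0) ->
  exists K, forall k, (K <= k)%N -> u k = 0.
Proof.
move=> /Sq_W [M [rho [M0 r1 hM]]] hT.
have [th [K [hth hK1 hK]]] := weight_contract r1.
have Wk k : 0 <= W rho th k by apply: W_ge0; lra.
exists (maxn K0 K) => k hk; apply/eqP; rewrite -nm_eq0 eq_le nm_ge0 andbT.
apply: (@halves_le0 _ _ (M * W rho th k)) => t.
elim: t k hk => [|t IH] k hk; first by rewrite expr0 mulr1 hM.
move: (hk); rewrite geq_max => /andP[h0 h1].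
have hn := hK1 k h1; have n0 : 0 < nm (k%:R - beta) by lra.
rewrite -(ler_pM2l n0) -nmM.
have -> : (k%:R - beta) * u k = - \sum_(j | j != ord_max) (a j)%:R * p 0 j * u (k + a j)%N.
  by apply/eqP; rewrite -addr_eq0 addrC; apply/eqP; exact: hT.
rewrite nmN; apply: le_trans (@sum_weight u (M * 2^-1 ^+ t) rho th k _) _.
  by move=> j jN; rewrite mulrAC; apply: IH; apply: leq_trans hk _; exact: leq_addr.
apply: le_trans (ler_wpM2l _ (hK k h1)) _; first by rewrite mulr_ge0 // exprn_ge0 // invr_ge0.
by rewrite exprS le_eqVlt; apply/orP; left; apply/eqP; ring.
Qed.

(** A Neumann series: the iterates [v t] decrease like 2 ^ -t in the weighted norm, and removing the
    first term of their sum u gives the equation. *)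
Lemma tail_solve w : Sq a w -> exists u K, Sq a u /\ forall k, (K <= k)%N -> T u k = w k.
Proof.
move=> /Sq_W [M [rho [M0 r1 hM]]].
have [th [K [hth hK1 hK]]] := weight_contract r1.
have Wk k : 0 <= W rho th k by apply: W_ge0; lra.
pose S (v : nat -> CC R) k := \sum_(j | j != ord_max) (a j)%:R * p 0 j * v (k + a j)%N.
(* The division by k - beta is controlled from K on only. Cutting off below K is consistent, since
   entries at k >= K call on later entries alone. *)
pose step (v : nat -> CC R) k := if (K <= k)%N then - S v k / (k%:R - beta) else 0.
pose v t := iter t step (fun k => if (K <= k)%N then w k / (k%:R - beta) else 0).
have h0 t k : 0 <= M * W rho th k * 2^-1 ^+ t.
  by apply: mulr_ge0; [exact: mulr_ge0|rewrite exprn_ge0 // invr_ge0].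
have vb t k : nm (v t k) <= M * W rho th k * 2^-1 ^+ t.
  elim: t k => [|t IH] k.
    rewrite expr0 mulr1 /=; case: leqP => hk; last by rewrite nm0 mulr_ge0.
    rewrite nmM nmV ler_pdivrMr; last by have := hK1 k hk; lra.
    apply: le_trans (hM _ hth k) _; rewrite -[X in X <= _]mulr1.
    by apply: ler_wpM2l; [exact: mulr_ge0|exact: hK1].
  rewrite /= /step; case: leqP => hk; last by rewrite nm0; exact: (h0 t.+1).
  have hn := hK1 k hk; rewrite nmM nmV nmN ler_pdivrMr; last by lra.
  apply: le_trans (@sum_weight (v t) (M * 2^-1 ^+ t) rho th k _) _.
    by move=> j jN; rewrite mulrAC; exact: IH.
  apply: le_trans (ler_wpM2l _ (hK k hk)) _; first by rewrite mulr_ge0 // exprn_ge0 // invr_ge0.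
  by rewrite exprS le_eqVlt; apply/orP; left; apply/eqP; ring.
have vabs k (A' : {fset nat}) : \sum_(t <- A') nm (v t k) <= M * W rho th k * 2.
  apply: (@le_trans _ _ (\sum_(t <- A') M * W rho th k * 2^-1 ^+ t)); first exact: ler_sum.
  by rewrite -mulr_sumr; apply: ler_wpM2l; [exact: mulr_ge0|exact: geo2_fset].
have /choice [u hu] : forall k, exists s, has_sum (fun t => v t k) s.
  by move=> k; exact: abs_has_sum_ex (vabs k).
exists u, K; split.
  apply: (@W_Sq u (M * 2) rho th) => [||| k]; [by rewrite mulr_ge0|lra|lra|].
  by apply: le_trans (has_sum_le (hu k) (vabs k)) _; rewrite mulrAC.
move=> k hk; have hn : k%:R - beta != 0 by rewrite -nm_gt0; have := hK1 k hk; lra.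
have h1 : has_sum (fun t => S (v t) k) (S u k).
  by apply: has_sum_big => j _; apply: has_sumZ; exact: hu.
have h2 := has_sumZ (c := - (k%:R - beta)) (has_sum_nat_shift (hu k)).
rewrite /Top -/(S u k); have -> : S u k = - (k%:R - beta) * (u k - v 0%N k).
  apply: has_sum_uniq h1 _; move: h2; apply: eq_has_sum => t /=.
  by rewrite /step hk mulNr mulrC divfK // opprK.
by rewrite /= hk mulNr mulrBr opprB subrK mulrC divfK.
Qed.

Lemma Top_eq_from u v k : (forall l, (k <= l)%N -> u l = v l) -> T u k = T v k.
Proof.
move=> h; rewrite /Top h //; congr (_ + _); apply: eq_bigr => j _.
by rewrite h // leq_addr.
Qed.

(** T is upper triangular with diagonal entries k - beta: changing u_K affects (T u)_k for k <= K
    only. The finitely many indices left by [tail_solve] are repaired downwards, passing over k =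
    beta. *)
Lemma solve_off_beta w : Sq a w -> exists2 u, Sq a u &
  forall k : nat, k%:R != beta -> T u k = w k.
Proof.
move=> /tail_solve [u [K [hu hK]]].
have {hK} : forall k : nat, (K <= k)%N -> k%:R != beta -> T u k = w k by move=> k /hK.
elim: K u hu => [|K IH] u hu hK; first by exists u => // k; exact: hK.
pose x := if K%:R == beta then 0 else (w K - T u K) / (K%:R - beta).
pose e k : CC R := if k == K then 1 else 0.
apply: (IH (fun k => u k + x * e k)).
  apply: SqD => //; apply: SqZ; apply: (@Sq_fin K.+1) => k hk.
  by rewrite /e gtn_eqF.
move=> k; rewrite leq_eqVlt => /orP[/eqP <-|hk] hb; rewrite Top_lin; last first.
  rewrite hK // [X in _ * X](@Top_eq_from _ (fun=> 0)); last by move=> l hl; rewrite /e gtn_eqF // (leq_trans hk).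
  by rewrite /Top big1 ?mulr0 ?addr0 ?mulr0 ?addr0 // => j _; rewrite mulr0.
have -> : T e K = K%:R - beta.
  rewrite /Top /e eqxx mulr1 big1 ?add0r // => j _.
  by rewrite gtn_eqF ?mulr0 // -addn1 leq_add2l (a_gt0 a_first a_incr).
by rewrite /x (negPf hb) divfK ?subr_eq0 // addrC subrK.
Qed.

Lemma ker_descend u k0 K : (forall k, (K <= k)%N -> u k = 0) ->
  (forall k, (k0 <= k < K)%N -> T u k = 0 /\ k%:R != beta) -> forall k, (k0 <= k)%N -> u k = 0.
Proof.
elim: K => [|K IH] hK hT; first by move=> k _; exact: hK.
have [hk0|hk0] := leqP k0 K; last by move=> k hk; apply: hK; exact: leq_trans hk0 hk.
apply: IH => k; last by move=> /andP[h1 h2]; apply: hT; rewrite h1 leqW.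
rewrite leq_eqVlt => /orP[/eqP <-|]; last exact: hK.
have [|hTK hb] := hT K; first by rewrite hk0 ltnSn.
move: hTK; rewrite /Top big1 ?add0r => [/eqP|j _].
  by rewrite mulf_eq0 subr_eq0 (negPf hb) => /eqP.
by rewrite hK ?mulr0 // -addn1 leq_add2l (a_gt0 a_first a_incr).
Qed.

Lemma Sq_ker_vanish u k0 : Sq a u ->
  (forall k, (k0 <= k)%N -> T u k = 0 /\ k%:R != beta) -> forall k, (k0 <= k)%N -> u k = 0.
Proof.
move=> hu hT; have [K hK] := @tail_unique u k0 hu (fun k hk => (hT k hk).1).
by apply: (ker_descend hK) => k /andP[hk _]; exact: hT.
Qed.

Local Notation a' := (a (penult n)).
Hypothesis pZ : p 0 (penult n) != 0.

Lemma penult_val : penult n = n.+1 :> nat.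
Proof. exact: lift_max. Qed.

Lemma penult_neq : penult n != ord_max.
Proof. by apply/eqP => /(congr1 (@nat_of_ord _)); rewrite penult_val /=; lia. Qed.

Lemma penult_lt (j : 'I_n.+3) : j != ord_max -> j != penult n -> (a j < a')%N.
Proof.
move=> h1 h2; apply: a_incr; rewrite penult_val.
have {}h1 : (j : nat) <> n.+2 by move=> e; move/eqP: h1; apply; exact: ord_inj.
have {}h2 : (j : nat) <> n.+1.
  by move=> e; move/eqP: h2; apply; apply: ord_inj; rewrite penult_val.
by have := ltn_ord j; lia.
Qed.

Lemma ker_determined u : (forall k, T u k = 0) -> (forall k, (k < a')%N -> u k = 0) -> forall k, u k = 0.
Proof.
move=> hT h0; elim/ltn_ind => k IH; case: (ltnP k a') => hk; first exact: h0.
have := hT (k - a')%N; rewrite /Top (bigD1 (penult n) penult_neq) /= subnK //.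
have pa : (0 < a')%N := a_gt0 a_first a_incr (penult n).
rewrite (IH (k - a')%N) ?mulr0 ?addr0; last by lia.
rewrite big1 ?addr0 => [/eqP|j /andP[j1 j2]]; last first.
  by rewrite IH ?mulr0 //; have := penult_lt j1 j2; lia.
rewrite mulf_eq0 mulf_eq0 (negPf pZ) orbF pnatr_eq0 eqn0Ngt pa /= => /eqP //.
Qed.

Variable U : 'I_a' -> nat -> CC R.
Hypothesis U_ker : forall j k, T (U j) k = 0.
Hypothesis U_free : forall lam : 'I_a' -> CC R,
  (forall k, \sum_j lam j * U j k = 0) -> forall j, lam j = 0.

(** An element of the kernel is determined by its first a_(N-1) values, so a free family of a_(N-1)
    elements has an invertible square matrix of initial values and is a basis. *)
Lemma ker_span u : (forall k, T u k = 0) -> exists lam : 'I_a' -> CC R,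
  forall k, u k = \sum_j lam j * U j k.
Proof.
move=> hu; pose X : 'M[CC R]_a' := \matrix_(j, k) U j k.
have fX : X \in unitmx.
  rewrite -row_free_unit -kermx_eq0; apply/rowV0P => r /sub_kermxP rX.
  have hr : forall j, r 0 j = 0.
    apply: U_free; apply: ker_determined => [k|k hk].
      by rewrite Top_sum big1 // => j _; rewrite U_ker mulr0.
    have := congr1 (fun M : 'rV_a' => M 0 (Ordinal hk)) rX; rewrite !mxE => h; rewrite -[RHS]h.
    by apply: eq_bigr => j _; rewrite mxE.
  by apply/rowP => j; rewrite hr mxE.
pose r : 'rV[CC R]_a' := (\row_k u k) *m invmx X.
exists (fun j => r 0 j) => k; apply/eqP; rewrite -subr_eq0; apply/eqP.
move: k; apply: ker_determined => [k|k hk].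
  rewrite (TopB u) hu Top_sum big1 ?subr0 // => j _; by rewrite U_ker mulr0.
have := congr1 (fun M : 'rV_a' => M 0 (Ordinal hk)) (mulmxKV fX (\row_k u k)).
rewrite /= -/r !mxE => <-; apply/eqP; rewrite subr_eq0; apply/eqP.
by apply: eq_bigr => j _; rewrite [X j _]mxE.
Qed.

Lemma span_generic u : (forall k : nat, k%:R != beta) -> Sq a (T u) ->
  exists lam : 'I_a' -> CC R, Sq a (fun k => u k - \sum_j lam j * U j k).
Proof.
move=> hb /solve_off_beta [v hv hT].
have [k|lam hlam] := @ker_span (fun k => u k - v k); first by rewrite TopB hT ?subrr.
exists lam; apply: Sq_ext hv => k; rewrite -hlam; ring.
Qed.

Lemma free_generic (lam : 'I_a' -> CC R) : (forall k : nat, k%:R != beta) ->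
  Sq a (fun k => \sum_j lam j * U j k) -> forall j, lam j = 0.
Proof.
move=> hb hS; apply: U_free => k; apply: (Sq_ker_vanish (k0 := 0%N) hS) => // l _.
by rewrite Top_sum big1 // => j _; rewrite U_ker mulr0.
Qed.

(** * The resonant case, beta a natural number *)

Section Resonant.
Variables (b0 : nat) (q : 'I_a') (V : nat -> CC R).
Hypothesis hbeta : beta = b0%:R.
Hypothesis Uq_small : forall k, (b0 < k)%N -> U q k = 0.
Hypothesis Uq_top : U q b0 != 0.
Hypothesis TV_small : forall k, (b0 < k)%N -> T V k = 0.
Hypothesis TV_top : T V b0 != 0.

Let UV j := if j == q then V else U j.

Let off_beta (k : nat) : (b0 < k)%N -> k%:R != beta.
Proof. by move=> h; rewrite hbeta eqr_nat gtn_eqF. Qed.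

Let Top_top u : (forall k, (b0 < k)%N -> u k = 0) -> T u b0 = 0.
Proof.
move=> h; rewrite /Top hbeta subrr mul0r addr0 big1 // => j _.
by rewrite h ?mulr0 // -addn1 leq_add2l (a_gt0 a_first a_incr).
Qed.

Lemma sum_UV (lam : 'I_a' -> CC R) k :
  \sum_j lam j * UV j k = lam q * V k + \sum_(j | j != q) lam j * U j k.
Proof.
rewrite (bigD1 q) //= {1}/UV eqxx; congr (_ + _).
by apply: eq_bigr => j /negPf jq; rewrite /UV jq.
Qed.

(** Small sequences can match T u at every index but beta; a multiple of V corrects the value
    there. *)
Lemma span_resonant u : Sq a (T u) ->
  exists lam : 'I_a' -> CC R, Sq a (fun k => u k - \sum_j lam j * UV j k).
Proof.
move=> /solve_off_beta [v1 hv1 hT1].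
(* T V may be nonzero below beta, and v2 compensates for that. Being supported on k <= beta, v2
   contributes nothing to the value at beta itself. *)
have [v2 hv2 hT2] : exists2 v, Sq a v & forall k : nat, k%:R != beta -> T v k = T V k.
  by apply: solve_off_beta; apply: (@Sq_fin b0.+1) => k; exact: TV_small.
have v2_small k : (b0 < k)%N -> v2 k = 0.
  apply: (Sq_ker_vanish (k0 := b0.+1) hv2) => l hl; have hb := off_beta hl.
  by rewrite hT2 // TV_small.
pose mu := (T u b0 - T v1 b0) / T V b0.
have [k|nu hnu] := @ker_span (fun k => (u k + (- mu) * V k) - (v1 k + (- mu) * v2 k)).
  rewrite TopB !Top_lin; have [hk|hk|->] := ltngtP k b0; last 1 first.
  - by rewrite (Top_top v2_small) mulr0 addr0 mulNr /mu divfK //; ring.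
  - by rewrite hT1 ?hT2 ?subrr // hbeta eqr_nat ltn_eqF.
  by rewrite hT1 ?hT2 ?subrr // off_beta.
exists (fun j => if j == q then mu else nu j).
move: (SqD (SqD hv1 (SqZ (- mu) hv2)) (SqZ (nu q) (@Sq_fin b0.+1 _ Uq_small))); apply: Sq_ext => k.
rewrite sum_UV eqxx (eq_bigr (fun j => nu j * U j k)); last by move=> j /negPf ->.
have := hnu k; rewrite (bigD1 q) //= => h.
set S := \sum_(_ | _) _ in h *.
have -> : u k = (u k + - mu * V k - (v1 k + - mu * v2 k)) + mu * V k + (v1 k + - mu * v2 k) by ring.
rewrite h; ring.
Qed.

(** A small combination s vanishes beyond beta, so (T s)_beta = 0 and the coefficient of V is 0.
    Then s is in the kernel; subtracting the multiple of [U q] with the same value at beta leaves a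
    kernel element that vanishes from beta on, hence everywhere. *)
Lemma free_resonant (lam : 'I_a' -> CC R) :
  Sq a (fun k => \sum_j lam j * UV j k) -> forall j, lam j = 0.
Proof.
set s := fun k => _; move=> hS.
have Ts k : T s k = lam q * T V k.
  rewrite /s Top_sum (bigD1 q) //= {1}/UV eqxx big1 ?addr0 // => j /negPf jq.
  by rewrite /UV jq U_ker mulr0.
have s_small k : (b0 < k)%N -> s k = 0.
  apply: (Sq_ker_vanish (k0 := b0.+1) hS) => l hl.
  by rewrite Ts TV_small // mulr0; split=> //; exact: off_beta.
have lq : lam q = 0.
  have /eqP := Top_top s_small; rewrite Ts mulf_eq0 (negPf TV_top) orbF => /eqP //.
pose mu := s b0 / U q b0; pose nu j := if j == q then - mu else lam j.
have hnu k : \sum_j nu j * U j k = s k + (- mu) * U q k.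
  rewrite /s sum_UV lq mul0r add0r (bigD1 q) //= {1}/nu eqxx addrC; congr (_ + _).
  by apply: eq_bigr => j /negPf jq; rewrite /nu jq.
have nu0 : forall j, nu j = 0.
  apply: U_free => k; rewrite hnu; move: k (leq0n k).
  apply: (@ker_descend _ 0%N b0) => [k|k /andP[_ hk]].
    rewrite leq_eqVlt => /orP[/eqP <-|hk]; first by rewrite mulNr /mu divfK // subrr.
    by rewrite s_small // Uq_small // mulr0 addr0.
  split; last by rewrite hbeta eqr_nat ltn_eqF.
  by rewrite Top_lin Ts lq mul0r U_ker mulr0 addr0.
move=> j; have [->//|jq] := eqVneq j q.
by have := nu0 j; rewrite /nu (negPf jq).
Qed.

End Resonant.
End Sequences.

Lemma pow_le_fact (R : realType) (X : R) : 0 <= X ->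
  exists2 M : R, 1 <= M & forall j, X ^+ j <= M * j`!%:R.
Proof.
move=> X0; pose N := Num.bound X; have XN : X < N%:R := archi_boundP X0.
have X1 : 1 <= 1 + X by lra.
exists ((1 + X) ^+ N); first by rewrite exprn_ege1.
have M0 : 0 <= (1 + X) ^+ N by rewrite exprn_ge0 //; lra.
elim=> [|j IH]; first by rewrite expr0 mulr1 exprn_ege1.
case: (leqP j.+1 N) => h.
  apply: (@le_trans _ _ ((1 + X) ^+ N)); last by rewrite ler_peMr // ler1n fact_gt0.
  apply: (@le_trans _ _ ((1 + X) ^+ j.+1)); last by rewrite ler_weXn2l.
  by rewrite lerXn2r ?nnegrE //; lra.
rewrite exprS factS natrM mulrCA; apply: ler_pM; rewrite ?exprn_ge0 //.
by apply: (le_trans (ltW XN)); rewrite ler_nat ltnW.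
Qed.

(** Taylor's formula for the ga-th derivative: with de = al + ga, the binomial coefficients divided
    by de! become 1 / (al! ga!). *)
Lemma recenter_fact (R : realType) (m : nat) (D : {ffun 'I_m -> nat} -> CC R)
    (h : 'I_m -> CC R) ga s :
  has_sum (shift_term (fun de => D de / (mfact de)%:R) h ga) s ->
  has_sum (fun al => D (addi al ga) * mon h al / (mfact al)%:R) ((mfact ga)%:R * s).
Proof.
move=> hs; have := has_sumZ (c := (mfact ga)%:R) hs.
apply: (@has_sum_reindex _ _ _ (fun al => addi al ga) (fun de => subi de ga)
  predT (fun de => [forall i, ga i <= de i])%N) => //.
- by move=> al _; rewrite addiK; split=> //; apply/forallP => i; rewrite ffunE leq_addl.
- by move=> de /forallP hd; split=> //; apply/ffunP => i; rewrite !ffunE subnK.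
- move=> de /forallPn [ i ]; rewrite -ltnNge => hi.
  by rewrite /shift_term (bigD1 i) //= bin_small // !mul0r !mulr0.
move=> al _; rewrite /shift_term.
have -> : \prod_i ('C(addi al ga i, ga i)%:R * h i ^+ (addi al ga i - ga i)) =
    (mfact (addi al ga))%:R / ((mfact al)%:R * (mfact ga)%:R) * mon h al :> CC R.
  rewrite /mon /mfact !natr_prod -big_split -prodf_div -big_split /=; apply: eq_bigr => i _.
  rewrite ffunE addnK; congr (_ * _); apply/eqP.
  rewrite eq_sym -subr_eq0; apply/eqP.
  rewrite -(bin_fact (leq_addl (al i) (ga i))) addnK !natrM.
  by field; rewrite !pnatr_eq0 -!lt0n !fact_gt0.
by field; rewrite !pnatr_eq0 -!lt0n !mfact_gt0.
Qed.

(** * Factorial estimates *)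

Section Estimates.
Variables (R : realType) (n : nat) (a : 'I_n.+3 -> nat).
Hypothesis a_first : a ord0 = 1%N.
Hypothesis a_incr : forall i j : 'I_n.+3, (i < j)%N -> (a i < a j)%N.
Local Notation aN := (a ord_max).
Local Notation a' := (a (penult n)).

Definition fwt (al : {ffun 'I_n.+2 -> nat}) := (\sum_k a (lift ord_max k) * al k)%N.
Definition wt1 (al : {ffun 'I_n.+1 -> nat}) := (\sum_k a (lift ord_max (lift ord_max k)) * al k)%N.

Lemma ap_gt0 : (0 < a')%N. Proof. exact: a_gt0. Qed.

Lemma wt_glue al i : wt a (gluei al i) = (fwt al + aN * i)%N.
Proof.
rewrite /wt (bigD1_ord ord_max) //= glue_max addnC; congr (_ + _)%N.
by apply: eq_bigr => k _; rewrite glue_lift.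
Qed.

Lemma fwt_glue al i : fwt (gluei al i) = (wt1 al + a' * i)%N.
Proof.
rewrite /fwt (bigD1_ord ord_max) //= glue_max addnC; congr (_ + _)%N.
by apply: eq_bigr => k _; rewrite glue_lift.
Qed.

Lemma fwtD al be : fwt (addi al be) = (fwt al + fwt be)%N.
Proof. by rewrite /fwt -big_split; apply: eq_bigr => i _; rewrite ffunE mulnDr. Qed.

Lemma fwt_uniti k : fwt (uniti k) = a (lift ord_max k).
Proof.
rewrite /fwt (bigD1 k) //= ffunE eqxx muln1 big1 ?addn0 // => i /negPf ik.
by rewrite ffunE ik muln0.
Qed.

Lemma fwt_eq0 al : (fwt al == 0)%N = (al == zeroi).
Proof.
apply/idP/eqP => [|->]; last by rewrite /fwt big1 // => i _; rewrite ffunE muln0.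
rewrite /fwt sum_nat_eq0 => /forallP h; apply/ffunP => i; rewrite ffunE.
by apply/eqP; have := h i; rewrite muln_eq0 eqn0Ngt (a_gt0 a_first a_incr).
Qed.

Lemma wt1_le al : (wt1 al <= a'.-1 * deg al)%N.
Proof.
rewrite /wt1 /deg big_distrr /=; apply: leq_sum => k _; rewrite leq_mul2r; apply/orP; right.
rewrite -ltnS prednK ?ap_gt0 //; apply: a_incr.
by rewrite penult_val !lift_max.
Qed.

Definition radii (Rb rho : R) (k : 'I_n.+2) : R := if k == ord_max then rho else Rb.

(** The growth of solutions of the recursion of order a_(N-1), to be compared with (K / a_N)! for
    the small sequences. *)
Definition bnd (A0 G : R) K := A0 * G ^+ (K %/ a') * (K %/ a')`!%:R.

(* As wt1 m <= (a' - 1) |m|, the factorial of (k + wt1 m) / a' + l is bounded, up to an exponential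
   factor, by (k / a')! l! ((a' - 1) |m| / a')!; the last factor is beaten by m! on every polydisc,
   whereas l! allows only a small radius in x_(N-1). *)
Lemma estimate (A0 G Rb : R) : 0 <= A0 -> 1 <= G -> 1 <= Rb ->
  exists rho M Q : R, [/\ 0 < rho, 0 <= M, 1 <= Q &
   forall k al, bnd A0 G (k + fwt al) / (mfact al)%:R * rmon (radii Rb rho) al <=
     M * Q ^+ (k %/ a') * (k %/ a')`!%:R].
Proof.
move=> A00 G1 Rb1.
have G0 : 0 < G by lra.
(* Before the power a_(N-1), this is the product of the bases of all the factors exponential in |m|;
   the power makes it comparable with the factorial of |m| / a_(N-1). *)
pose X := (2 * G * 4 * 2 ^+ n.+1 * Rb) ^+ a'.
have [|M1 M11 hM1] := @pow_le_fact R X.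
  by rewrite /X exprn_ge0 // !mulr_ge0 // ?exprn_ge0 //; lra.
have ap := ap_gt0.
pose Y := 2 * G * 4.
have Y1 : 1 <= Y by rewrite /Y; lra.
(* The radius in x_(N-1) cancels G^l from [bnd] and 2^l from the splitting of (z + l)!; the
   remaining l! cancels against the one in al!. *)
exists (2 * G)^-1, (A0 * (Y * 2) * (X * M1)), Y; split=> //.
- by rewrite invr_gt0 mulr_gt0.
- by rewrite !mulr_ge0 // ?exprn_ge0 // ?mulr_ge0 // ?exprn_ge0; lra.
move=> k al; elim/ffun_lift_ind: al => m l.
rewrite fwt_glue addnA /bnd divnDr ?dvdn_mulr // [(a' * l)%N]mulnC mulnK //.
set z := ((k + wt1 m) %/ a')%N; set y := (k %/ a')%N; set s := deg m.
rewrite mfact_glue [(mfact m * _)%N]mulnC.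
have -> : rmon (radii Rb (2 * G)^-1) (gluei m l) = (2 * G) ^- l * Rb ^+ s.
  rewrite rmon_glue mulrC /radii eqxx exprVn; congr (_ * _).
  by rewrite /s /deg -prodrXr; apply: eq_bigr => c _; rewrite eq_sym (negPf (neq_lift _ _)).
pose x := ((a'.-1 * s) %/ a')%N.
(* The numerator contains only x!, and the gap from x to s is at least s / a_(N-1): m! thus leaves
   the factorial of s / a_(N-1) in the denominator, which beats any exponential in s. *)
have hx : (x + s %/ a' <= s)%N.
  rewrite -(leq_pmul2r ap) mulnDl.
  apply: leq_trans (leq_add (leq_divM _ _) (leq_divM _ _)) _.
  by rewrite -mulSnr prednK // mulnC.
have hz : (z <= x + y + 1)%N.
  apply: (@leq_trans ((k + a'.-1 * s) %/ a')); first by rewrite leq_div2r // leq_add2l wt1_le.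
  rewrite -ltnS ltn_divLR // [X in (X < _)%N]addnC {1}(divn_eq k a') {1}(divn_eq (a'.-1 * s) a').
  rewrite -/x -/y; have := ltn_pmod k ap; have := ltn_pmod (a'.-1 * s) ap; nia.
have f1 : ((z + l)`!%:R : R) <= 2 ^+ (z + l) * (z`!%:R * l`!%:R).
  by rewrite -natrX -!natrM ler_nat fact_add_ge.
have f2 : (z`!%:R : R) <= 2 * 4 ^+ (x + y) * (x`!%:R * y`!%:R).
  rewrite -natrX -!natrM ler_nat; apply: leq_trans (leq_fact hz) _.
  apply: leq_trans (fact_add_ge _ _) _; rewrite muln1.
  have -> : (2 ^ (x + y + 1) = 2 * 2 ^ (x + y))%N by rewrite addn1 expnS.
  rewrite -[4%N]/(2 * 2)%N expnMn -!mulnA leq_mul2l /= leq_mul2l.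
  by rewrite fact_add_ge orbT.
have f3 : (x`!%:R : R) * (s %/ a')`!%:R <= 2 ^+ (n.+1 * s) * (mfact m)%:R.
  rewrite -natrX -!natrM ler_nat; apply: leq_trans (fact_add_le _ _) _.
  by apply: leq_trans (leq_fact hx) _; exact: mfact_ge.
have f4 : (2 * G * 4 * 2 ^+ n.+1 * Rb) ^+ s <= X * M1 * (s %/ a')`!%:R.
  set X0 := 2 * G * 4 * 2 ^+ n.+1 * Rb; have X01 : 1 <= X0.
    rewrite /X0 !mulr_ege1 ?exprn_ege1 //; lra.
  rewrite -mulrA; apply: (@le_trans _ _ (X * X ^+ (s %/ a'))); last first.
    by apply: ler_wpM2l => //; apply: exprn_ge0; exact: le_trans ler01 X01.
  rewrite /X -exprM -exprD ler_weXn2l // {1}(divn_eq s a') [(_ * a')%N]mulnC addnC leq_add2r.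
  by rewrite ltnW // ltn_mod.
have m0 : 0 < (mfact m)%:R :> R by rewrite ltr0n mfact_gt0.
have l0 : 0 < l`!%:R :> R by rewrite ltr0n fact_gt0.
have q0 : 0 < (s %/ a')`!%:R :> R by rewrite ltr0n fact_gt0.
have xs : (x <= s)%N by apply: leq_trans hx; exact: leq_addr.
have Gz : (2 * G) ^+ z <= (2 * G) * ((2 * G) ^+ s * (2 * G) ^+ y).
  rewrite -exprD -exprS; apply: ler_weXn2l; first by lra.
  by apply: leq_trans hz _; rewrite addn1 ltnS leq_add2r.
have F4 : (4 : R) ^+ (x + y) <= 4 ^+ s * 4 ^+ y.
  by rewrite -exprD; apply: ler_weXn2l; [lra|rewrite leq_add2r].
rewrite natrM.
have -> : A0 * G ^+ (z + l) * (z + l)`!%:R / (l`!%:R * (mfact m)%:R) * ((2 * G) ^- l * Rb ^+ s) =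
   (z + l)`!%:R * (A0 * G ^+ (z + l) * ((2 * G) ^- l * Rb ^+ s) / (l`!%:R * (mfact m)%:R)).
  by field; rewrite !gt_eqF // exprn_gt0 // mulr_gt0.
have g0 : 0 <= A0 * G ^+ (z + l) * ((2 * G) ^- l * Rb ^+ s) / (l`!%:R * (mfact m)%:R).
  have h1 : 0 <= G ^+ (z + l) by rewrite exprn_ge0 // ltW.
  have h2 : 0 <= (2 * G) ^- l by rewrite invr_ge0 exprn_ge0 // mulr_ge0 // ltW.
  have h3 : 0 <= Rb ^+ s by rewrite exprn_ge0 //; lra.
  by rewrite divr_ge0 ?mulr_ge0 // ltW.
apply: le_trans (ler_wpM2r g0 f1) _.
have -> : 2 ^+ (z + l) * (z`!%:R * l`!%:R) *
  (A0 * G ^+ (z + l) * ((2 * G) ^- l * Rb ^+ s) / (l`!%:R * (mfact m)%:R)) =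
  A0 * (z`!%:R * ((2 * G) ^+ z * Rb ^+ s / (mfact m)%:R)).
  rewrite !exprD !exprMn invfM; field; rewrite !gt_eqF ?exprn_gt0 //.
rewrite -!mulrA ler_wpM2l //.
have Rs : 0 <= Rb ^+ s by rewrite exprn_ge0 //; lra.
have Gz0 : 0 <= (2 * G) ^+ z by rewrite exprn_ge0 // mulr_ge0 // ltW.
apply: (@le_trans _ _ (2 * (4 ^+ s * 4 ^+ y) * (x`!%:R * y`!%:R) *
   ((2 * G) * ((2 * G) ^+ s * (2 * G) ^+ y) * Rb ^+ s / (mfact m)%:R))).
  have Rm : 0 <= Rb ^+ s / (mfact m)%:R by rewrite divr_ge0 // ltW.
  apply: ler_pM => //; first exact: mulr_ge0.
    by apply: le_trans f2 _; rewrite ler_wpM2r // ler_wpM2l.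
  by rewrite -[X in _ <= X]mulrA ler_wpM2r.
have f5 : x`!%:R / (mfact m)%:R <= 2 ^+ (n.+1 * s) / (s %/ a')`!%:R :> R.
  by rewrite ler_pdivrMr // mulrAC ler_pdivlMr.
have Gs : 0 <= (2 * G) ^+ s by rewrite exprn_ge0 // mulr_ge0 // ltW.
have Gy : 0 <= (2 * G) ^+ y by rewrite exprn_ge0 // mulr_ge0 // ltW.
have G2 : 0 <= 2 * G by lra.
apply: (@le_trans _ _ (2 * (4 ^+ s * 4 ^+ y) * y`!%:R *
   ((2 * G) * ((2 * G) ^+ s * (2 * G) ^+ y) * Rb ^+ s) * (2 ^+ (n.+1 * s) / (s %/ a')`!%:R))).
  have -> : 2 * (4 ^+ s * 4 ^+ y) * (x`!%:R * y`!%:R) *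
     ((2 * G) * ((2 * G) ^+ s * (2 * G) ^+ y) * Rb ^+ s / (mfact m)%:R) =
   2 * (4 ^+ s * 4 ^+ y) * y`!%:R *
   ((2 * G) * ((2 * G) ^+ s * (2 * G) ^+ y) * Rb ^+ s) * (x`!%:R / (mfact m)%:R) by ring.
  by apply: ler_wpM2l f5; rewrite !mulr_ge0 // ?exprn_ge0 // ltW.
have f6 : (2 * G * 4 * 2 ^+ n.+1 * Rb) ^+ s / (s %/ a')`!%:R <= X * M1 by rewrite ler_pdivrMr.
have e : 2 * (4 ^+ s * 4 ^+ y) * y`!%:R *
   ((2 * G) * ((2 * G) ^+ s * (2 * G) ^+ y) * Rb ^+ s) * (2 ^+ (n.+1 * s) / (s %/ a')`!%:R) =
   2 * (2 * G) * Y ^+ y * y`!%:R * ((2 * G * 4 * 2 ^+ n.+1 * Rb) ^+ s / (s %/ a')`!%:R).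
  rewrite /Y exprM !exprMn; ring.
rewrite e; have Yy : 0 <= Y ^+ y by rewrite exprn_ge0 //; lra.
apply: (@le_trans _ _ (2 * (2 * G) * Y ^+ y * y`!%:R * (X * M1))).
  by apply: ler_wpM2l f6; rewrite !mulr_ge0 // ltW.
have -> : 2 * (G * (4 * (2 * (X * (M1 * (Y ^+ y * y`!%:R)))))) =
  (2 * G * 4 * 2) * Y ^+ y * y`!%:R * (X * M1) by ring.
have XM : 0 <= X * M1.
  have X00 : 0 <= X by rewrite exprn_ge0 // !mulr_ge0 // ?exprn_ge0 //; lra.
  by rewrite mulr_ge0 //; lra.
do 3 apply: ler_wpM2r => //.
by lra.
Qed.

End Estimates.

(** * Power branches and the binomial series *)

Section ComplexDerivative.
Variable R : realType.
Implicit Types (f g : CC R -> CC R) (z w l k : CC R).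

(** Complex differentiability without quotients, so that products and compositions are estimated
    directly. *)
Definition cderiv f z l := forall e : R, 0 < e -> exists2 d : R, 0 < d &
  forall w, nm (w - z) < d -> nm (f w - f z - l * (w - z)) <= e * nm (w - z).

Lemma cderiv_lip f z l : cderiv f z l -> exists2 d : R, 0 < d &
  forall w, nm (w - z) < d -> nm (f w - f z) <= (nm l + 1) * nm (w - z).
Proof.
move=> /(_ 1 ltr01) [d d0 hd]; exists d => // w /hd h.
have -> : f w - f z = (f w - f z - l * (w - z)) + l * (w - z) by ring.
by apply: le_trans (nmD _ _) _; rewrite nmM; lra.
Qed.

Lemma cderiv_quadratic f z l (K d : R) : 0 <= K -> 0 < d ->
  (forall w, nm (w - z) < d -> nm (f w - f z - l * (w - z)) <= K * nm (w - z) ^+ 2) ->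
  cderiv f z l.
Proof.
move=> K0 d0 h e e0; exists (Num.min d (e / (K + 1))).
  by rewrite lt_min d0 divr_gt0 //; lra.
move=> w; rewrite lt_min => /andP[wd we]; apply: le_trans (h w wd) _.
rewrite expr2 mulrA ler_wpM2r ?nm_ge0 //.
move: we; rewrite ltr_pdivlMr; last by lra.
by have := nm_ge0 (w - z); nra.
Qed.

Lemma cderivM f g z l k : cderiv f z l -> cderiv g z k ->
  cderiv (fun w => f w * g w) z (l * g z + f z * k).
Proof.
move=> hf hg e e0.
pose K := nm (g z) + nm (f z) + 1; have K0 : 0 < K by rewrite /K; have := nm_ge0 (g z); have := nm_ge0 (f z); lra.
have e1 : 0 < e / 2 / K by rewrite !divr_gt0.
have [d1 d10 h1] := hf _ e1; have [d2 d20 h2] := hg _ e1.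
have [d3 d30 h3] := cderiv_lip hf; have [d4 d40 h4] := cderiv_lip hg.
pose L := (nm l + 1) * (nm k + 1); have L0 : 0 < L by rewrite mulr_gt0 //; have := nm_ge0 l; have := nm_ge0 k; lra.
exists (Num.min (Num.min d1 d2) (Num.min (Num.min d3 d4) (e / 2 / L))).
  by rewrite !lt_min d10 d20 d30 d40 !divr_gt0.
move=> w; rewrite !lt_min => /andP[/andP[/h1 {}h1 /h2 {}h2] /andP[/andP[/h3 {}h3 /h4 {}h4] hL]].
have -> : f w * g w - f z * g z - (l * g z + f z * k) * (w - z) =
  (f w - f z - l * (w - z)) * g z + f z * (g w - g z - k * (w - z)) + (f w - f z) * (g w - g z) by ring.
set x := nm (w - z) in h1 h2 h3 h4 hL *; have x0 : 0 <= x by exact: nm_ge0.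
apply: le_trans (nmD _ _) _; apply: le_trans (lerD (nmD _ _) (lexx _)) _; rewrite !nmM.
have t1 : nm (f w - f z - l * (w - z)) * nm (g z) + nm (f z) * nm (g w - g z - k * (w - z)) <=
    e / 2 * x.
  apply: (@le_trans _ _ (e / 2 / K * x * K)); last by rewrite mulrAC divfK // gt_eqF.
  have := nm_ge0 (g z); have := nm_ge0 (f z); rewrite /K => a b.
  have := ler_wpM2r b h1; have := ler_wpM2l a h2.
  have : 0 <= e / 2 / K * x by rewrite mulr_ge0 // ltW.
  rewrite /K; lra.
have t2 : nm (f w - f z) * nm (g w - g z) <= e / 2 * x.
  apply: (@le_trans _ _ ((nm l + 1) * x * ((nm k + 1) * x))).
    by apply: ler_pM => //; exact: nm_ge0.
  have -> : (nm l + 1) * x * ((nm k + 1) * x) = (x * L) * x by rewrite /L; ring.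
  by rewrite ler_wpM2r // ltW // -ltr_pdivlMr.
by rewrite [e]splitr mulrDl; exact: lerD.
Qed.

Lemma cderiv_comp f g z l k : cderiv f z l -> cderiv g (f z) k ->
  cderiv (fun w => g (f w)) z (k * l).
Proof.
move=> hf hg e e0.
have l0 := nm_ge0 l; have k0 := nm_ge0 k.
have e1 : 0 < e / 2 / (nm l + 1) by rewrite !divr_gt0 //; lra.
have e2 : 0 < e / 2 / (nm k + 1) by rewrite !divr_gt0 //; lra.
have [d1 d10 h1] := hg _ e1; have [d2 d20 h2] := hf _ e2.
have [d3 d30 h3] := cderiv_lip hf.
exists (Num.min (Num.min d2 d3) (d1 / (nm l + 1))).
  by rewrite !lt_min d20 d30 divr_gt0 //; lra.
move=> w; rewrite !lt_min => /andP[/andP[/h2 {}h2 /h3 {}h3] hd].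
have {}hd : nm (f w - f z) < d1.
  by apply: le_lt_trans h3 _; rewrite mulrC -ltr_pdivlMr //; lra.
have {}h1 := h1 _ hd.
have -> : g (f w) - g (f z) - k * l * (w - z) =
  (g (f w) - g (f z) - k * (f w - f z)) + k * (f w - f z - l * (w - z)) by ring.
apply: le_trans (nmD _ _) _; rewrite nmM [e]splitr mulrDl; apply: lerD.
  apply: le_trans h1 _; apply: (@le_trans _ _ (e / 2 / (nm l + 1) * ((nm l + 1) * nm (w - z)))).
    by rewrite ler_wpM2l // ltW.
  by rewrite mulrA divfK // gt_eqF //; lra.
apply: (@le_trans _ _ ((nm k + 1) * (e / 2 / (nm k + 1) * nm (w - z)))).
  by apply: ler_pM => //; [exact: nm_ge0|lra].
by rewrite le_eqVlt; apply/orP; left; apply/eqP; field; rewrite gt_eqF //; lra.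
Qed.

Lemma cderivZ z c : cderiv (fun w => c * w) z c.
Proof.
move=> e e0; exists 1 => // w _.
by rewrite -mulrBr subrr nm0 mulr_ge0 ?nm_ge0 // ltW.
Qed.

Lemma real_derive0 (f : R -> R) df : is_derive (0 : R) (1 : R) f df ->
  forall e : R, 0 < e -> exists2 d : R, 0 < d &
    forall h, `|h| < d -> `|f h - f 0 - df * h| <= e * `|h|.
Proof.
move=> [hd hv] e e0; move: hd; rewrite /derivable => /cvg_ex [l hl].
have el : l = df by rewrite -hv /derive; apply/esym/cvg_lim.
move/cvgrPdist_lt: hl => /(_ e e0); rewrite el => /nbhs_ballP [d d0 hd].
exists d => // h hh; case: (eqVneq h 0) => [->|h0].
  by rewrite subrr mulr0 subr0 normr0 mulr0.
have := hd h; rewrite /ball /= sub0r normrN => /(_ hh h0).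
rewrite addr0 [h *: 1]mulr1 => /ltW h1.
have -> : f h - f 0 - df * h = - (h * (df - h^-1 * (f h - f 0))).
  by rewrite mulrBr mulrA mulfV // mul1r opprB mulrC.
by rewrite normrN normrM mulrC ler_wpM2r.
Qed.

Lemma cexpD z w : cexp (z + w) = cexp z * cexp w.
Proof.
case: z w => [x y] [x' y']; rewrite /cexp /= expRD cosD sinD.
by apply/eqP; rewrite eq_complex /=; apply/andP; split; apply/eqP; ring.
Qed.

Lemma cexp0 : cexp (0 : CC R) = 1.
Proof. by rewrite /cexp /= expR0 cos0 sin0 mul1r mul1r. Qed.

Lemma cexpN z : cexp (- z) * cexp z = 1.
Proof. by rewrite -cexpD addNr cexp0. Qed.

Lemma cexp_neq0 z : cexp z != 0.
Proof. by apply/eqP => h; have := cexpN z; rewrite h mulr0 => /eqP; rewrite eq_sym oner_eq0. Qed.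

Lemma cderiv_cexp0 : cderiv (@cexp R) 0 1.
Proof.
move=> e e0.
(* The four errors below add up to 8 c W, which e / 16 keeps under e W. *)
have [c [c0 c1 c2]] : exists c, [/\ 0 < c, c <= e / 16 & c <= 1 / 2].
  by exists (Num.min (e / 16) (1 / 2)); rewrite lt_min !ge_min !lexx orbT !divr_gt0.
have [d1 d10 h1] := real_derive0 (is_derive_expR 0) c0.
have [d2 d20 h2] := real_derive0 (is_derive_cos 0) c0.
have [d3 d30 h3] := real_derive0 (is_derive_sin 0) c0.
exists (Num.min (Num.min d1 d2) (Num.min d3 c)); first by rewrite !lt_min d10 d20 d30 c0.
move=> [x y]; rewrite subr0 !lt_min => /andP[/andP[w1 w2] /andP[w3 w4]].
set W := nm _ in w1 w2 w3 w4 *.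
have hx : `|x| <= W := nm_Re (x +i* y)%C.
have hy : `|y| <= W := nm_Im (x +i* y)%C.
have {}h1 := h1 x (le_lt_trans hx w1).
have {}h2 := h2 y (le_lt_trans hy w2).
have {}h3 := h3 y (le_lt_trans hy w3).
rewrite expR0 mul1r in h1; rewrite cos0 sin0 oppr0 mul0r subr0 in h2.
rewrite sin0 cos0 mul1r subr0 in h3.
have W0 : 0 <= W by exact: nm_ge0.
rewrite cexp0 mul1r; apply: le_trans (nm_ReIm _) _.
have -> : complex.Re (cexp (x +i* y)%C - 1 - (x +i* y)%C : CC R) = (expR x - 1 - x) * cos y + (1 + x) * (cos y - 1).
  by rewrite /=; ring.
have -> : complex.Im (cexp (x +i* y)%C - 1 - (x +i* y)%C : CC R) = (expR x - 1) * sin y + (sin y - y).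
  by rewrite /=; ring.
have cy : `|cos y| <= 1 by rewrite ler_norml cos_geN1 cos_le1.
have cx1 : c * `|x| <= c * W by rewrite ler_wpM2l // ltW.
have cy1 : c * `|y| <= c * W by rewrite ler_wpM2l // ltW.
have b1 : `|(expR x - 1 - x) * cos y| <= c * W.
  rewrite normrM; apply: le_trans (ler_pM _ _ h1 cy) _ => //; lra.
have b2 : `|(1 + x) * (cos y - 1)| <= 2 * (c * W).
  rewrite normrM; apply: ler_pM => //; last by lra.
  by apply: le_trans (ler_normD _ _) _; rewrite normr1; lra.
have bx : `|expR x - 1| <= 2 * c.
  have -> : expR x - 1 = (expR x - 1 - x) + x by ring.
  apply: le_trans (ler_normD _ _) _.
  have : c * W <= 1 * W by rewrite ler_wpM2r //; lra.
  lra.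
have by_ : `|sin y| <= 2 * W.
  have -> : sin y = (sin y - y) + y by ring.
  apply: le_trans (ler_normD _ _) _.
  have : c * W <= 1 * W by rewrite ler_wpM2r //; lra.
  lra.
have b3 : `|(expR x - 1) * sin y| <= 4 * (c * W).
  rewrite normrM; apply: le_trans (ler_pM _ _ bx by_) _ => //; lra.
have b4 : `|sin y - y| <= c * W by lra.
have := ler_normD ((expR x - 1 - x) * cos y) ((1 + x) * (cos y - 1)).
have := ler_normD ((expR x - 1) * sin y) (sin y - y).
have : c * W <= e / 16 * W by rewrite ler_wpM2r.
have : 0 <= e * W by rewrite mulr_ge0 // ltW.
lra.
Qed.

Lemma cderiv_cexp z : cderiv (@cexp R) z (cexp z).
Proof.
move=> e e0; have n0 : 0 < nm (cexp z) by rewrite nm_gt0 cexp_neq0.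
have [d d0 h] := cderiv_cexp0 (divr_gt0 e0 n0); exists d => // w hw.
have := h (w - z); rewrite !subr0 cexp0 mul1r => /(_ hw) h1.
have -> : cexp w - cexp z - cexp z * (w - z) = cexp z * (cexp (w - z) - 1 - (w - z)).
  have -> : cexp w = cexp z * cexp (w - z) by rewrite -cexpD addrC subrK.
  ring.
rewrite nmM; apply: le_trans (ler_wpM2l (ltW n0) h1) _.
by rewrite mulrA [nm _ * _]mulrC divfK // gt_eqF.
Qed.

(** With u = L w - L z one has w - z = z (exp u - 1). Continuity makes u small, and the derivative
    of exp at 0 then compares u with (w - z) / z; c <= 1/2 gives |u| <= 2 |w - z| / |z|. *)
Lemma cderiv_log (L : CC R -> CC R) z (d : R) : 0 < d -> {for z, continuous L} ->
  (forall w, nm (w - z) < d -> cexp (L w) = w) -> cderiv L z z^-1.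
Proof.
move=> d0 hc hL; have hz : cexp (L z) = z by apply: hL; rewrite subrr nm0.
have z0 : z != 0 by rewrite -hz cexp_neq0.
have nz : 0 < nm z by rewrite nm_gt0.
move=> e e0; pose c := Num.min (1 / 2) (e * nm z / 2).
have c0 : 0 < c by rewrite lt_min !divr_gt0 // mulr_gt0.
have [c1 c2] : c <= 1 / 2 /\ c <= e * nm z / 2 by rewrite !ge_min !lexx orbT.
have [d1 d10 h1] := cderiv_cexp0 c0.
have : \forall w \near z, nm (L w - L z) < d1.
  by move/cvg_nmP: hc; apply.
move=> /nbhs_nmP [d2 d20 h2]; exists (Num.min d d2); first by rewrite lt_min d0.
move=> w; rewrite lt_min => /andP[wd wd2].
have := h1 (L w - L z); rewrite !subr0 cexp0 mul1r => /(_ (h2 w wd2)).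
set u := L w - L z => hu.
have e1 : w - z = z * (cexp u - 1).
  have ew : cexp (L z) * cexp u = w by rewrite -cexpD /u addrC subrK hL.
  by rewrite hz in ew; rewrite mulrBr mulr1 ew.
have e2 : u - z^-1 * (w - z) = - (cexp u - 1 - u).
  by rewrite e1 mulKf //; ring.
rewrite e2 nmN; apply: (le_trans hu).
have hu2 : nm u <= 2 * (nm (w - z) / nm z).
  have eu : u = z^-1 * (w - z) - (cexp u - 1 - u) by rewrite -e2; ring.
  have nq : nm (z^-1 * (w - z)) = nm (w - z) / nm z by rewrite nmM nmV mulrC.
  have := nmB (z^-1 * (w - z)) (cexp u - 1 - u); rewrite -eu nq.
  have : c * nm u <= 1 / 2 * nm u by rewrite ler_wpM2r ?nm_ge0.
  lra.
apply: (@le_trans _ _ (e * nm z / 2 * (2 * (nm (w - z) / nm z)))).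
  by apply: ler_pM => //; [exact: ltW|exact: nm_ge0].
by rewrite le_eqVlt; apply/orP; left; apply/eqP; field; rewrite gt_eqF.
Qed.

(** Unlike [segment_ind], this propagates to the right only, as the inequality in the next lemma
    does. *)
Lemma real_ind (P : R -> Prop) : P 0 ->
  (forall t, 0 <= t <= 1 -> exists2 d : R, 0 < d &
     (forall s, 0 <= s <= t -> t - d < s -> P s -> P t) /\
     (forall s, t <= s <= 1 -> s < t + d -> P t -> P s)) -> P 1.
Proof.
move=> P0 h; pose S := [set t : R | 0 <= t <= 1 /\ P t].
have hS : has_sup S.
  split; first by exists 0; split=> //; rewrite lexx ler01.
  by exists 1 => t [/andP[_ ?] _].
have T0 : 0 <= sup S by apply: ub_le_sup; [exact: hS.2|split=> //; rewrite lexx ler01].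
have T1 : sup S <= 1 by apply: ge_sup; [exact: hS.1|move=> t [/andP[_ ?] _]].
have [|d d0 [hl hr]] := h (sup S); first by rewrite T0.
have [s [/andP[s0 s1] Ps] hs] := sup_adherent d0 hS.
have sT : s <= sup S by apply: ub_le_sup; [exact: hS.2|split=> //; rewrite s0].
have PT : P (sup S) by apply: (hl s) => //; rewrite s0.
case: (ltP 1 (sup S + d)) => h1; first by apply: hr => //; rewrite T1 lexx.
have h2 : P (sup S + d / 2) by apply: hr => //; [apply/andP; split; lra|lra].
have : sup S + d / 2 <= sup S by apply: ub_le_sup; [exact: hS.2|split=> //; apply/andP; split; lra].
lra.
Qed.

(** A mean value inequality: for every c > 0 the bound |f (pt t) - f z0| <= c t |z - z0| travels
    along the segment, because the derivative is 0 at each of its points. *)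
Lemma cderiv0_cst f z0 (rho : R) : (forall z, nm (z - z0) < rho -> cderiv f z 0) ->
  forall z, nm (z - z0) < rho -> f z = f z0.
Proof.
move=> h z hz; pose pt (t : R) : CC R := z0 + t%:C%C * (z - z0).
have pt0 : pt 0 = z0 by rewrite /pt mul0r addr0.
have pt1 : pt 1 = z by rewrite /pt mul1r addrC subrK.
have ptB s t : nm (pt s - pt t) = `|s - t| * nm (z - z0).
  rewrite -nm_real -nmM; congr nm; rewrite /pt rmorphB /=; ring.
apply/eqP; rewrite -subr_eq0 -nm_eq0 eq_le nm_ge0 andbT; apply/ler_addgt0Pr => e e0; rewrite add0r.
pose c := e / (nm (z - z0) + 1).
have z0' := nm_ge0 (z - z0).
have c0 : 0 < c by rewrite divr_gt0 //; lra.
have cz : c * nm (z - z0) <= e by rewrite /c mulrAC ler_pdivrMr; nra.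
suff : nm (f (pt 1) - f z0) <= 1 * (c * nm (z - z0)) by rewrite pt1 mul1r; lra.
apply: (@real_ind (fun t => nm (f (pt t) - f z0) <= t * (c * nm (z - z0)))).
  by rewrite pt0 subrr nm0 mul0r.
move=> t /andP[t0 t1].
have ht : nm (pt t - z0) < rho.
  rewrite -[z0 in _ - z0]pt0 ptB subr0 ger0_norm //; apply: le_lt_trans hz.
  by rewrite ler_piMl.
have [d d0 hd] := h _ ht _ c0.
exists (d / (nm (z - z0) + 1)); first by rewrite divr_gt0 //; lra.
have key s : `|s - t| < d / (nm (z - z0) + 1) -> nm (f (pt s) - f (pt t)) <= `|s - t| * (c * nm (z - z0)).
  move=> hs; have := hd (pt s); rewrite ptB mul0r subr0 mulrCA; apply.
  move: hs; rewrite ltr_pdivlMr; last by lra.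
  by apply: le_lt_trans; rewrite ler_wpM2l //; lra.
split=> s /andP[s0 s1] hs Ps.
  have := key s; rewrite ler0_norm ?subr_le0 // opprB => {}key.
  have {}key := key ltac:(lra).
  have := nm_dist3 (f (pt s)) (f (pt t)) (f z0); rewrite (nm_distC (f (pt t)) (f (pt s))); lra.
have := key s; rewrite ger0_norm ?subr_ge0 // => {}key.
have {}key := key ltac:(lra).
have := nm_dist3 (f (pt t)) (f (pt s)) (f z0); lra.
Qed.

End ComplexDerivative.

(** * The binomial series with complex exponent *)

Section Binomial.
Variable R : realType.

Let cst1 (i : nat) : {ffun 'I_1 -> nat} := [ffun=> i].
Let row1 (z : CC R) : 'rV[CC R]_1 := const_mx z.

Lemma has_sum_ord1E (F : {ffun 'I_1 -> nat} -> CC R) (G : nat -> CC R) s :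
  (forall i, F (cst1 i) = G i) -> has_sum F s <-> has_sum G s.
Proof. by move=> h; rewrite has_sum_ord1; split; apply: eq_has_sum => i; rewrite -h. Qed.

Lemma pseries_cderiv (c : nat -> CC R) (r M : R) (F : CC R -> CC R) : 0 < r ->
  (forall l, nm (c l) * r ^+ l <= M) ->
  (forall z, nm z <= r -> has_sum (fun l => c l * z ^+ l) (F z)) ->
  forall z, nm z <= r / 4 -> exists2 k : CC R,
    has_sum (fun l => l.+1%:R * c l.+1 * z ^+ l) k & cderiv F z k.
Proof.
move=> r0 hM hF z hz; pose C (al : {ffun 'I_1 -> nat}) := c (al 0).
have hC : pbd C (fun=> r) M by move=> al; rewrite /rmon big_ord1; exact: hM.
have h1 (x y : 'rV[CC R]_1) : (forall i, nm (x 0 i - y 0 i) <= r) <-> nm (x 0 0 - y 0 0) <= r.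
  by split=> [/(_ 0)|h i] //; rewrite ord1.
pose f (x : 'rV[CC R]_1) := F (x 0 0).
have hf : expands_on r 0 C f.
  move=> x /(_ 0); rewrite mxE subr0 => hx; apply/(has_sum_ord1E (G := fun l => c l * x 0 0 ^+ l)).
    by move=> i; rewrite /C /mon big_ord1 !ffunE mxE subr0.
  exact: hF.
have hy (i : 'I_1) : nm (row1 z 0 i - (0 : 'rV[CC R]_1) 0 i) <= r / 4 by rewrite !mxE subr0.
have hrec := expands_on_recenter r0 hC hf hy.
have hb : pbd (recenter C (fun i => row1 z 0 i - (0 : 'rV[CC R]_1) 0 i)) (fun=> r / 4) (M * 2 ^+ 1).
  apply: (recenter_bound (r := fun=> r)) hC => i; first by rewrite divr_gt0.
  by have := hy i; lra.
set D := recenter C _ in hrec hb.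
exists (D (uniti 0)).
  have h2 := has_sum_dC (k := 0) r0 hC hy.
  have e2 i : dC 0 C (cst1 i) * mon (fun i => row1 z 0 i - (0 : 'rV[CC R]_1) 0 i) (cst1 i) =
      i.+1%:R * c i.+1 * z ^+ i.
    by rewrite /dC /C /mon big_ord1 !ffunE !mxE subr0 addn1.
  exact: (@has_sum_ord1E _ _ (D (uniti 0)) e2).1 h2.
have r4 : 0 < r / 4 by rewrite divr_gt0.
have M0 : 0 <= M by apply: le_trans (hM 0%N); rewrite mulr_ge0 ?nm_ge0 // exprn_ge0 // ltW.
apply: (@cderiv_quadratic _ _ _ _ (M * 2 ^+ 1 * 2 ^+ 1 / (r / 4 / 2) ^+ 2) (r / 4 / 2)).
- by rewrite divr_ge0 ?mulr_ge0 ?exprn_ge0 ?divr_ge0 // ltW.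
- by rewrite divr_gt0.
move=> w hw; have := @expands_on_taylor1 R 1 _ _ _ _ _ 0 (w - z) r4 hb hrec (ltW hw).
have -> : f ((w - z) *: 'e_0 + row1 z) = F w by rewrite /f !mxE /= mulr1 subrK.
have -> : f (row1 z) = F z by rewrite /f mxE.
by rewrite expr_div_n mulrA mulrAC.
Qed.

Definition binc (de : CC R) l : CC R := cffact de l / l`!%:R.

Lemma cffactS (de : CC R) l : cffact de l.+1 = cffact de l * (de - l%:R).
Proof. by rewrite /cffact big_ord_recr. Qed.

Lemma cffact_add (de : CC R) r l : cffact de (r + l) = cffact de r * cffact (de - r%:R) l.
Proof.
rewrite /cffact big_split_ord /=; congr (_ * _); apply: eq_bigr => i _ /=.
by rewrite natrD opprD addrA.
Qed.

(** For a natural number D > |de|, the coefficient is at most that of (D + l) over l in modulus,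
    hence at most 2 ^ (D + l). *)
Lemma binc_bound (de : CC R) : exists M : R, forall l, nm (binc de l) * (2^-1) ^+ l <= M.
Proof.
pose D := Num.bound (nm de); have hD : nm de < D%:R := archi_boundP (nm_ge0 _).
exists (2 ^+ D) => l.
have h l' : nm (cffact de l') * D`!%:R <= (D + l')`!%:R.
  elim: l' => [|l' IH]; first by rewrite addn0 /cffact big_ord0 nm1 mul1r.
  rewrite cffactS nmM addnS factS natrM mulrAC mulrC; apply: ler_pM => //.
  - exact: nm_ge0.
  - by rewrite mulr_ge0 ?nm_ge0.
  apply: le_trans (nmB _ _) _; rewrite nm_nat -natr1 natrD; lra.
have h2 : nm (cffact de l) * D`!%:R <= 2 ^+ D * 2 ^+ l * (l`!%:R * D`!%:R).
  apply: le_trans (h l) _; rewrite -exprD -natrX -!natrM ler_nat.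
  by rewrite [(l`! * _)%N]mulnC fact_add_ge.
have D0 : (0 : R) < D`!%:R by rewrite ltr0n fact_gt0.
have l0 : (0 : R) < l`!%:R by rewrite ltr0n fact_gt0.
move: h2; rewrite mulrA ler_pM2r // => h2.
rewrite /binc nmM nmV nm_nat exprVn ler_pdivrMr ?exprn_gt0 // ler_pdivrMr //.
Qed.

Definition binom_fun (de : CC R) (z : CC R) := sum (fun l => binc de l * z ^+ l).

Lemma binom_has_sum de z : nm z <= 4^-1 -> has_sum (fun l => binc de l * z ^+ l) (binom_fun de z).
Proof.
move=> hz; have [M hM] := binc_bound de.
have M0 : 0 <= M by apply: le_trans (hM 0%N); rewrite mulr_ge0 ?nm_ge0 ?exprn_ge0 ?invr_ge0.
have [s hs] : exists s, has_sum (fun l => binc de l * z ^+ l) s.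
  apply: (@abs_has_sum_ex _ _ _ (M * 2)) => A.
  apply: (@le_trans _ _ (\sum_(l <- A) M * 2^-1 ^+ l)); last first.
    by rewrite -mulr_sumr ler_wpM2l // geo2_fset.
  apply: ler_sum => l _; rewrite nmM nmX.
  apply: (@le_trans _ _ (nm (binc de l) * (2^-1 ^+ l * 2^-1 ^+ l))).
    rewrite ler_wpM2l ?nm_ge0 // -exprMn lerXn2r ?nnegrE ?nm_ge0 ?mulr_ge0 ?invr_ge0 //.
    by apply: le_trans hz _; lra.
  by rewrite mulrA ler_wpM2r // exprn_ge0 // invr_ge0.
by rewrite /binom_fun (has_sum_sum hs).
Qed.

Lemma binom_fun0 de : binom_fun de 0 = 1.
Proof.
have h0 : nm (0 : CC R) <= 4^-1 by rewrite nm0 invr_ge0.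
apply: has_sum_uniq (binom_has_sum (de := de) h0) _; move: (has_sum_single 0%N (1 : CC R)).
apply: eq_has_sum => -[|l] /=; first by rewrite /binc /cffact big_ord0 expr0 mulr1 divr1.
by rewrite expr0n mulr0.
Qed.

(** The coefficients satisfy (l + 1) c_(l+1) + l c_l = de c_l. The radius is a quarter of the 1/4 on
    which the series is summed, as recentering demands. *)
Lemma binom_ode de z : nm z <= 16^-1 -> exists2 k, (1 + z) * k = de * binom_fun de z &
  cderiv (binom_fun de) z k.
Proof.
move=> hz; have [M hM] := binc_bound de.
have [||||k hk hd] := @pseries_cderiv (binc de) 4^-1 M (binom_fun de) _ _ _ z.
- by rewrite invr_gt0.
- move=> l; apply: le_trans (hM l); rewrite ler_wpM2l ?nm_ge0 // lerXn2r ?nnegrE ?invr_ge0 //; lra.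
- by move=> w; exact: binom_has_sum.
- by lra.
exists k => //; have hz4 : nm z <= 4^-1 by lra.
have hb := binom_has_sum (de := de) hz4.
have h1 : has_sum (fun l => l%:R * binc de l * z ^+ l) (z * k).
  have := has_sumZ (c := z) hk.
  apply: (@has_sum_reindex _ _ _ predn S (fun l => 0 < l)%N predT) => //.
  - by case.
  - by case=> // _; rewrite !mul0r.
  by case=> // l _ /=; rewrite exprS; ring.
have := has_sumD hk h1; have -> : k + z * k = (1 + z) * k by ring.
move=> h; apply: has_sum_uniq h _; have := has_sumZ (c := de) hb; apply: eq_has_sum => l.
rewrite /binc cffactS factS natrM; field.
by rewrite nat1r !pnatr_eq0 -!lt0n fact_gt0.
Qed.

(* Both sides solve z g' = de g; only the continuity of L is used. *)
Lemma cexp_log_binom (L : CC R -> CC R) z0 (rho : R) de : z0 != 0 ->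
  (forall z, nm (z - z0) < rho -> {for z, continuous L} /\ cexp (L z) = z) ->
  rho <= nm z0 / 16 ->
  forall z, nm (z - z0) < rho ->
    cexp (de * L z) = cexp (de * L z0) * binom_fun de ((z - z0) / z0).
Proof.
move=> z00 hL hrho z hz; have n0 : 0 < nm z0 by rewrite nm_gt0.
(* The contributions - de / w and de / w of the two factors cancel in the derivative of h. *)
pose h w := cexp (- de * L w) * binom_fun de ((w - z0) / z0).
have hsmall w : nm (w - z0) < rho -> nm ((w - z0) / z0) <= 16^-1.
  by move=> hw; rewrite nmM nmV ler_pdivrMr //; lra.
have hd w : nm (w - z0) < rho -> cderiv h w 0.
  move=> hw; have [hc hw0] := hL w hw.
  have w0 : w != 0 by rewrite -hw0 cexp_neq0.
  have dL : cderiv L w w^-1.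
    apply: (@cderiv_log _ _ _ (rho - nm (w - z0))) => //; first by rewrite subr_gt0.
    move=> x hx; have [] // := hL x; have := nm_dist3 w x z0; lra.
  have d1 := cderiv_comp (cderiv_comp dL (cderivZ (L w) (- de))) (cderiv_cexp (- de * L w)).
  have [k ek dk] := binom_ode de (hsmall w hw).
  have dq : cderiv (fun w => (w - z0) / z0) w z0^-1.
    move=> e e0; exists 1 => // x _.
    have -> : (x - z0) / z0 - (w - z0) / z0 - z0^-1 * (x - w) = 0 by ring.
    by rewrite nm0 mulr_ge0 ?nm_ge0 // ltW.
  have := cderivM d1 (cderiv_comp dq dk).
  suff -> : cexp (- de * L w) * (- de / w) * binom_fun de ((w - z0) / z0) +
      cexp (- de * L w) * (k / z0) = 0 by [].
  have e1 : 1 + (w - z0) / z0 = w / z0 by field.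
  rewrite e1 in ek; have ek' : k / z0 = de * binom_fun de ((w - z0) / z0) / w.
    by rewrite -ek; field; rewrite w0.
  rewrite ek'; ring.
have := cderiv0_cst hd hz; rewrite /h subrr mul0r binom_fun0 mulr1 => hh.
have e1 x : cexp (de * x) * cexp (- de * x) = 1 by rewrite -cexpD mulNr addrN cexp0.
rewrite -[LHS]mulr1 -(e1 (L z0)) -hh [cexp (- de * L z) * _]mulrC.
transitivity (cexp (de * L z) * cexp (- de * L z) * (cexp (de * L z0) * binom_fun de ((z - z0) / z0))).
  ring.
by rewrite e1 mul1r.
Qed.

Lemma cexp_pow (z : CC R) r : cexp (r%:R * z) = cexp z ^+ r.
Proof.
elim: r => [|r IH]; first by rewrite mul0r cexp0 expr0.
by rewrite -natr1 mulrDl mul1r cexpD IH exprSr.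
Qed.

(** b(z) z^-r is exp ((gam - r) L z), and (gam)_r (gam - r)_l = (gam)_(r + l). The radius does not
    depend on r, so it serves all the terms of a Gamma-series together. *)
Lemma branch_binom gam z0 (b : CC R -> CC R) : z0 != 0 -> is_power_branch gam z0 b ->
  exists2 rho : R, 0 < rho & forall z, nm (z - z0) <= rho -> forall r,
    has_sum (fun l => cffact gam (r + l) * (b z0 * z0 ^- (r + l)) / l`!%:R * (z - z0) ^+ l)
      (cffact gam r * (b z * z ^- r)).
Proof.
move=> z00 [L /nbhs_nmP [e e0 he]]; have n0 : 0 < nm z0 by rewrite nm_gt0.
pose rho := Num.min e (nm z0 / 16).
have rho0 : 0 < rho by rewrite lt_min e0 divr_gt0.
have [r1 r2] : rho <= e /\ rho <= nm z0 / 16 by rewrite !ge_min !lexx orbT.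
exists (rho / 2); first by rewrite divr_gt0.
move=> z hz r; have hz' : nm (z - z0) < rho by lra.
have hb w : nm (w - z0) < rho -> b w * w ^- r = cexp ((gam - r%:R) * L w).
  move=> hw; have [_ hw0 ->] := he w (lt_le_trans hw r1).
  have hw1 : w != 0 by rewrite -hw0 cexp_neq0.
  rewrite -{2}hw0 -cexp_pow mulrBl cexpD; congr (_ * _).
  by apply: (mulIf (cexp_neq0 (r%:R * L w))); rewrite cexpN mulVf ?cexp_neq0.
have hz0 : nm (z0 - z0) < rho by rewrite subrr nm0.
have hbin := @cexp_log_binom L z0 rho (gam - r%:R) z00 _ r2 z hz'.
rewrite (hb z hz') hbin => [|w hw]; last by have [? ? _] := he w (lt_le_trans hw r1).
have hq : nm ((z - z0) / z0) <= 4^-1 by rewrite nmM nmV ler_pdivrMr //; lra.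
have := has_sumZ (c := cffact gam r * cexp ((gam - r%:R) * L z0)) (binom_has_sum (de := gam - r%:R) hq).
rewrite -mulrA; apply: eq_has_sum => l; rewrite -(hb z0 hz0) cffact_add /binc.
rewrite exprMn exprD invfM exprVn; field.
by rewrite pnatr_eq0 -lt0n fact_gt0 /= !expf_neq0.
Qed.

End Binomial.

(** * Recentered sequences *)

Lemma big_lift_max (T : Type) (idx : T) (op : Monoid.com_law idx) m (F : 'I_m.+1 -> T) :
  \big[op/idx]_(l | l != ord_max) F l = \big[op/idx]_(l < m) F (lift ord_max l).
Proof.
rewrite big_mkcond (bigD1_ord ord_max) //= eqxx Monoid.mul1m; apply: eq_bigr => l _.
by rewrite eq_sym neq_lift.
Qed.

Lemma exp_sum_bound (R : realType) m (x : 'I_m -> R) : (forall k, 0 <= x k) ->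
  exists2 E : R, 0 <= E & forall A : {fset {ffun 'I_m -> nat}},
    \sum_(al <- A) rmon x al / (mfact al)%:R <= E.
Proof.
move=> x0; have /choice [M hM] : forall k, exists M : R, 1 <= M /\ forall j, (2 * x k) ^+ j <= M * j`!%:R.
  by move=> k; have [|M h1 h2] := @pow_le_fact R (2 * x k); [rewrite mulr_ge0|exists M].
exists (\prod_k (2 * M k)).
  by apply: prodr_ge0 => k _; have [? _] := hM k; lra.
move=> A; rewrite (eq_bigr (fun al : {ffun 'I_m -> nat} => \prod_k (x k ^+ al k / (al k)`!%:R))); last first.
  by move=> al _; rewrite /rmon /mfact natr_prod prodf_div.
apply: (ler_sum_prod (g := fun k j => x k ^+ j / j`!%:R)) => [k j|k L].
  by rewrite divr_ge0 ?exprn_ge0.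
have [M1 hj] := hM k; apply: (@le_trans _ _ (\sum_(l < L) M k * 2^-1 ^+ l)).
  apply: ler_sum => l _; rewrite ler_pdivrMr ?ltr0n ?fact_gt0 // mulrAC exprVn ler_pdivlMr ?exprn_gt0 //.
  by rewrite mulrC -exprMn.
rewrite -mulr_sumr mulrC; apply: ler_wpM2r; [lra|exact: geo2_sum].
Qed.

Lemma nm_cffact (R : realType) (gam : CC R) s : nm (cffact gam s) <= (nm gam + 1) ^+ s * s`!%:R.
Proof.
have g0 := nm_ge0 gam; elim: s => [|s IH]; first by rewrite /cffact big_ord0 nm1 expr0 mul1r.
rewrite cffactS nmM exprSr factS natrM [(s.+1)%:R * _]mulrC mulrACA.
apply: ler_pM => //; [exact: nm_ge0|exact: nm_ge0|].
apply: le_trans (nmB _ _) _; rewrite nm_nat -natr1.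
have : 0 <= nm gam * s%:R by rewrite mulr_ge0.
lra.
Qed.

Section WeightSequences.
Variables (R : realType) (n : nat) (a : 'I_n.+3 -> nat).
Hypothesis a_first : a ord0 = 1%N.
Hypothesis a_incr : forall i j : 'I_n.+3, (i < j)%N -> (a i < a j)%N.
Local Notation aN := (a ord_max).
Local Notation a' := (a (penult n)).

Variable h : 'I_n.+2 -> CC R.
Hypothesis h_max : h ord_max = 0.

(* If c is the sequence of the x_1-derivatives at (0, ..., 0, t0) of a function killed by the
   operators d_i - d_1^(a_i), then [useq c k] is its k-th x_1-derivative at the point h + t0 e_(N-1). *)
Definition useq (c : nat -> CC R) k : CC R :=
  sum (fun al : {ffun 'I_n.+2 -> nat} => c (k + fwt a al)%N * mon h al / (mfact al)%:R).

(** Half of this radius has room for the displacement h and a polydisc of radius 1 around it. *)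
Definition hbound : R := 2 * (\sum_k nm (h k) + 1).

Lemma h_le k : nm (h k) + 1 <= hbound / 2.
Proof.
have -> : hbound / 2 = \sum_k nm (h k) + 1 by rewrite /hbound; lra.
by rewrite lerD2r (bigD1 k) //= lerDl sumr_ge0 // => *; exact: nm_ge0.
Qed.

Lemma hbound_ge1 : 1 <= hbound.
Proof. by have := h_le ord_max; have := nm_ge0 (h ord_max); lra. Qed.

Variables (A0 G : R).
Hypotheses (A00 : 0 <= A0) (G1 : 1 <= G).

Lemma array_bound (Rb : R) : 1 <= Rb -> exists rho M Q : R, [/\ 0 < rho, 0 <= M, 1 <= Q &
  forall k (D : {ffun 'I_n.+2 -> nat} -> CC R),
    (forall al, nm (D al) <= bnd a A0 G (k + fwt a al)) ->
    pbd (fun al => D al / (mfact al)%:R) (radii Rb rho) (M * Q ^+ (k %/ a') * (k %/ a')`!%:R)].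
Proof.
move=> Rb1; have [rho [M [Q [rho0 M0 Q1 hest]]]] := @estimate R n a a_first a_incr A0 G Rb A00 G1 Rb1.
exists rho, M, Q; split=> // k D hD al; apply: le_trans (hest k al).
rewrite nmM nmV nm_nat; apply: ler_wpM2r.
  by apply: rmon_ge0 => i; rewrite /radii; case: ifP => _; lra.
by apply: ler_wpM2r; [rewrite invr_ge0|exact: hD].
Qed.

Lemma useq_sum (c : nat -> CC R) k : (forall K, nm (c K) <= bnd a A0 G K) ->
  has_sum (fun al : {ffun 'I_n.+2 -> nat} => c (k + fwt a al)%N * mon h al / (mfact al)%:R) (useq c k).
Proof.
move=> hc; have [rho [M [Q [rho0 M0 Q1 hp]]]] := array_bound hbound_ge1.
have hb := hp k (fun al => c (k + fwt a al)%N) (fun al => hc _).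
have [s hs] : exists s, has_sum (fun al : {ffun 'I_n.+2 -> nat} =>
    c (k + fwt a al)%N * mon h al / (mfact al)%:R) s.
  apply: abs_has_sum_ex => A; apply: le_trans (geo_abs_le (x := fun k => nm (h k)) A _ hb).
    by apply: ler_sum => al _; rewrite -nm_mon -nmM mulrAC.
  move=> i; rewrite nm_ge0 /= /radii; case: eqP => [->|_]; first by rewrite h_max nm0 divr_ge0 // ltW.
  by have := h_le i; lra.
by rewrite /useq (has_sum_sum hs).
Qed.

(** The effect of x_j d_j: al_j / al! = 1 / (al - e_j)!, so the weight al_j becomes a shift of the
    sequence by a_j. *)
Lemma useq_weighted (c : nat -> CC R) k j : (forall K, nm (c K) <= bnd a A0 G K) ->
  has_sum (fun al : {ffun 'I_n.+2 -> nat} =>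
      (al j)%:R * (c (k + fwt a al)%N * mon h al / (mfact al)%:R))
    (h j * useq c (k + a (lift ord_max j))).
Proof.
move=> hc; apply: (@has_sum_unshift _ _ j) => [al ->|]; first by rewrite mul0r.
have := has_sumZ (c := h j) (useq_sum (k := k + a (lift ord_max j)) hc); apply: eq_has_sum => al.
rewrite fwtD fwt_uniti mon_add mon_unit mfactS !ffunE eqxx addn1 natrM addnAC addnA invfM.
by field; rewrite ?nat1r ?natr1 !pnatr_eq0 -!lt0n mfact_gt0.
Qed.

(** The terms of T with j < N - 1 add up to the factor fwt al. The operator at p thus acts termwise
    as the two-term operator a_(N-1) t0 c_(K + a_(N-1)) + (K - beta) c_K at the base point, with K =
    k + fwt al. *)
Lemma Top_useq (beta : CC R) (p : 'rV[CC R]_n.+3) (c : nat -> CC R) k :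
  (forall K, nm (c K) <= bnd a A0 G K) ->
  (forall j, j != ord_max -> p 0 (lift ord_max j) = h j) ->
  has_sum (fun al : {ffun 'I_n.+2 -> nat} =>
     (a'%:R * p 0 (penult n) * c (k + fwt a al + a')%N + ((k + fwt a al)%:R - beta) * c (k + fwt a al)%N) *
       (mon h al / (mfact al)%:R))
   (Top a beta p (useq c) k).
Proof.
move=> hc hp; rewrite /Top big_lift_max.
have -> : \sum_(j < n.+2) (a (lift ord_max j))%:R * p 0 (lift ord_max j) * useq c (k + a (lift ord_max j)) =
  \sum_(j < n.+2) (a (lift ord_max j))%:R * (h j * useq c (k + a (lift ord_max j))) +
  a'%:R * p 0 (penult n) * useq c (k + a').
  rewrite (bigD1 ord_max) //= [in RHS](bigD1 ord_max) //= h_max mul0r mulr0 add0r addrC.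
  by congr (_ + _); apply: eq_bigr => j jm; rewrite hp // mulrA.
have h1 := @has_sum_big _ _ _ (index_enum 'I_n.+2) predT _ _ (fun j _ =>
  has_sumZ (c := (a (lift ord_max j))%:R) (useq_weighted (k := k) (j := j) hc)).
have h2 := has_sumZ (c := a'%:R * p 0 (penult n)) (useq_sum (k := k + a') hc).
have h3 := has_sumZ (c := k%:R - beta) (useq_sum (k := k) hc).
move: (has_sumD (has_sumD h1 h2) h3); apply: eq_has_sum => al.
have -> : \sum_(j < n.+2) (a (lift ord_max j))%:R * ((al j)%:R *
    (c (k + fwt a al)%N * mon h al / (mfact al)%:R)) =
    (fwt a al)%:R * (c (k + fwt a al)%N * mon h al / (mfact al)%:R).
  by rewrite /fwt natr_sum mulr_suml; apply: eq_bigr => j _; rewrite natrM mulrA.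
rewrite -[(k + a' + _)%N]addnAC natrD; ring.
Qed.

(* Recentering at 0 recovers c. *)
Lemma useq_inj (c : nat -> CC R) : (forall K, nm (c K) <= bnd a A0 G K) ->
  (forall k, useq c k = 0) -> forall K, c K = 0.
Proof.
move=> hc hU K.
(* Twice [hbound], because translation by h must leave a polydisc of radius hbound / 2, large enough
   to contain a neighbourhood of 0. *)
have Rb1 : 1 <= 2 * hbound by have := hbound_ge1; lra.
have [rho [M [Q [rho0 M0 Q1 hp]]]] := array_bound Rb1.
pose D (al : {ffun 'I_n.+2 -> nat}) := c (fwt a al).
have hb := hp 0%N D (fun al => hc _).
pose r' (k : 'I_n.+2) : R := if k == ord_max then rho / 2 else hbound / 2.
have r'0 k : 0 < r' k.
  by rewrite /r'; case: ifP => _; [lra|have := hbound_ge1; lra].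
have hr' k : nm (h k) + r' k <= radii (2 * hbound) rho k / 2.
  rewrite /r' /radii; case: eqP => [->|_]; first by rewrite h_max nm0 add0r.
  by have := h_le k; lra.
have rec0 ga : recenter (fun al => D al / (mfact al)%:R) h ga = 0.
  have := recenter_fact (recenter_sum (ga := ga) r'0 hr' hb).
  have := useq_sum (k := fwt a ga) hc; rewrite hU => h1 h2.
  have : (mfact ga)%:R * recenter (fun al => D al / (mfact al)%:R) h ga = 0.
    apply: has_sum_uniq h2 _; move: h1; apply: eq_has_sum => al.
    by rewrite /D fwtD addnC.
  by move/eqP; rewrite mulf_eq0 pnatr_eq0 eqn0Ngt mfact_gt0 /= => /eqP.
have : expands 0 (fun al => D al / (mfact al)%:R) (fun=> 0).
  apply: (@expands_on_expands _ _ (Num.min (rho / 2) 1)); first by rewrite lt_min ltr01 divr_gt0.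
  move=> x hx.
  have hx2 k : nm (x 0 k) <= rho / 2 /\ nm (x 0 k) <= 1.
    by have := hx k; rewrite mxE subr0 le_min => /andP[].
  have hx3 k : nm (x 0 k - h k) <= r' k.
    rewrite /r'; case: eqP => [->|_]; first by rewrite h_max subr0; have [] := hx2 ord_max.
    have := nmB (x 0 k) (h k); have := h_le k; have [_] := hx2 k; lra.
  have [s hs] : exists s, has_sum (fun al => D al / (mfact al)%:R * mon (fun k => x 0 k) al) s.
    apply: abs_has_sum_ex => A; apply: le_trans (geo_abs_le (x := fun k => nm (x 0 k)) A _ hb).
      by apply: ler_sum => al _; rewrite nmM nm_mon.
    move=> k; rewrite nm_ge0 /= /radii; have [u1 u2] := hx2 k; case: ifP => _ //.
    by have := hbound_ge1; lra.
  have e : (fun k => x 0 k) = (fun k => h k + (x 0 k - h k)) by apply/funext => k; ring.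
  have := hs; rewrite {1}e => /(recenter_has_sum r'0 hr' hb hx3) hs0.
  have s0 : s = 0.
    by apply: has_sum_uniq hs0 _; apply: has_sum0 => ga; rewrite rec0 mul0r.
  rewrite s0 in hs; move: hs; apply: eq_has_sum => al; congr (_ * mon _ _).
  by apply/funext => k; rewrite mxE subr0.
move/expands_inj/(_ (expands0 _)) => hE.
pose al : {ffun 'I_n.+2 -> nat} := [ffun k => if k == ord0 then K else 0%N].
have wal : fwt a al = K.
  rewrite /fwt (bigD1 ord0) //= ffunE eqxx big1 => [|k /negPf k0]; last by rewrite ffunE k0 muln0.
  have -> : lift ord_max ord0 = ord0 :> 'I_n.+3 by apply: ord_inj; rewrite lift_max.
  by rewrite a_first mul1n addn0.
have /eqP := hE al; rewrite /D wal mulf_eq0 invr_eq0 pnatr_eq0 [mfact _ == _]eqn0Ngt mfact_gt0 orbF.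
by move/eqP.
Qed.

End WeightSequences.

(** * Expansion of the Gamma-series *)

Section GammaSeries.
Variables (R : realType) (n : nat) (a : 'I_n.+3 -> nat).
Hypothesis a_first : a ord0 = 1%N.
Hypothesis a_incr : forall i j : 'I_n.+3, (i < j)%N -> (a i < a j)%N.
Local Notation aN := (a ord_max).
Local Notation a' := (a (penult n)).
Variables (J : nat) (gam : CC R) (b : CC R -> CC R).

Let ap0 : (0 < a')%N := ap_gt0 a_first a_incr.

(* [cseq t K] is the value at (0, ..., 0, t) of the K-th x_1-derivative. *)
Definition cseq (t : CC R) K : CC R :=
  if (J <= K)%N && (a' %| K - J)%N then
    J`!%:R * (cffact gam ((K - J) %/ a') * (b t * t ^- ((K - J) %/ a'))) else 0.

(** The l-th derivative in x_(N-1) of the entry of weight K: each derivative lowers the exponent of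
    t by one and adds a factor to the falling factorial. *)
Definition cseq_deriv (t : CC R) K l : CC R :=
  if (J <= K)%N && (a' %| K - J)%N then
    J`!%:R * (cffact gam ((K - J) %/ a' + l) * (b t * t ^- ((K - J) %/ a' + l))) else 0.

Lemma lift_comm (l : 'I_n) : lift ord0 (lift ord_max l) = lift ord_max (lift ord0 l) :> 'I_n.+2.
Proof. by apply: ord_inj; rewrite lift0 !lift_max lift0. Qed.

Section Reindex.
Variable i : nat.

Let wk (k : {ffun 'I_n.+1 -> nat}) :=
  (\sum_(l < n.+1 | l != ord_max) a (lift ord_max (lift ord0 l)) * k l + aN * i)%N.
Let ek (k : {ffun 'I_n.+1 -> nat}) := (J + a' * k ord_max - wk k)%N.
(** The defining sum determines the exponent e of x_1 from m_2, ..., m_N. Here e becomes free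
    instead and m_(N-1) is solved for, which explains the divisibility by a_(N-1) in [cseq]. *)
Let to_m (k : {ffun 'I_n.+1 -> nat}) : {ffun 'I_n.+1 -> nat} :=
  [ffun c => if unlift ord0 c is Some l then k (lift ord_max l) else ek k].
Let to_k (m : {ffun 'I_n.+1 -> nat}) : {ffun 'I_n.+1 -> nat} :=
  gluei [ffun l => m (lift ord0 l)] ((wt1 a m + aN * i - J) %/ a').

Let wm (m : {ffun 'I_n.+1 -> nat}) :=
  (\sum_(l < n) a (lift ord_max (lift ord_max (lift ord0 l))) * m (lift ord0 l))%N.

Let wt1_split m : wt1 a m = (m ord0 + wm m)%N.
Proof.
rewrite /wt1 big_ord_recl; congr (_ + _)%N.
suff -> : lift ord_max (lift ord_max ord0) = ord0 :> 'I_n.+3 by rewrite a_first mul1n.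
by apply: ord_inj; rewrite !lift_max.
Qed.

Let wk_split k : wk k = (\sum_(l < n) a (lift ord_max (lift ord_max (lift ord0 l))) * k (lift ord_max l) + aN * i)%N.
Proof. by rewrite /wk big_lift_max; congr (_ + _)%N; apply: eq_bigr => l _; rewrite lift_comm. Qed.

Let to_m0 k : to_m k ord0 = ek k.
Proof. by rewrite ffunE unlift_none. Qed.

Let to_mS k l : to_m k (lift ord0 l) = k (lift ord_max l).
Proof. by rewrite ffunE liftK. Qed.

Let wt1_to_m k : (wk k <= J + a' * k ord_max)%N -> (wt1 a (to_m k) + aN * i = J + a' * k ord_max)%N.
Proof.
move=> h; rewrite wt1_split to_m0 /wm (eq_bigr (fun l => a (lift ord_max (lift ord_max (lift ord0 l))) * k (lift ord_max l))%N); last first.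
  by move=> l _; rewrite to_mS.
by rewrite -addnA -wk_split /ek subnK.
Qed.

Lemma gamma_series_reindex (y : 'rV[CC R]_n.+2) s :
  has_sum (fun m : {ffun 'I_n.+1 -> nat} =>
     cseq (y 0 ord_max) (wt1 a m + aN * i) / ((mfact m)%:R * i`!%:R) *
       mon (fun c => y 0 (lift ord_max c)) m) s ->
  gamma_series a J gam b i y = s.
Proof.
move=> hs; apply: has_sum_sum; move: hs.
apply: (@has_sum_reindex _ _ _ to_m to_k (fun k => wk k <= J + a' * k ord_max)%N
  (fun m => (J <= wt1 a m + aN * i)%N && (a' %| wt1 a m + aN * i - J)%N)).
- move=> k hk; rewrite wt1_to_m // leq_addr addKn dvdn_mulr //; split=> //.
  apply/ffunP; apply: forall_lift => [l|]; rewrite ?glue_lift ?glue_max; first by rewrite ffunE to_mS.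
  by rewrite wt1_to_m // addKn mulKn.
- move=> m /andP[h1 h2].
  have e1 : (a' * to_k m ord_max = wt1 a m + aN * i - J)%N.
    by rewrite glue_max mulnC divnK.
  have e2 : wk (to_k m) = (wm m + aN * i)%N.
    by rewrite wk_split; congr (_ + _)%N; apply: eq_bigr => l _; rewrite glue_lift ffunE.
  have e3 := wt1_split m.
  split; first by rewrite e1 e2 subnKC // e3 -addnA leq_addl.
  apply/ffunP => c; case: (unliftP ord0 c) => [l ->|->].
    by rewrite to_mS glue_lift ffunE.
  by rewrite to_m0 /ek e1 e2 subnKC // e3 -addnA addnK.
- by move=> k /negPf; rewrite /wk => ->.
- by move=> m /negPf hm; rewrite /cseq hm !mul0r.
move=> k hk; rewrite /= ifT //; rewrite -/(wk k) wt1_to_m // /cseq leq_addr addKn dvdn_mulr // mulKn //=.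
rewrite -/(ek k) !big_lift_max.
have -> : mfact (to_m k) = ((ek k)`! * \prod_(l < n) (k (lift ord_max l))`!)%N.
  rewrite /mfact big_ord_recl to_m0; congr (_ * _)%N; apply: eq_bigr => l _; by rewrite to_mS.
have -> : mon (fun c => y 0 (lift ord_max c)) (to_m k) =
   y 0 ord0 ^+ ek k * \prod_(l < n) y 0 (lift ord0 (lift ord_max l)) ^+ k (lift ord_max l).
  rewrite /mon big_ord_recl to_m0; congr (_ ^+ _ * _).
    by congr (y 0 _); apply: ord_inj; rewrite lift_max.
  by apply: eq_bigr => l _; rewrite to_mS lift_comm.
rewrite natrM natr_prod !invfM; ring.
Qed.

End Reindex.

Variable p : 'rV[CC R]_n.+3.
Local Notation t0 := (p 0 (penult n)).
Hypothesis pY : p 0 ord_max = 0.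
Hypothesis t0_neq0 : t0 != 0.
Hypothesis b_branch : is_power_branch gam t0 b.

(* The point p, without its coordinate t0, as seen from (0, ..., 0, t0). *)
Definition hvec (k : 'I_n.+2) : CC R := if k == ord_max then 0 else p 0 (lift ord_max k).

Lemma hvec_max : hvec ord_max = 0. Proof. by rewrite /hvec eqxx. Qed.

Definition growA : R := J`!%:R * nm (b t0).
Definition growG : R := Num.max 1 ((nm gam + 1) / nm t0).

Lemma growA_ge0 : 0 <= growA. Proof. by rewrite mulr_ge0 ?nm_ge0. Qed.
Lemma growG_ge1 : 1 <= growG. Proof. by rewrite le_max lexx. Qed.
Lemma growGX_ge0 k : 0 <= growG ^+ k.
Proof. by rewrite exprn_ge0 // (le_trans ler01 growG_ge1). Qed.

Lemma coef_bound s :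
  nm (J`!%:R * (cffact gam s * (b t0 * t0 ^- s))) <= growA * growG ^+ s * s`!%:R.
Proof.
have n0 : 0 < nm t0 by rewrite nm_gt0.
rewrite !nmM nm_nat nmV nmX /growA.
have -> : J`!%:R * (nm (cffact gam s) * (nm (b t0) / nm t0 ^+ s)) =
   J`!%:R * nm (b t0) * (nm (cffact gam s) / nm t0 ^+ s) by ring.
rewrite -[X in _ <= X]mulrA ler_wpM2l ?mulr_ge0 ?nm_ge0 // ler_pdivrMr ?exprn_gt0 //.
apply: le_trans (nm_cffact _ _) _; rewrite mulrAC ler_wpM2r // -exprMn lerXn2r ?nnegrE //.
- by have := nm_ge0 gam; lra.
- by rewrite mulr_ge0 ?nm_ge0 //; have := growG_ge1; lra.
by rewrite -ler_pdivrMr // le_max lexx orbT.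
Qed.

Lemma grow_mono s t : (s <= t)%N ->
  growA * growG ^+ s * s`!%:R <= growA * growG ^+ t * t`!%:R.
Proof.
move=> h; have A0 := growA_ge0; apply: ler_pM => //.
- exact: (mulr_ge0 A0 (growGX_ge0 _)).
- by apply: ler_wpM2l => //; rewrite ler_weXn2l // growG_ge1.
by rewrite ler_nat leq_fact.
Qed.

Lemma bnd_mono s K : (s <= K %/ a')%N -> growA * growG ^+ s * s`!%:R <= bnd a growA growG K.
Proof. exact: grow_mono. Qed.

Lemma bnd_ge0 K : 0 <= bnd a growA growG K.
Proof. by apply: mulr_ge0 => //; apply: mulr_ge0; [exact: growA_ge0|exact: growGX_ge0]. Qed.

Lemma cseq_bound K : nm (cseq t0 K) <= bnd a growA growG K.
Proof.
rewrite /cseq; case: ifP => [/andP[h1 h2]|_]; last by rewrite nm0 bnd_ge0.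
by apply: le_trans (coef_bound _) _; apply: bnd_mono; rewrite leq_div2r // leq_subr.
Qed.

Lemma cseq_deriv_bound K l : nm (cseq_deriv t0 K l) <= bnd a growA growG (K + a' * l).
Proof.
rewrite /cseq_deriv; case: ifP => [/andP[h1 h2]|_]; last by rewrite nm0 bnd_ge0.
apply: le_trans (coef_bound _) _; apply: bnd_mono.
by rewrite divnDr ?dvdn_mulr // mulKn // leq_add2r leq_div2r // leq_subr.
Qed.

(* The two arrays differ only when K < J <= K + a' l. *)
Lemma cseq_deriv_cseq K l :
  nm (cseq_deriv t0 K l - cseq t0 (K + a' * l)) <= growA * growG ^+ l * l`!%:R.
Proof.
have g1 := growG_ge1; have A0 := growA_ge0.
have rhs0 : 0 <= growA * growG ^+ l * l`!%:R by apply: mulr_ge0 => //; apply: mulr_ge0 => //; exact: growGX_ge0.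
rewrite /cseq_deriv /cseq; case: ifP => [/andP[h1 h2]|hK].
  rewrite (leq_trans h1) ?leq_addr //= -addnBAC // dvdn_addl ?dvdn_mulr // h2.
  by rewrite divnDl // mulKn // subrr nm0.
case: ifP => [/andP[h1 h2]|_]; last by rewrite subrr nm0.
have hKJ : (K < J)%N.
  rewrite ltnNge; apply/negP => h; move: hK; rewrite h /= -addnBAC // dvdn_addl ?dvdn_mulr // in h2 *.
  by rewrite h2.
rewrite sub0r nmN; apply: le_trans (coef_bound _) _.
have hr : ((K + a' * l - J) %/ a' <= l)%N.
  by rewrite -[X in (_ <= X)%N](mulKn l ap0) leq_div2r // leq_subLR leq_add2r ltnW.
exact: grow_mono.
Qed.

(** The derivatives of i! f_i at (0, ..., 0, t0). The i derivatives in x_N enter through their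
    weight a_N i, those in x_(N-1) are kept apart. *)
Definition base_array i (al : {ffun 'I_n.+2 -> nat}) :=
  cseq_deriv t0 (wt1 a (front al) + aN * i) (al ord_max).

Lemma front_wt al : (wt1 a (front al) + a' * al ord_max)%N = fwt a al.
Proof. by rewrite -{3}(glue_front al) fwt_glue. Qed.

Lemma base_array_bound i al : nm (base_array i al) <= bnd a growA growG (aN * i + fwt a al).
Proof. by rewrite -front_wt addnC addnAC; exact: cseq_deriv_bound. Qed.

Let Rb : R := hbound hvec.

(* Expansion at (0, ..., 0, t0), on a polydisc that does not depend on i. *)
Lemma base_expansion : exists rho M Q : R, [/\ 0 < rho, 0 <= M, 1 <= Q &
  forall i, pbd (fun al => base_array i al / (mfact al)%:R) (radii Rb rho)
      (M * Q ^+ ((aN * i) %/ a') * ((aN * i) %/ a')`!%:R) /\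
   forall y : 'rV[CC R]_n.+2, (forall k, k != ord_max -> nm (y 0 k) <= Rb / 2) ->
     nm (y 0 ord_max - t0) <= rho / 2 ->
     has_sum (fun al => base_array i al / (mfact al)%:R *
          mon (fun k => y 0 k - (if k == ord_max then t0 else 0)) al)
       (i`!%:R * gamma_series a J gam b i y)].
Proof.
have [rho1 rho10 hbin] := branch_binom t0_neq0 b_branch.
have Rb1 : 1 <= Rb by exact: hbound_ge1.
have [rho2 [M [Q [rho20 M0 Q1 hp]]]] := array_bound a_first a_incr growA_ge0 growG_ge1 Rb1.
pose rho := Num.min rho1 rho2.
have rho0 : 0 < rho by rewrite lt_min rho10.
have [r1 r2] : rho <= rho1 /\ rho <= rho2 by rewrite !ge_min !lexx orbT.
exists rho, M, Q; split=> // i.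
have hb : pbd (fun al => base_array i al / (mfact al)%:R) (radii Rb rho)
      (M * Q ^+ ((aN * i) %/ a') * ((aN * i) %/ a')`!%:R).
  move=> al; apply: le_trans (hp (aN * i)%N (base_array i) (base_array_bound i) al).
  rewrite ler_wpM2l ?nm_ge0 // ler_rmon // => k; rewrite /radii.
  by case: ifP => _; rewrite ?lexx ?r2 ?andbT; lra.
split=> // y hy hyt; pose x (k : 'I_n.+2) := y 0 k - (if k == ord_max then t0 else 0).
rewrite -/x.
have [S hS] : exists S, has_sum (fun al : {ffun 'I_n.+2 -> nat} => base_array i al / (mfact al)%:R * mon x al) S.
  apply: abs_has_sum_ex => A; apply: le_trans (geo_abs_le (x := fun k => nm (x k)) A _ hb).
    by apply: ler_sum => al _; rewrite nmM nm_mon.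
  move=> k; rewrite nm_ge0 /= /radii /x; case: (eqVneq k ord_max) => [->|hk] //.
  by rewrite subr0 hy.
suff -> : gamma_series a J gam b i y = S / i`!%:R.
  by rewrite mulrC divfK // pnatr_eq0 -lt0n fact_gt0.
apply: gamma_series_reindex.
have hyt' : nm (y 0 ord_max - t0) <= rho1 by lra.
(* Summing first over the exponent of x_(N-1), each row is the binomial expansion of one term of the
   branch. *)
have := has_sum_fubini ((has_sum_glue _ _).1 hS) (t := fun m => cseq (y 0 ord_max) (wt1 a m + aN * i) / (mfact m)%:R *
   mon (fun c => y 0 (lift ord_max c)) m).
have hin m : has_sum (fun l => base_array i (gluei m l) / (mfact (gluei m l))%:R * mon x (gluei m l))
  (cseq (y 0 ord_max) (wt1 a m + aN * i) / (mfact m)%:R * mon (fun c => y 0 (lift ord_max c)) m).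
  have ex : (fun k => x (lift ord_max k)) = (fun c => y 0 (lift ord_max c)).
    by apply/funext => k; rewrite /x eq_sym (negPf (neq_lift _ _)) subr0.
  have exm : x ord_max = y 0 ord_max - t0 by rewrite /x eqxx.
  rewrite /cseq; case: ifP => hc.
    have := has_sumZ (c := J`!%:R / (mfact m)%:R * mon (fun c => y 0 (lift ord_max c)) m)
      (hbin _ hyt' ((wt1 a m + aN * i - J) %/ a')%N).
    have -> : J`!%:R / (mfact m)%:R * mon (fun c => y 0 (lift ord_max c)) m *
      (cffact gam ((wt1 a m + aN * i - J) %/ a') * (b (y 0 ord_max) * y 0 ord_max ^- ((wt1 a m + aN * i - J) %/ a'))) =
      J`!%:R * (cffact gam ((wt1 a m + aN * i - J) %/ a') *
        (b (y 0 ord_max) * y 0 ord_max ^- ((wt1 a m + aN * i - J) %/ a'))) / (mfact m)%:R *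
         mon (fun c => y 0 (lift ord_max c)) m by ring.
    apply: eq_has_sum => l.
    rewrite mon_glue ex exm /base_array front_glue glue_max /cseq_deriv hc mfact_glue natrM invfM.
    ring.
  rewrite !mul0r; apply: has_sum0 => l.
  by rewrite /base_array front_glue glue_max /cseq_deriv hc !mul0r.
move/(_ hin) => h; have := has_sumZ (c := (i`!%:R)^-1) h; rewrite mulrC; apply: eq_has_sum => m.
by rewrite invfM; ring.
Qed.

Definition gamma_array (be : {ffun 'I_n.+3 -> nat}) : CC R :=
  (mfact (front be))%:R *
    recenter (fun al => base_array (be ord_max) al / (mfact al)%:R) hvec (front be).

Definition gamma_seq : nat -> CC R := useq a hvec (cseq t0).

Lemma gamma_expansion : exists r M Q : R, [/\ 0 < r, 0 <= M, 1 <= Q &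
  forall i,
   [/\ forall ga, has_sum (shift_term (fun al => base_array i al / (mfact al)%:R) hvec ga)
        (recenter (fun al => base_array i al / (mfact al)%:R) hvec ga),
      pbd (fun ga => recenter (fun al => base_array i al / (mfact al)%:R) hvec ga / i`!%:R)
        (fun=> r) (M * Q ^+ ((aN * i) %/ a') * (((aN * i) %/ a')`!%:R / i`!%:R)) &
      expands_on r (ycoord p)
        (fun ga => recenter (fun al => base_array i al / (mfact al)%:R) hvec ga / i`!%:R)
        (gamma_series a J gam b i)]].
Proof.
have [rho [M [Q [rho0 M0 Q1 hbase]]]] := base_expansion.
(* [h_le] leaves room 1 in the other coordinates; in x_(N-1), where [hvec] vanishes, the room is rho
   / 2. *)
pose r := Num.min 1 (rho / 2).
have r0 : 0 < r by rewrite lt_min ltr01 divr_gt0.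
have [r1 r2] : r <= 1 /\ r <= rho / 2 by rewrite !ge_min !lexx orbT.
have hr k : nm (hvec k) + r <= radii Rb rho k / 2.
  rewrite /radii; case: eqP => [->|_]; first by rewrite hvec_max nm0 add0r.
  by have := h_le hvec k; rewrite -/Rb; lra.
exists r, (M * 2 ^+ n.+2), Q; split=> //; first by rewrite mulr_ge0 // exprn_ge0.
move=> i; have [hb hsum] := hbase i; have i0 : (0 : R) < i`!%:R by rewrite ltr0n fact_gt0.
split=> [ga||].
- exact: (recenter_sum (r' := fun=> r) (fun=> r0) hr hb).
- move=> ga; rewrite nmM nmV nm_nat mulrAC ler_pdivrMr //.
  apply: le_trans (recenter_bound (r' := fun=> r) (fun=> r0) hr hb ga) _.
  by rewrite le_eqVlt; apply/orP; left; apply/eqP; field; rewrite gt_eqF.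
move=> y hy.
have yk k : k != ord_max -> nm (y 0 k) <= Rb / 2.
  move=> hk; have := hy k; rewrite ycoordE; have := h_le hvec k; rewrite /hvec (negPf hk) -/Rb.
  by have := nm_dist3 (p 0 (lift ord_max k)) (y 0 k) 0; rewrite !subr0; lra.
have ym : nm (y 0 ord_max - t0) <= rho / 2 by have := hy ord_max; rewrite ycoordE; lra.
have := hsum y yk ym.
have -> : (fun k => y 0 k - (if k == ord_max then t0 else 0)) =
    (fun k => hvec k + (y 0 k - ycoord p 0 k)).
  apply/funext => k; rewrite ycoordE /hvec; case: (eqVneq k ord_max) => [->|_]; last by ring.
  by rewrite add0r.
move/(recenter_has_sum (r' := fun=> r) (fun=> r0) hr hb hy) => h.
have := has_sumZ (c := (i`!%:R)^-1) h; set g := gamma_series _ _ _ _ _ _.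
have -> : (i`!%:R)^-1 * (i`!%:R * g) = g.
  by rewrite mulrA mulVf ?mul1r // pnatr_eq0 -lt0n fact_gt0.
by apply: eq_has_sum => ga; rewrite mulrA [_^-1 * _]mulrC.
Qed.

Lemma gamma_formal : formal_germ p (gamma_series a J gam b).
Proof.
have [r [M [Q [r0 M0 Q1 h]]]] := gamma_expansion.
apply/nbhs_rowP; exists (r / 4); first by rewrite divr_gt0.
move=> y hy i; have [_ hb he] := h i.
exists (recenter (fun ga => recenter (fun al => base_array i al / (mfact al)%:R) hvec ga / i`!%:R)
  (fun k => y 0 k - ycoord p 0 k)).
apply: (@expands_on_expands _ _ (r / 4)); first by rewrite divr_gt0.
by apply: expands_on_recenter hb he _ => // k; exact: ltW.
Qed.

Lemma gamma_tayd : tayd p (gamma_series a J gam b) gamma_array.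
Proof.
have [r [M [Q [r0 M0 Q1 h]]]] := gamma_expansion.
move=> i; have [_ _ he] := h i; move: (expands_on_expands r0 he); apply: expands_ext => ga.
rewrite /gamma_array front_glue glue_max.
rewrite mfact_glue natrM invfM; field.
by rewrite !pnatr_eq0 -!lt0n fact_gt0 mfact_gt0.
Qed.

(** As [hvec] is 0 in the direction x_(N-1), only al with al_(N-1) = 0 count, and there the two sums
    differ by [cseq_deriv] against [cseq]. This difference is bounded in terms of the order in
    x_(N-1) alone, and the sum of |h|^al / al! is finite. *)
Lemma gamma_array_seq : convarr (fun be => gamma_array be - gamma_seq (wt a be)).
Proof.
have [r [M [Q [r0 M0 Q1 h]]]] := gamma_expansion.
have [E E0 hE] := @exp_sum_bound R n.+2 (fun k => nm (hvec k)) (fun k => nm_ge0 _).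
have g1 := growG_ge1; have A0 := growA_ge0.
exists (growA * E), growG; split=> //; first exact: mulr_ge0.
elim/ffun_lift_ind => ga i; have [hs _ _] := h i.
have s1 := recenter_fact (hs ga).
have s2 := useq_sum a_first a_incr (hvec_max) A0 g1 (k := wt a (gluei ga i)) cseq_bound.
rewrite /gamma_array front_glue glue_max /gamma_seq.
have := has_sumD s1 (has_sumZ (c := -1) s2); rewrite mulN1r => s3.
have Gl : growG ^+ ga ord_max <= growG ^+ deg (gluei ga i).
  by rewrite ler_weXn2l // deg_glue (leq_trans (leq_deg _ _)) // leq_addr.
have Fl : ((ga ord_max)`!%:R : R) <= (deg (gluei ga i))`!%:R.
  by rewrite ler_nat leq_fact // deg_glue (leq_trans (leq_deg _ ord_max)) // leq_addr.
have G0 := growGX_ge0.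
apply: le_trans (has_sum_le s3 (M := growA * growG ^+ ga ord_max * (ga ord_max)`!%:R * E) _) _; last first.
  have -> : growA * growG ^+ ga ord_max * (ga ord_max)`!%:R * E =
    growA * E * (growG ^+ ga ord_max * (ga ord_max)`!%:R) by ring.
  by rewrite -[X in _ <= X]mulrA; apply: ler_wpM2l; [exact: mulr_ge0|exact: ler_pM].
move=> A; apply: le_trans (ler_wpM2l _ (hE A)); last by apply: mulr_ge0 => //; apply: mulr_ge0.
rewrite mulr_sumr; apply: ler_sum => al _.
have -> : base_array i (addi al ga) * mon hvec al / (mfact al)%:R +
   -1 * (cseq t0 (wt a (gluei ga i) + fwt a al)%N * mon hvec al / (mfact al)%:R) =
   (base_array i (addi al ga) - cseq t0 (wt a (gluei ga i) + fwt a al)%N) * (mon hvec al / (mfact al)%:R) by ring.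
rewrite nmM [nm (mon _ _ / _)]nmM nmV nm_nat nm_mon.
case: (posnP (al ord_max)) => hal; last first.
  have -> : rmon (fun k => nm (hvec k)) al = 0.
    by rewrite /rmon (bigD1 ord_max) //= hvec_max nm0 expr0n gtn_eqF // mul0r.
  by rewrite mul0r !mulr0.
rewrite ler_wpM2r //; first by rewrite divr_ge0 // rmon_ge0 // => k; exact: nm_ge0.
have -> : base_array i (addi al ga) = cseq_deriv t0 (wt1 a (front (addi al ga)) + aN * i) (ga ord_max).
  by rewrite /base_array [addi al ga ord_max]ffunE hal.
have -> : (wt a (gluei ga i) + fwt a al = wt1 a (front (addi al ga)) + aN * i + a' * ga ord_max)%N.
  rewrite wt_glue addnAC -fwtD (addiC ga al) -front_wt [addi al ga ord_max]ffunE hal add0n.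
  by rewrite addnAC.
exact: cseq_deriv_cseq.
Qed.

End GammaSeries.

(** * Gevrey order of the Gamma-series *)

Lemma expn_fact_le y k : (y`! ^ k <= (k * y)`!)%N.
Proof.
elim: k => [|k IH]; first by rewrite expn0 mul0n.
by rewrite expnS mulSn; apply: leq_trans (leq_mul (leqnn _) IH) (fact_add_le _ _).
Qed.

Lemma fact_mul_le k i : ((k * i)`! <= 2 ^ (k * (k * i)) * i`! ^ k)%N.
Proof.
have := fact_sum_ge (nseq k tt) (fun=> i).
by rewrite !big_const_seq count_predT size_nseq !iter_addn_0 iter_muln_1 [(i * k)%N]mulnC.
Qed.

(** Taking l-th powers removes the quotient: for y = k i / l one has (y!)^l <= (l y)! <= (k i)!,
    which is at most exponential times (i!)^k. *)
Lemma fact_div_powR (R : realType) k l i (r : R) : (0 < l)%N -> k%:R / l%:R <= r ->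
  ((k * i) %/ l)`!%:R <= (2 ^+ (k * k)) ^+ i * (i`!%:R : R) `^ r.
Proof.
move=> l0 hr; have l0' : 0 < l%:R :> R by rewrite ltr0n.
have i1 : 1 <= i`!%:R :> R by rewrite ler1n fact_gt0.
have X1 : 1 <= (2 ^+ (k * k)) ^+ i :> R by rewrite -exprM exprn_ege1 // ler1n.
have P0 : 0 <= (i`!%:R : R) `^ r by exact: powR_ge0.
have X0 : 0 <= (2 ^+ (k * k)) ^+ i :> R by lra.
rewrite -(@ler_pXn2r _ l) ?nnegrE ?mulr_ge0 // exprMn -[(_ `^ r) ^+ l]powR_mulrn // -powRrM.
apply: (@le_trans _ _ ((2 ^+ (k * k)) ^+ i * i`!%:R ^+ k)); last first.
  apply: ler_pM; rewrite ?exprn_ge0 //; first by rewrite -[X in X <= _]expr1 ler_weXn2l.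
  by rewrite -[_ ^+ k]powR_mulrn // ler_powR // -ler_pdivrMr.
rewrite -!exprM -!natrX -natrM ler_nat -mulnA.
apply: leq_trans (expn_fact_le _ _) (leq_trans _ (fact_mul_le k i)).
by rewrite leq_fact // mulnC leq_divM.
Qed.

Lemma formal_scale (R : realType) m (p : 'rV[CC R]_m.+1) (f : fseries R m) (c : nat -> CC R) :
  formal_germ p f -> formal_germ p (fun i y => f i y * c i).
Proof.
apply: filterS => y h i; have [C hC] := h i; exists (fun al => c i * C al).
have := expandsZ (c i) (hC : expands y C (f i)).
by apply: filterS => x; rewrite [f i x * _]mulrC.
Qed.

Lemma tay_scale (R : realType) m (p : 'rV[CC R]_m.+1) (f : fseries R m) C (c : nat -> CC R) :
  tay p f C -> tay p (fun i y => f i y * c i) (fun be => C be * c (be ord_max)).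
Proof.
move=> h i; have := expandsZ (c i) (h i).
have -> : (fun y => f i y * c i) = (fun y => c i * f i y) by apply/funext => x; rewrite mulrC.
by apply: expands_ext => al; rewrite glue_max mulrC.
Qed.

Section GammaGevrey.
Variables (R : realType) (n : nat) (a : 'I_n.+3 -> nat).
Hypothesis a_first : a ord0 = 1%N.
Hypothesis a_incr : forall i j : 'I_n.+3, (i < j)%N -> (a i < a j)%N.
Local Notation aN := (a ord_max).
Local Notation a' := (a (penult n)).
Variables (J : nat) (gam : CC R) (b : CC R -> CC R).
Variable p : 'rV[CC R]_n.+3.
Local Notation t0 := (p 0 (penult n)).
Hypothesis pY : p 0 ord_max = 0.
Hypothesis t0_neq0 : t0 != 0.
Hypothesis b_branch : is_power_branch gam t0 b.

(** The coefficient of x_N^i grows like (a_N i / a_(N-1))! / i!, which is at most exponential times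
    (i!)^(s - 1) for s >= a_N / a_(N-1). *)
Lemma gamma_gevrey (s : \bar R) : ((aN%:R / a'%:R)%:E <= s)%E ->
  gevrey_germ s p (gamma_series a J gam b).
Proof.
have ap0 := ap_gt0 a_first a_incr.
have hf := gamma_formal a_first a_incr J t0_neq0 b_branch.
move=> hs; split=> // r er; move: hs; rewrite er lee_fin {er} => hr.
have [r1 [M [Q [r10 M0 Q1 h]]]] := gamma_expansion a_first a_incr J t0_neq0 b_branch.
pose c i : CC R := (((i`!%:R : R) `^ (r - 1))%:C%C)^-1.
pose C (be : {ffun 'I_n.+3 -> nat}) : CC R :=
  recenter (fun al => base_array a J gam b p (be ord_max) al / (mfact al)%:R) (hvec p) (front be)
    / (be ord_max)`!%:R.
have hC : tay p (gamma_series a J gam b) C.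
  move=> i; have [_ _ he] := h i; move: (expands_on_expands r10 he); apply: expands_ext => ga.
  by rewrite /C glue_max front_glue.
(* The two exponential bases, from the expansion and from the comparison of factorials; 1 / X is an
   admissible radius in x_N. *)
pose X : R := Q ^+ aN * 2 ^+ (aN * aN).
have X1 : 1 <= X by rewrite mulr_ege1 // exprn_ege1 // ler1n.
pose rho := Num.min r1 X^-1.
have rho0 : 0 < rho by rewrite lt_min r10 invr_gt0; lra.
have [rh1 rh2] : rho <= r1 /\ rho <= X^-1 by rewrite !ge_min !lexx orbT.
apply: (bound_convergent (r := rho) (M := M) pY (formal_scale c hf) (tay_scale c hC)) => //.
elim/ffun_lift_ind => ga i; have [_ hb _] := h i.
rewrite rmon_glue /C glue_max front_glue nmM.
set y := recenter _ _ _ / _; set P := (i`!%:R : R) `^ (r - 1).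
have P0 : 0 < P by rewrite powR_gt0 // ltr0n fact_gt0.
have -> : nm (c i) = P^-1 by rewrite /c nmV nm_real gtr0_norm.
have rm0 : 0 <= rmon (fun=> rho) ga by apply: rmon_ge0 => _; exact: ltW.
have le1 : nm y * rmon (fun=> rho) ga <= M * Q ^+ (aN * i %/ a') * ((aN * i %/ a')`!%:R / i`!%:R).
  apply: le_trans (hb ga); rewrite ler_wpM2l ?nm_ge0 // ler_rmon // => _; rewrite rh1 andbT; exact: ltW.
have le2 : (aN * i %/ a')`!%:R / i`!%:R / P <= (2 ^+ (aN * aN)) ^+ i.
  have i0 : (0 : R) < i`!%:R by rewrite ltr0n fact_gt0.
  rewrite !ler_pdivrMr // -mulrA; apply: le_trans (fact_div_powR i ap0 hr) _.
  rewrite ler_wpM2l ?exprn_ge0 //.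
  have -> : r = r - 1 + 1 by rewrite subrK.
  rewrite powRD; last by rewrite (gt_eqF i0) implybT.
  by rewrite powRr1 // ltW.
have le3 : Q ^+ (aN * i %/ a') <= (Q ^+ aN) ^+ i by rewrite -exprM ler_weXn2l // leq_div.
have le4 : X ^+ i * rho ^+ i <= 1.
  rewrite -exprMn exprn_ile1 //; first by rewrite mulr_ge0 // ltW //; lra.
  by apply: le_trans (ler_wpM2l _ rh2) _; rewrite ?divff //; lra.
have -> : nm y / P * (rmon (fun=> rho) ga * rho ^+ i) = nm y * rmon (fun=> rho) ga * (P^-1 * rho ^+ i) by ring.
have Pr : 0 <= P^-1 * rho ^+ i by apply: mulr_ge0; rewrite ?invr_ge0 ?exprn_ge0 // ltW.
apply: le_trans (ler_wpM2r Pr le1) _.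
have -> : M * Q ^+ (aN * i %/ a') * ((aN * i %/ a')`!%:R / i`!%:R) * (P^-1 * rho ^+ i) =
  M * (Q ^+ (aN * i %/ a') * ((aN * i %/ a')`!%:R / i`!%:R / P) * rho ^+ i) by ring.
rewrite -[X in _ <= X]mulr1 ler_wpM2l //; apply: le_trans le4.
have rX : 0 <= rho ^+ i by rewrite exprn_ge0 // ltW.
rewrite ler_wpM2r // /X exprMn; apply: ler_pM => //.
  by rewrite exprn_ge0 //; lra.
by rewrite !divr_ge0 // ltW.
Qed.

End GammaGevrey.

(** * The sequences of the Gamma-series *)

Lemma branch_neq0 (R : realType) (gam z0 : CC R) b : is_power_branch gam z0 b -> b z0 != 0.
Proof. by case=> log /nbhs_singleton[_ _ ->]; exact: cexp_neq0. Qed.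

Lemma cffact_nat_eq0 (R : realType) m r : (m < r)%N -> cffact (m%:R : CC R) r = 0.
Proof.
move=> h; rewrite /cffact (bigD1 (Ordinal h)) //= subrr mul0r //.
Qed.

Lemma cffact_nat_neq0 (R : realType) m : cffact (m%:R : CC R) m != 0.
Proof. by apply/prodf_neq0 => l _; rewrite subr_eq0 eqr_nat gtn_eqF. Qed.

Section GammaKernel.
Variables (R : realType) (n : nat) (a : 'I_n.+3 -> nat).
Hypothesis a_first : a ord0 = 1%N.
Hypothesis a_incr : forall i j : 'I_n.+3, (i < j)%N -> (a i < a j)%N.
Local Notation a' := (a (penult n)).
Variables (p : 'rV[CC R]_n.+3) (beta : CC R).
Local Notation t0 := (p 0 (penult n)).
Hypothesis t0_neq0 : t0 != 0.

Let ap0 : (0 < a')%N := ap_gt0 a_first a_incr.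
Let hm : hvec p ord_max = 0 := hvec_max p.

(** Only al = 0 has weight 0; all other terms involve entries of c beyond k. *)
Lemma useq_top (c : nat -> CC R) k : (forall K, (k < K)%N -> c K = 0) ->
  useq a (hvec p) c k = c k.
Proof.
move=> hc; apply: has_sum_sum; apply: eq_has_sum (has_sum_single zeroi (c k)) => al.
case: eqP => [->|/eqP al0].
  by rewrite (eqP (_ : fwt a zeroi == 0)%N) ?fwt_eq0 // addn0 mon0 mfact0 mulr1 divr1.
rewrite hc ?mul0r // -[X in (X < _)%N]addn0 ltn_add2l lt0n fwt_eq0 //.
Qed.

Section OneSeries.
Variables (J : nat) (gam : CC R) (b : CC R -> CC R).
Hypothesis gam_eq : a'%:R * gam = beta - J%:R.
Local Notation c := (cseq a J gam b t0).

(** Along J, J + a_(N-1), ... this is (gam)_(r+1) = (gam)_r (gam - r). At K = J - a_(N-1), if it is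
    a natural number, the first entry has no predecessor to cancel it, and a defect remains. *)
Lemma cseq_rec K : a'%:R * t0 * c (K + a')%N + (K%:R - beta) * c K =
  if (K + a' == J)%N then a'%:R * t0 * (J`!%:R * b t0) else 0.
Proof.
case hK : ((J <= K)%N && (a' %| K - J)%N).
  have [JK dv] := andP hK; have e := divnK dv.
  rewrite gtn_eqF; last by rewrite (leq_ltn_trans JK) // -[X in (X < _)%N]addn0 ltn_add2l.
  rewrite /cseq hK (leq_trans JK) ?leq_addr //= -addnBAC // dvdn_addl // dv divnDr //.
  rewrite divnn ap0 addn1; set r := ((K - J) %/ a')%N in e *.
  have -> : beta = a'%:R * gam + J%:R by rewrite gam_eq subrK.
  have -> : K%:R = r%:R * a'%:R + J%:R :> CC R by rewrite -natrM -natrD e subnK.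
  rewrite cffactS exprS; field; rewrite t0_neq0 expf_neq0 //.
rewrite /cseq hK mulr0 addr0; case: eqP => [KJ|KJ].
  by rewrite KJ leqnn subnn dvdn0 div0n /= /cffact big_ord0 expr0 invr1 mulr1 mul1r.
case: ifP => [/andP[h1 h2]|_]; last by rewrite mulr0.
move: hK; case: (leqP J K) => h.
  by rewrite -addnBAC // dvdn_addl // in h2; rewrite h2.
have : (K + a' - J < a')%N by rewrite ltn_subLR // ltn_add2r.
case: (posnP (K + a' - J)) => [e|h0 h3]; last by rewrite gtnNdvd in h2.
by case: KJ; apply/eqP; rewrite eqn_leq h1 andbT -subn_eq0 e.
Qed.

Hypothesis b_branch : is_power_branch gam t0 b.
Local Notation u := (gamma_seq a J gam b p).

Let Top_sum k : has_sum (fun al : {ffun 'I_n.+2 -> nat} =>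
  (if (k + fwt a al + a' == J)%N then a'%:R * t0 * (J`!%:R * b t0) else 0) *
    (mon (hvec p) al / (mfact al)%:R)) (Top a beta p u k).
Proof.
have hj j : j != ord_max -> p 0 (lift ord_max j) = hvec p j by rewrite /hvec => /negPf->.
have := Top_useq a_first a_incr hm (growA_ge0 J b p) (growG_ge1 gam p)
  (beta := beta) (k := k) (cseq_bound a J gam b t0_neq0) hj.
by apply: eq_has_sum => al; rewrite cseq_rec.
Qed.

Lemma Top_gamma_seq0 k : (J < k + a')%N -> Top a beta p u k = 0.
Proof.
move=> h; apply: (has_sum_uniq (@Top_sum k)); apply: has_sum0 => al.
by rewrite gtn_eqF ?mul0r // (leq_trans h) // addnAC leq_addr.
Qed.

Lemma Top_gamma_seq_neq0 k : J = (k + a')%N -> Top a beta p u k != 0.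
Proof.
move=> h; have -> : Top a beta p u k = a'%:R * t0 * (J`!%:R * b t0).
  apply: (has_sum_uniq (@Top_sum k)).
  apply: eq_has_sum (has_sum_single zeroi _) => al.
  have -> : (k + fwt a al + a' == J)%N = (al == zeroi).
    by rewrite h eqn_add2r -[X in (_ == X)%N]addn0 eqn_add2l fwt_eq0.
  case: eqP => [->|_]; last by rewrite mul0r.
  by rewrite mon0 mfact0 divr1 mulr1.
by rewrite !mulf_neq0 ?pnatr_eq0 -?lt0n ?fact_gt0 // (branch_neq0 b_branch).
Qed.

Section Natural.
Variables (m : nat).
Hypothesis gam_nat : gam = m%:R.

Let cseq0 K : (J + a' * m < K)%N -> c K = 0.
Proof.
move=> h; rewrite /cseq; case: ifP => // /andP[h1 h2].
rewrite gam_nat cffact_nat_eq0 ?mul0r ?mulr0 //.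
by rewrite -(ltn_pmul2l ap0) [X in (_ < X)%N]mulnC divnK // ltn_subRL.
Qed.

(** (m)_r = 0 for r > m: this is the sequence of the polynomial solution, whose last index is J +
    a_(N-1) m. *)
Lemma gamma_seq_nat0 k : (J + a' * m < k)%N -> u k = 0.
Proof. by move=> h; rewrite /gamma_seq useq_top ?cseq0 // => K hK; rewrite cseq0 // (ltn_trans h). Qed.

Lemma gamma_seq_nat_neq0 : u (J + a' * m)%N != 0.
Proof.
rewrite /gamma_seq useq_top // /cseq leq_addr addKn dvdn_mulr // mulKn //= gam_nat.
rewrite !mulf_neq0 ?pnatr_eq0 -?lt0n ?fact_gt0 ?cffact_nat_neq0 ?(branch_neq0 b_branch) //.
by rewrite invr_eq0 expf_neq0.
Qed.

End Natural.
End OneSeries.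

Lemma cseq_small j gam b k : (j < a')%N -> (k < a')%N ->
  cseq a j gam b t0 k = if k == j then j`!%:R * b t0 else 0.
Proof.
move=> hj hk; rewrite /cseq; case: (eqVneq k j) => [->|kj].
  by rewrite leqnn subnn dvdn0 div0n /= /cffact big_ord0 expr0 invr1 mulr1 mul1r.
case: ifP => // /andP[h1]; rewrite gtnNdvd //; first by rewrite subn_gt0 ltn_neqAle eq_sym kj.
by rewrite (leq_ltn_trans (leq_subr _ _)).
Qed.

(** A relation between the recentered sequences passes to the base point by [useq_inj]; there the
    first a_(N-1) entries form a diagonal matrix with nonzero diagonal. *)
Lemma gamma_seq_free (gam : 'I_a' -> CC R) (b : 'I_a' -> CC R -> CC R) :
  (forall j, is_power_branch (gam j) t0 (b j)) ->
  forall lam : 'I_a' -> CC R, (forall k, \sum_j lam j * gamma_seq a j (gam j) (b j) p k = 0) ->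
  forall j, lam j = 0.
Proof.
move=> hb lam h j0; pose c K := \sum_j lam j * cseq a j (gam j) (b j) t0 K.
(* Constants common to the whole combination, whose members have different exponents and
   branches. *)
pose A := \sum_(j < a') nm (lam j) * growA j (b j) p.
pose G : R := 1 + \sum_j growG (gam j) p.
have G0 j : 0 <= growG (gam j) p by apply: le_trans (growG_ge1 _ _).
have A0 : 0 <= A by apply: sumr_ge0 => j _; apply: mulr_ge0; [exact: nm_ge0|exact: growA_ge0].
have G1 : 1 <= G by rewrite lerDl sumr_ge0.
have Gj j : growG (gam j) p <= G.
  by rewrite /G (bigD1 j) //= addrCA lerDl addr_ge0 // sumr_ge0.
have cb K : nm (c K) <= bnd a A G K.
  apply: le_trans (nm_sum _ _ _) _; rewrite /bnd /A -mulrA mulr_suml; apply: ler_sum => j _.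
  rewrite nmM -mulrA; apply: ler_wpM2l; first exact: nm_ge0.
  apply: le_trans (cseq_bound a j (gam j) (b j) t0_neq0 K) _.
  rewrite /bnd -mulrA; apply: ler_wpM2l; first exact: growA_ge0.
  by apply: ler_wpM2r => //; rewrite lerXn2r ?nnegrE // (le_trans ler01).
have c0 K : c K = 0.
  apply: (useq_inj a_first a_incr hm A0 G1 cb) => k.
  rewrite -(h k); apply: has_sum_uniq (useq_sum a_first a_incr hm A0 G1 (k := k) cb) _.
  have H j := has_sumZ (c := lam j) (useq_sum a_first a_incr hm (growA_ge0 j (b j) p)
    (growG_ge1 (gam j) p) (k := k) (cseq_bound a j (gam j) (b j) t0_neq0)).
  have := has_sum_big (r := index_enum _) (P := predT) (fun j _ => H j).
  apply: eq_has_sum => al; rewrite /c !mulr_suml; apply: eq_bigr => j _; ring.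
have := c0 j0; rewrite /c (bigD1 j0) //= cseq_small // eqxx big1 ?addr0; last first.
  by move=> j hj; rewrite cseq_small // eq_sym (negPf (_ : nat_of_ord j != j0)) ?mulr0 //.
move/eqP; rewrite !mulf_eq0 (negPf (branch_neq0 (hb j0))) pnatr_eq0 orbF.
by rewrite -[(j0 `! == 0)%N]negbK -lt0n fact_gt0 orbF => /eqP.
Qed.

End GammaKernel.

(** * The solution spaces *)

(** The logarithm that defines the given branch serves for z^-1 too. *)
Lemma branch_inv (R : realType) (gam z0 : CC R) b :
  is_power_branch gam z0 b -> is_power_branch (- 1) z0 (fun z => z^-1).
Proof.
case=> log h; exists log; apply: filterS h => z [hc e _]; split=> //.
by rewrite mulN1r -{1}e; apply: (mulIf (cexp_neq0 (log z))); rewrite cexpN mulVf // cexp_neq0.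
Qed.

Section Assembly.
Variables (R : realType) (n : nat) (a : 'I_n.+3 -> nat).
Hypothesis a_first : a ord0 = 1%N.
Hypothesis a_incr : forall i j : 'I_n.+3, (i < j)%N -> (a i < a j)%N.
Local Notation a' := (a (penult n)).
Variables (beta : CC R) (p : 'rV[CC R]_n.+3).
Hypothesis pY : p 0 ord_max = 0.

(** The dictionary between germs and sequences: the arrays of the Phi j differ from V_(wt) by
    convergent ones, so generation and independence modulo convergent germs become the last two
    hypotheses. *)
Lemma ext0_of_sequences (s : \bar R) d (Phi : 'I_d -> fseries R n.+2)
    (D : 'I_d -> {ffun 'I_n.+3 -> nat} -> CC R) (V : 'I_d -> nat -> CC R) :
  (forall j, gevrey_germ s p (Phi j)) ->
  (forall j, tayd p (Phi j) (D j)) ->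
  (forall j, convarr (fun be => D j be - V j (wt a be))) ->
  (forall j, Sq a (Top a beta p (V j))) ->
  (forall u, Sq a (Top a beta p u) ->
     exists lam, Sq a (fun k => u k - \sum_j lam j * V j k)) ->
  (forall lam, Sq a (fun k => \sum_j lam j * V j k) -> forall j, lam j = 0) ->
  ext0_direct_sum a beta s p Phi.
Proof.
move=> hG hT hV hS span free.
have hF j : formal_germ p (Phi j) by case: (hG j).
have sumV lam : convarr (fun be => \sum_j lam j * (D j be - V j (wt a be))).
  by apply: carr_sum => j; apply: carrZ.
split=> // [f [ff _]|lam].
- have [e he] := formal_tayd ff.
  rewrite (annihilatedP a beta pY ff he).
  have lin lam : convergent_germ p (fun i y => f i y - \sum_j lam j * Phi j i y) <->
      convarr (fun be => e be - \sum_j lam j * D j be).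
    have -> : (fun i y => f i y - \sum_j lam j * Phi j i y) =
              (fun i y => 1 * f i y + \sum_j (- lam j) * Phi j i y).
      apply/funext => i; apply/funext => y; rewrite mul1r -sumrN; congr (_ + _).
      by apply: eq_bigr => j _; rewrite mulNr.
    have -> : (fun be => e be - \sum_j lam j * D j be) =
              (fun be => 1 * e be + \sum_j (- lam j) * D j be).
      apply/funext => be; rewrite mul1r -sumrN; congr (_ + _).
      by apply: eq_bigr => j _; rewrite mulNr.
    exact: (carr_germP pY (formal_lin (fun j => - lam j) 1 ff hF) (tayd_lin (fun j => - lam j) 1 he hT)).
  split=> [/(annihilatedD_reduce a_first a_incr pY)[u [hu Tu]]|[lam /lin hlam]].
    have [lam hlam] := span u Tu; exists lam; apply/lin.
    have := carrB (carrD hu ((carr_wt a_first a_incr _).2 hlam)) (sumV lam).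
    apply: carr_ext => be /=; rewrite addrA subrK -addrA -opprD; congr (_ - _).
    by rewrite -big_split; apply: eq_bigr => j _; rewrite /=; ring.
  have -> : e = (fun be => (e be - \sum_j lam j * D j be) + \sum_j lam j * D j be).
    by apply/funext => be; rewrite subrK.
  apply: annihilatedD_add; first exact: annihilatedD_conv.
  by apply: annihilatedD_sum => j; apply: (annihilatedD_seq a_first a_incr pY (hV j)).
move=> hc j; apply: free; apply/(carr_wt a_first a_incr).
have hd : convarr (fun be => 0 * D j be + \sum_k lam k * D k be).
  apply/(carr_germP pY (formal_lin lam 0 (hF j) hF) (tayd_lin lam 0 (hT j) hT)).
  have -> // : (fun i y => 0 * Phi j i y + \sum_k lam k * Phi k i y) =
     (fun i y => \sum_k lam k * Phi k i y).
  by apply/funext => i; apply/funext => y; rewrite mul0r add0r.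
apply: carr_ext (carrB hd (sumV lam)) => be /=; rewrite mul0r add0r -sumrN -big_split.
by apply: eq_bigr => k _; rewrite /=; ring.
Qed.

End Assembly.

Theorem theorem4p23 (R : realType) (n : nat) (a : 'I_n.+3 -> nat)
    (a_first : a ord0 = 1%N)
    (a_incr : forall i j : 'I_n.+3, (i < j)%N -> (a i < a j)%N)
    (beta : CC R) (p : 'rV[CC R]_n.+3)
    (pY : p 0 ord_max = 0) (pZ : p 0 (penult n) != 0)
    (s : \bar R)
    (s_ge : (((a ord_max)%:R / (a (penult n))%:R)%:E <= s)%E)
    (b : 'I_(a (penult n)) -> CC R -> CC R)
    (b_branch : forall j : 'I_(a (penult n)),
       is_power_branch (vexp a beta j) (p 0 (penult n)) (b j)) :
  (~ is_natC beta ->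
     ext0_direct_sum a beta s p
       (fun j : 'I_(a (penult n)) => phi_v a beta (b j) j)) /\
  (forall beta0 : nat, beta = beta0%:R ->
     exists q : 'I_(a (penult n)),
       [/\ is_natC (vexp a beta q),
           forall q' : 'I_(a (penult n)), is_natC (vexp a beta q') -> q' = q
         & ext0_direct_sum a beta s p
             (fun j : 'I_(a (penult n)) =>
                if j == q then phi_vtilde a beta0
                else phi_v a beta (b j) j)]).

Proof.
have ap0 := ap_gt0 a_first a_incr.
have ap_neq0 : (a (penult n))%:R != 0 :> CC R by rewrite pnatr_eq0 -lt0n.
have vexpE j : (a (penult n))%:R * vexp a beta j = beta - j%:R.
  by rewrite /vexp mulrC divfK.
pose U (j : 'I_(a (penult n))) := gamma_seq a j (vexp a beta j) (b j) p.
have U_ker j k : Top a beta p (U j) k = 0.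
  (* As j < a_(N-1), no index k satisfies k + a_(N-1) = j: the recursion has no defect. *)
  by apply: (Top_gamma_seq0 a_first a_incr pZ _ (vexpE j)); rewrite ltn_addl.
have U_free := gamma_seq_free a_first a_incr pZ b_branch.
have SU j : Sq a (Top a beta p (U j)) by apply: (@Sq_fin _ _ _ 0) => k _.
have hG (j : 'I_(a (penult n))) := gamma_gevrey a_first a_incr j pY pZ (b_branch j) s_ge.
have hT (j : 'I_(a (penult n))) := gamma_tayd a_first a_incr j pZ (b_branch j).
have hA (j : 'I_(a (penult n))) := gamma_array_seq a_first a_incr j pZ (b_branch j).
split=> [beta_nat|b0 beta_b0].
  have off k : k%:R != beta by apply/eqP => e; apply: beta_nat; exists k.
  apply: (ext0_of_sequences a_first a_incr pY hG hT hA SU) => [u|lam].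
    exact: (span_generic a_first a_incr pZ U_ker U_free off).
  exact: (free_generic a_first a_incr U_ker U_free off).
pose q := Ordinal (ltn_pmod b0 ap0); pose m := (b0 %/ a (penult n))%N.
have qm : (q + a (penult n) * m)%N = b0 by rewrite addnC mulnC -divn_eq.
have vq : vexp a beta q = m%:R.
  by apply: (mulfI ap_neq0); rewrite vexpE beta_b0 -{1}qm natrD natrM addrC addKr.
exists q; split; first by exists m.
  move=> q' [k hk]; apply: val_inj => /=.
  have : b0 = (k * a (penult n) + q')%N.
    apply/eqP; rewrite -(eqr_nat (CC R)) natrD natrM -beta_b0 -hk mulrC vexpE subrK //.
  by move=> ->; rewrite modnMDl modn_small.
have binv := branch_inv (b_branch q).
pose V := gamma_seq a (b0 + a (penult n)) (- 1) (fun z => z^-1) p.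
(* The exponent vector (beta + a_(N-1), 0, ..., 0, -1, 0) also has weight beta. Its progression
   starts a_(N-1) above beta, which puts the defect of [cseq_rec] at the index beta. *)
have Veq : (a (penult n))%:R * (- 1) = beta - (b0 + a (penult n))%:R.
  by rewrite beta_b0 natrD opprD addNKr mulrN1.
have V_small k : (b0 < k)%N -> Top a beta p V k = 0.
  by move=> h; apply: (Top_gamma_seq0 a_first a_incr pZ _ Veq); rewrite ltn_add2r.
have V_top : Top a beta p V b0 != 0 := Top_gamma_seq_neq0 a_first a_incr pZ Veq binv erefl.
have Uq_small k : (b0 < k)%N -> U q k = 0.
  by move=> h; apply: (gamma_seq_nat0 a_first a_incr p _ vq); rewrite qm.
have Uq_top : U q b0 != 0.
  by have := gamma_seq_nat_neq0 a_first a_incr pZ q (b_branch q) vq; rewrite qm.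
pose W j := if j == q then V else U j.
apply: (@ext0_of_sequences _ _ _ a_first a_incr _ _ pY _ _ _
  (fun j => if j == q then gamma_array a (b0 + a (penult n)) (- 1) (fun z => z^-1) p
            else gamma_array a j (vexp a beta j) (b j) p) W).
- move=> j; case: ifP => _; last exact: hG.
  exact: (gamma_gevrey a_first a_incr _ pY pZ binv s_ge).
- move=> j; case: ifP => _; last exact: hT.
  exact: (gamma_tayd a_first a_incr _ pZ binv).
- move=> j; rewrite /W; case: ifP => _; last exact: hA.
  exact: (gamma_array_seq a_first a_incr _ pZ binv).
- move=> j; rewrite /W; case: ifP => _; last exact: SU.
  by apply: (@Sq_fin _ _ _ b0.+1) => k; exact: V_small.
- move=> u; exact: (span_resonant a_first a_incr pZ U_ker U_free beta_b0 Uq_small V_small V_top).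
- move=> lam; exact: (free_resonant a_first a_incr U_ker U_free beta_b0 Uq_small Uq_top V_small V_top).
Qed.
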